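(* Assume the following. (a) $l$ is continuous on $H\times\Lambda_0$ and there is $C>0$ such that $|l(x,a)-l(x',a)|\le C\|x-x'\|_H$, $|l(x,a)|\le C(1+\|x\|_H+\|a\|_\Lambda^2)$ and $|g(x)-g(x')|\le C\|x-x'\|_H$ for all $x,x'\in H$, $a\in\Lambda_0$; moreover, if $\Lambda_0$ is unbounded, $l$ and $g$ are bounded from below. (b) $b:H\times\Lambda\to H$ and $\sigma:H\times\Lambda\to L_2(\Xi,H)$ are affine and continuous. (c) $l:H\times\Lambda_0\to\mathbb R$ and $g:H\to\mathbb R$ are convex. Then, for every $t\in[0,T]$, the function $V(t,\cdot)$ is convex.
   Context: $H$ and $\Xi$ are real separable Hilbert spaces, $\Lambda$ is a real separable Banach space, $\Lambda_0\subset\Lambda$ is convex, $p>2$ and $0<T<\infty$ are fixed. $L_2(\Xi,H)$ is the space of Hilbert--Schmidt operators. $A:\mathcal D(A)\subset H\to H$ is linear, densely defined and maximal dissipative; it generates a $C_0$-semigroup of contractions $(\mathrm e^{sA})_{s\ge 0}$. For $t\in[0,T]$, a reference probability space $(\Omega,\mathscr F,(\mathscr F^t_s)_{s\in[t,T]},\mathbb P,(W(s))_{s\in[t,T]})$ is fixed: $(\Omega,\mathscr F,\mathbb P)$ is complete, $W$ is a cylindrical Wiener process in $\Xi$ with $W(t)=0$ $\mathbb P$-a.s., and $\mathscr F^t_s$ is generated by $\{W(\tau):t\le\tau\le s\}$ and the $\mathbb P$-null sets. $\mathcal U_t$ is the set of all $\mathscr F^t_s$-progressively measurable $a(\cdot):[t,T]\times\Omega\to\Lambda_0$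 with $\mathbb E\int_t^T\|a(s)\|_\Lambda^p\,\mathrm ds<\infty$. $X(\cdot;t,x,a(\cdot))$ is the mild solution with continuous trajectories of $\mathrm dX(s)=[AX(s)+b(X(s),a(s))]\mathrm ds+\sigma(X(s),a(s))\mathrm dW(s)$, $X(t)=x$, i.e. $X(s)=\mathrm e^{(s-t)A}x+\int_t^s\mathrm e^{(s-r)A}b(X(r),a(r))\mathrm dr+\int_t^s\mathrm e^{(s-r)A}\sigma(X(r),a(r))\mathrm dW(r)$. Further $J(t,x;a(\cdot))=\mathbb E\big[\int_t^T l(X(s),a(s))\mathrm ds+g(X(T))\big]$ with $X(s)=X(s;t,x,a(\cdot))$, and the value function is $V(t,x)=\inf_{a(\cdot)\in\mathcal U_t}J(t,x;a(\cdot))$. *)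

(* Defs.v *)
From HB Require Import structures.
From mathcomp Require Import all_boot all_order all_algebra.
From mathcomp Require Import all_classical all_reals all_analysis.
Import Order.TTheory GRing.Theory Num.Theory.
Import numFieldNormedType.Exports.

Set Implicit Arguments.
Unset Strict Implicit.
Unset Printing Implicit Defensive.

Local Open Scope classical_set_scope.
Local Open Scope ring_scope.

HB.mixin Record NormedModule_isHilbert (R : realType) H
    of NormedModule R H & Complete H := {
  inner : H -> H -> R ;
  innerC : forall x y, inner x y = inner y x ;
  inner_linearl : forall (k : R) x y z,
    inner (k *: x + y) z = k * inner x z + inner y z ;
  inner_norm : forall x, inner x x = `|x| ^+ 2
}.

#[short(type="hilbertType")]
HB.structure Definition Hilbert (R : realType) :=
  {H of CompleteNormedModule R H & NormedModule_isHilbert R H}.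

Definition separable (E : topologicalType) :=
  exists2 Q : set E, countable Q & dense Q.

Definition affine (R : realType) (E F : lmodType R) (f : E -> F) :=
  forall (k : R) u v, f (k *: u + (1 - k) *: v) = k *: f u + (1 - k) *: f v.

(* [convex_function] of the library only covers real-valued functions. With the
   conventions [+oo + -oo = -oo] and [0 * _ = 0] the inequality is meaningful
   for all values of [f]; it is the usual one when [f] is finite. *)
Definition convex_efunction (R : realType) (E : lmodType R) (f : E -> \bar R) :=
  forall (k : R) x y, 0 <= k <= 1 ->
    (f (k *: x + (1 - k) *: y)%R <= k%:E * f x + (1 - k)%:E * f y)%E.

Section hilbert_schmidt.
Context {R : realType}.

Definition orthonormal_basis (Xi : hilbertType R) (B : set Xi) :=
  [/\ forall e, B e -> `|e| = 1,
      forall e e', B e -> B e' -> e <> e' -> inner e e' = 0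
    & forall x, (forall e, B e -> inner x e = 0) -> x = 0].

(* Some orthonormal basis; the Hilbert-Schmidt norm does not depend on it. *)
Definition onb (Xi : hilbertType R) : set Xi :=
  xget set0 [set B | orthonormal_basis B].

Definition hs_norm2 (Xi H : hilbertType R) (L : Xi -> H) : \bar R :=
  \esum_(e in @onb Xi) (`|L e| ^+ 2)%:E.

Definition hilbert_schmidt (Xi H : hilbertType R) (L : Xi -> H) :=
  [/\ linear L, continuous L & (hs_norm2 L < +oo)%E].

Definition hs_continuous (E : topologicalType) (Xi H : hilbertType R)
    (f : E -> Xi -> H) :=
  forall u, hs_norm2 (fun xi => f v xi - f u xi) @[v --> u] --> 0%E.

End hilbert_schmidt.

Section semigroup.
Context {R : realType} {H : hilbertType R}.
Implicit Types (D : set H) (A : H -> H) (S : R -> H -> H).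

(* An operator with domain [D] is given by a total function [A] whose values
   off [D] are irrelevant. *)
Definition linear_operator D A :=
  D 0 /\ forall (k : R) x y, D x -> D y ->
    D (k *: x + y) /\ A (k *: x + y) = k *: A x + A y.

Definition dissipative D A := forall x, D x -> inner (A x) x <= 0.

Definition maximal_dissipative D A :=
  dissipative D A /\
  forall D' A', linear_operator D' A' -> dissipative D' A' ->
    D `<=` D' -> {in D, A' =1 A} -> D' `<=` D.

Definition c0_contraction_semigroup S :=
  [/\ forall s, 0 <= s -> linear (S s),
      forall x, S 0 x = x,
      forall r s, 0 <= r -> 0 <= s -> forall x, S (r + s) x = S r (S s x),
      forall x, S h x @[h --> 0^'+] --> x
    & forall s x, 0 <= s -> `|S s x| <= `|x|].

Definition generates D A S :=
  c0_contraction_semigroup S /\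
  forall x y, (D x /\ A x = y) <->
    (h^-1 *: (S h x - x) @[h --> 0^'+] --> y).

End semigroup.

(* [f] restricted to [D] is measurable from the sigma-algebra [F] to the Borel
   sets; [F] is a set system because filtrations live on a fixed type. *)
Definition borel_on {X : Type} {E : topologicalType} (F : set (set X))
    (D : set X) (f : X -> E) :=
  forall U : set E, open U -> F (D `&` f @^-1` U).

Definition borel_prod {R : realType} {Omega : Type} (F : set (set Omega)) :
    set (set (R * Omega)) :=
  <<s [set A `*` B | A in (measurable : set (set R)) & B in F] >>.

Section bochner.
Context {R : realType} {H : hilbertType R}.
Local Notation mu := (@lebesgue_measure R).

(* [v] is the Bochner integral of [f] over [[t, s]]: the limit of the integrals
   of the simple functions [\sum_(i < n k) \1_(A k i) *: h k i]. *)
Definition is_bochner_integral (t s : R) (f : R -> H) (v : H) :=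
  borel_on measurable `[t, s] f /\
  exists (n : nat -> nat) (A : nat -> nat -> set R) (h : nat -> nat -> H),
  [/\ forall k i, (i < n k)%N -> measurable (A k i),
      (\int[mu]_(r in `[t, s])
         `|f r - \sum_(i < n k) \1_(A k i) r *: h k i|%:E)%E
        @[k --> \oo] --> 0%E
    & \sum_(i < n k) fine (mu (`[t, s] `&` A k i)) *: h k i
        @[k --> \oo] --> v].

End bochner.

Section stochastic.
Context {R : realType} {d : measure_display} {Omega : measurableType d}
  (P : probability Omega R) {H Xi : hilbertType R}.
Local Notation mu := (@lebesgue_measure R).

(* A cylindrical process in [Xi] is given by its real components:
   [W s xi] stands for the (generalized) inner product of [W s] and [xi]. *)
Implicit Types (W : R -> Xi -> Omega -> R) (t T s : R).

Definition wiener_filtration W t s : set (set Omega) :=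
  <<s [set E | exists r xi B, [/\ t <= r <= s, measurable B
                                & E = W r xi @^-1` B]]
      `|` P.-negligible >>.

(* The law of the increments is not prescribed for [xi = 0] because
   [normal_prob] is not the Dirac mass for a null standard deviation. *)
Definition cylindrical_wiener W t T :=
  [/\ forall s xi, t <= s <= T -> measurable_fun setT (W s xi),
      forall s (k : R) xi eta, t <= s <= T ->
        {ae P, forall w, W s (k *: xi + eta) w = k * W s xi w + W s eta w},
      forall xi, {ae P, forall w, W t xi w = 0},
      forall xi, {ae P, forall w,
        {within `[t, T], continuous (fun s => W s xi w)}}
    & forall r s xi, t <= r -> r < s -> s <= T ->
        let dW w := W s xi w - W r xi w in
        (xi != 0 -> forall B, measurable B ->
          P (dW @^-1` B) = normal_prob 0 (Num.sqrt (s - r) * `|xi|) B) /\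
        (forall E B, wiener_filtration W t r E -> measurable B ->
          P (E `&` dW @^-1` B) = (P E * P (dW @^-1` B))%E)].

Definition reference_space W t T :=
  measure_is_complete P /\ cylindrical_wiener W t T.

Definition progressive W t T (E : topologicalType) (f : R -> Omega -> E) :=
  forall s, t <= s <= T ->
    borel_on (borel_prod (wiener_filtration W t s)) (`[t, s] `*` setT)
      (fun z => f z.1 z.2).

(* [\1_`]e_left, e_right] * e_coef * (e_dir (x) e_val)], a process with values
   in the operators of rank one from [Xi] to [H]. *)
Record elementary_term := ElementaryTerm {
  e_left : R ; e_right : R ; e_coef : Omega -> R ; e_dir : Xi ; e_val : H }.

Definition elementary_adapted W t s (e : elementary_term) :=
  [/\ t <= e_left e, e_left e <= e_right e, e_right e <= s,
      exists M, forall w, `|e_coef e w| <= M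
    & borel_on (wiener_filtration W t (e_left e)) setT (e_coef e)].

Definition elementary_process n (e : nat -> elementary_term)
    (r : R) (w : Omega) (xi : Xi) : H :=
  \sum_(i < n) (\1_`]e_left (e i), e_right (e i)] r * e_coef (e i) w *
                inner (e_dir (e i)) xi) *: e_val (e i).

Definition elementary_integral W n (e : nat -> elementary_term)
    (w : Omega) : H :=
  \sum_(i < n) (e_coef (e i) w * (W (e_right (e i)) (e_dir (e i)) w -
                                  W (e_left (e i)) (e_dir (e i)) w))
               *: e_val (e i).

(* [I] is the Ito integral of [Phi] over [[t, s]]: the limit in [L^2] of the
   integrals of elementary processes that converge to [Phi] in
   [L^2(Omega * [t, s]; L_2(Xi, H))]. *)
Definition is_ito_integral W t s (Phi : R -> Omega -> Xi -> H)
    (I : Omega -> H) :=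
  [/\ forall r w, t <= r <= s -> hilbert_schmidt (Phi r w),
      forall xi, progressive W t s (fun r w => Phi r w xi),
      borel_on measurable setT I
    & exists (n : nat -> nat) (e : nat -> nat -> elementary_term),
      [/\ forall k i, (i < n k)%N -> elementary_adapted W t s (e k i),
          (\int[P]_w \int[mu]_(r in `[t, s])
             hs_norm2 (fun xi =>
               (Phi r w xi - elementary_process (n k) (e k) r w xi)%R))%E
            @[k --> \oo] --> 0%E
        & (\int[P]_w (`|I w - elementary_integral W (n k) (e k) w| ^+ 2)%:E)%E
            @[k --> \oo] --> 0%E]].

Context {Lam : completeNormedModType R}.
Implicit Types (a : R -> Omega -> Lam) (X : R -> Omega -> H).

Definition admissible W t T (Lam0 : set Lam) (p : R) a :=
  [/\ progressive W t T a,
      forall s w, t <= s <= T -> Lam0 (a s w)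
    & (\int[P]_w \int[mu]_(s in `[t, T]) (`|a s w| `^ p)%:E < +oo)%E].

(* Square integrability is what makes the Ito integral of the coefficients
   well defined; the solution is unique in this class. *)
Definition mild_solution W t T (S : R -> H -> H) (b : H * Lam -> H)
    (sigma : H * Lam -> Xi -> H) (x : H) a X :=
  [/\ progressive W t T X,
      {ae P, forall w, {within `[t, T], continuous (fun s => X s w)}},
      (\int[P]_w \int[mu]_(s in `[t, T]) (`|X s w| ^+ 2)%:E < +oo)%E
    & forall s, t <= s <= T -> exists B I : Omega -> H,
      [/\ {ae P, forall w, is_bochner_integral t s
             (fun r => S (s - r) (b (X r w, a r w))) (B w)},
          is_ito_integral W t s
             (fun r w xi => S (s - r) (sigma (X r w, a r w) xi)) I
        & {ae P, forall w, X s w = S (s - t) x + B w + I w}]].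

Definition cost t T (l : H * Lam -> R) (g : H -> R) a X : \bar R :=
  (\int[P]_w (\int[mu]_(s in `[t, T]) (l (X s w, a s w))%:E
              + (g (X T w))%:E))%E.

(* [X x a] is the solution with initial datum [x] at time [t] and control [a]. *)
Definition value W t T (Lam0 : set Lam) (p : R) (l : H * Lam -> R)
    (g : H -> R) (X : H -> (R -> Omega -> Lam) -> R -> Omega -> H) (x : H) :
    \bar R :=
  ereal_inf [set cost t T l g a (X x a) | a in admissible W t T Lam0 p].

End stochastic.

(* Main.v *)
(* An affine combination [k X1 + (1 - k) X2] of two mild solutions is, the
   coefficients being affine, the mild solution for the same combination of the
   data and of the controls, up to uniqueness. Uniqueness is obtained directly
   for the defect [Y = X - k X1 - (1 - k) X2]: the Ito inequality
   [E |int Phi dW|^2 <= C E int |Phi|^2], its pathwise analogue for the Bochner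
   integral and the Lipschitz continuity of affine continuous maps bound
   [E |Y s|^2] by a multiple of [int_t^s E |Y r|^2 dr], so [Y = 0] by Gronwall.
   Convexity of [l] and [g] then makes the cost jointly convex in the datum and
   the control, and the infimum of a jointly convex function over one of its
   variables is convex. *)
Require Import Defs.
From HB Require Import structures.
From mathcomp Require Import all_boot all_order all_algebra.
From mathcomp Require Import all_classical all_reals all_analysis.
From mathcomp Require Import measurable_realfun.
From mathcomp Require Import ring lra.
Import Order.TTheory GRing.Theory Num.Theory.
Import numFieldNormedType.Exports.
Set Implicit Arguments.
Unset Strict Implicit.
Unset Printing Implicit Defensive.
Local Open Scope classical_set_scope.
Local Open Scope ring_scope.

(** * Hilbert spaces and finite rank operators *)

(** An Ito integral is given only as a limit of elementary integrals, and [hs_norm2] of a process is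
    not known to be measurable in time and chance. No isometry is therefore attempted for general
    integrands: the estimate passes to the limit through square sums over finite families of basis
    vectors. Such sums are measurable and lie below the Hilbert-Schmidt norm, and for a single
    elementary process some finite family attains the norm up to any [eps]. The defect vanishes
    almost surely at each time, hence almost everywhere for the product of time and chance; the
    terminal cost uses the first form, the running cost the second. Along the exact combination of
    [X1] and [X2] convexity applies pointwise, and Lipschitz continuity in the state charges the
    replacement of [X] with a multiple of [|Y|], whose integral is zero. Linearity of the integrals
    presupposes finite costs: [p > 2] controls the quadratic growth in the control, and
    integrability of [X T], which is not part of the definition of a mild solution, is recovered
    from the equation at time [T]. *)

Section inner_product.
Context {R : realType} {H : hilbertType R}.
Implicit Types (x y z : H) (k : R).

Lemma innerDl x y z : inner (x + y) z = inner x z + inner y z.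
Proof. by rewrite -[x in LHS]scale1r inner_linearl mul1r. Qed.

Lemma inner0l z : inner (0 : H) z = 0.
Proof. by apply: (addIr (inner (0 : H) z)); rewrite -innerDl !add0r. Qed.

Lemma innerZl k x z : inner (k *: x) z = k * inner x z.
Proof. by rewrite -[k *: x]addr0 inner_linearl inner0l addr0. Qed.

Lemma innerDr x y z : inner z (x + y) = inner z x + inner z y.
Proof. by rewrite innerC innerDl !(innerC z). Qed.

Lemma innerZr k x z : inner z (k *: x) = k * inner z x.
Proof. by rewrite innerC innerZl innerC. Qed.

Lemma inner0r z : inner z (0 : H) = 0.
Proof. by rewrite innerC inner0l. Qed.

Lemma innerBl x y z : inner (x - y) z = inner x z - inner y z.
Proof. by rewrite innerDl -scaleN1r innerZl mulN1r. Qed.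

Lemma innerBr x y z : inner z (x - y) = inner z x - inner z y.
Proof. by rewrite innerC innerBl !(innerC z). Qed.

Lemma inner_suml I (r : seq I) (Q : pred I) (f : I -> H) z :
  inner (\sum_(i <- r | Q i) f i) z = \sum_(i <- r | Q i) inner (f i) z.
Proof.
by apply: (big_morph (inner^~ z)) => [x y|]; [exact: innerDl|exact: inner0l].
Qed.

Lemma inner_sumr I (r : seq I) (Q : pred I) (f : I -> H) z :
  inner z (\sum_(i <- r | Q i) f i) = \sum_(i <- r | Q i) inner z (f i).
Proof. by rewrite innerC inner_suml; under eq_bigr do rewrite innerC. Qed.

Lemma sqnormD x y : `|x + y| ^+ 2 = `|x| ^+ 2 + inner x y *+ 2 + `|y| ^+ 2.
Proof. by rewrite -!inner_norm !innerDl !innerDr (innerC y x); ring. Qed.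

Lemma sqnormB x y : `|x - y| ^+ 2 = `|x| ^+ 2 - inner x y *+ 2 + `|y| ^+ 2.
Proof. by rewrite -!inner_norm !innerBl !innerBr (innerC y x); ring. Qed.

Lemma inner_ler_norm x y : inner x y <= `|x| * `|y|.
Proof.
have [->|x0] := eqVneq x 0; first by rewrite inner0l normr0 mul0r.
have [->|y0] := eqVneq y 0; first by rewrite inner0r normr0 mulr0.
have xp : 0 < `|x| by rewrite normr_gt0.
have yp : 0 < `|y| by rewrite normr_gt0.
(* Expands to [2 * |x| * |y|] times the difference that has to be nonnegative; both norms are
   positive by now. *)
have : 0 <= `|(`|y| *: x - `|x| *: y)| ^+ 2 by exact: sqr_ge0.
rewrite sqnormB !normrZ !normr_id innerZl innerZr => h.
rewrite -(ler_pM2l xp) -(ler_pM2l yp); lra.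
Qed.

Lemma normr_inner_le x y : `|inner x y| <= `|x| * `|y|.
Proof.
rewrite ler_norml inner_ler_norm andbT.
have := inner_ler_norm (- x) y.
by rewrite -scaleN1r innerZl normrZ normrN1 mul1r mulN1r lerNl.
Qed.

Lemma sqnorm_sum I (r : seq I) (f : I -> H) :
  `|\sum_(i <- r) f i| ^+ 2 = \sum_(i <- r) \sum_(j <- r) inner (f i) (f j).
Proof.
rewrite -inner_norm inner_suml; apply: eq_bigr => i _.
by rewrite inner_sumr.
Qed.

End inner_product.

(** * Orthonormal bases and finite projections *)

Section basis.
Context {R : realType} {Xi : hilbertType R}.
Implicit Types (x y e : Xi) (s F : seq Xi) (B : set Xi).

Let orthonormal B := (forall e, B e -> `|e| = 1) /\
  (forall e e', B e -> B e' -> e <> e' -> inner e e' = 0).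

(** Zorn's lemma gives a maximal orthonormal set; a nonzero vector orthogonal to it would, once
    normalized, enlarge it. So the choice made in [onb] is a genuine one and not the default of
    [xget]. *)
Lemma onbP : orthonormal_basis (@onb R Xi).
Proof.
rewrite /onb.
suff [B Bb] : exists B : set Xi, orthonormal_basis B.
  exact: (@xgetPex _ set0 [set B | orthonormal_basis B] (ex_intro _ B Bb)).
have [B [[B1 B2] Bmax]] : exists B, orthonormal B /\
    forall C, B `<` C -> ~ orthonormal C.
  apply: Zorn_bigcup => C Csub Ctot; split.
    by move=> e [B CB Be]; exact: (Csub _ CB).1.
  move=> e e' [B CB Be] [B' CB' Be'].
  have [BB'|B'B] := Ctot _ _ CB CB'.
    by apply: (Csub _ CB').2 => //; exact: BB'.
  by apply: (Csub _ CB).2 => //; exact: B'B.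
exists B; split => // x xB; apply: contrapT => /eqP x0.
have xp : 0 < `|x| by rewrite normr_gt0.
have BxB e : B e -> inner ((`|x|^-1) *: x) e = 0.
  by move=> Be; rewrite innerZl xB ?mulr0.
apply: (Bmax (B `|` [set `|x|^-1 *: x])).
  split; first by left.
  move=> /(_ (`|x|^-1 *: x)) h.
  have := xB _ (h (or_intror erefl)); rewrite innerZr inner_norm.
  move=> /eqP; rewrite mulf_eq0 invr_eq0 sqrf_eq0 !gt_eqF//.
split=> [e [/B1//|->]|].
  by rewrite normrZ ger0_norm ?invr_ge0 ?mulVf ?gt_eqF.
move=> e e' [Be|->] [Be'|->] ee' //.
- exact: B2.
- by rewrite innerC BxB.
- by rewrite BxB.
Qed.


(** Finite parts of the basis are duplicate-free lists, so that sums over them are ordinary big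
    operators. *)
Definition onbseq F := uniq F /\ (forall e, e \in F -> @onb R Xi e).

Definition proj_on F x : Xi := \sum_(e <- F) inner x e *: e.

Definition coord_sq F x : R := \sum_(e <- F) inner x e ^+ 2.

Lemma coord_sqE F x : coord_sq F x = \sum_(e <- F) inner x e * inner x e.
Proof. by apply: eq_bigr => e _; rewrite expr2. Qed.

Lemma onbseq_undup_cat F G : onbseq F -> onbseq G -> onbseq (undup (F ++ G)).
Proof.
move=> [_ Fo] [_ Go]; split; first exact: undup_uniq.
by move=> e; rewrite mem_undup mem_cat => /orP[/Fo|/Go].
Qed.

Lemma inner_proj_on F x e : onbseq F -> e \in F ->
  inner (proj_on F x) e = inner x e.
Proof.
move=> [uF Fo] eF; rewrite inner_suml (bigD1_seq e)//=.
have [bas1 bas2 _] := onbP.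
rewrite innerZl inner_norm (bas1 _ (Fo _ eF)) expr1n mulr1.
rewrite big_seq_cond big1 ?addr0// => i /andP[iF ie].
by rewrite innerZl (bas2 _ _ (Fo _ iF) (Fo _ eF) (elimN eqP ie)) mulr0.
Qed.

Lemma inner_proj_on_sub F G x y : onbseq G -> {subset F <= G} ->
  inner (proj_on F x) (proj_on G y) = \sum_(e <- F) inner x e * inner y e.
Proof.
move=> Go FG; rewrite inner_suml big_seq [RHS]big_seq.
by apply: eq_bigr => e /FG eG; rewrite innerZl (innerC e) inner_proj_on.
Qed.

(** Kept bilinear, because the Gram matrix of a finite rank operator involves the residuals of two
    different directions. *)
Lemma inner_proj_on_compl F x y : onbseq F ->
  inner (x - proj_on F x) (y - proj_on F y) =
  inner x y - \sum_(e <- F) inner x e * inner y e.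
Proof.
move=> Fo; rewrite innerBl !innerBr inner_proj_on_sub//.
rewrite [inner x (proj_on _ _)]inner_sumr [inner (proj_on _ _) y]inner_suml.
under eq_bigr do rewrite innerZr mulrC.
under [X in _ - (X - _)]eq_bigr do rewrite innerZl (innerC _ y).
by rewrite subrr subr0.
Qed.

Lemma sqnorm_proj_on_compl F x : onbseq F ->
  `|x - proj_on F x| ^+ 2 = `|x| ^+ 2 - coord_sq F x.
Proof. by move=> Fo; rewrite -!inner_norm inner_proj_on_compl// coord_sqE. Qed.

Lemma bessel F x : onbseq F -> coord_sq F x <= `|x| ^+ 2.
Proof. by move=> Fo; rewrite -subr_ge0 -sqnorm_proj_on_compl// sqr_ge0. Qed.

Lemma coord_sq_sub F G x : onbseq F -> onbseq G -> {subset F <= G} ->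
  coord_sq G x = coord_sq F x + `|proj_on G x - proj_on F x| ^+ 2.
Proof.
move=> Fo Go FG; rewrite sqnormB (innerC (proj_on G x)) -!inner_norm.
by rewrite !inner_proj_on_sub// -!coord_sqE; ring.
Qed.

Lemma coord_sq_ge_sub F G x : onbseq F -> onbseq G -> {subset F <= G} ->
  coord_sq F x <= coord_sq G x.
Proof. by move=> Fo Go FG; rewrite (coord_sq_sub x Fo Go)// lerDl sqr_ge0. Qed.

(** The argument avoids series over the basis. Finite families that nearly maximise [coord_sq] have
    Cauchy projections, and the limit is [x] because adjoining one more basis vector gains almost
    nothing. *)
Lemma parseval_approx x (eta : R) : 0 < eta -> exists2 F, onbseq F &
  forall G, onbseq G -> {subset F <= G} -> `|x - proj_on G x| ^+ 2 <= eta.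
Proof.
move=> eta0.
suff [F Fo Fx] : exists2 F, onbseq F & `|x - proj_on F x| ^+ 2 <= eta.
  exists F => // G Go FG; apply: le_trans Fx.
  by rewrite !sqnorm_proj_on_compl// lerD2l lerN2 coord_sq_ge_sub.
pose A := [set coord_sq F x | F in onbseq].
have supA : has_sup A.
  split; first by exists (coord_sq [::] x), [::].
  by exists (`|x| ^+ 2) => _ [F Fo <-]; exact: bessel.
have /choice[Fn FnP] : forall n, exists F, onbseq F /\
    sup A - n.+1%:R^-1 < coord_sq F x.
  move=> n; have n0 : (0 : R) < n.+1%:R^-1 by rewrite invr_gt0.
  have [_ [F Fo <-] FA] := sup_adherent n0 supA.
  by exists F.
have Fo n : onbseq (Fn n) by case: (FnP n).
(* By Pythagoras the squared distance between nested projections is the gain in [coord_sq], which is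
   at most the gap between [Fn n] and the supremum. *)
have sub_sup F n : onbseq F -> {subset Fn n <= F} ->
    `|proj_on F x - proj_on (Fn n) x| ^+ 2 <= n.+1%:R^-1.
  move=> FFo FF; have := coord_sq_sub x (Fo n) FFo FF.
  have : coord_sq F x <= sup A by apply: ub_le_sup; [exact: supA.2|exists F].
  have := (FnP n).2; move: (_%:R^-1) => z; lra.
pose u n := proj_on (Fn n) x.
have sqle (a b : R) : 0 <= b -> a ^+ 2 <= b ^+ 2 -> a <= b.
  by move=> b0 ab; have [//|ba] := leP a b; nra.
have small (e : R) : 0 < e -> \forall n \near \oo, n.+1%:R^-1 <= e.
  by move=> e0; near=> n; apply: ltW; near: n; exact: near_infty_natSinv_lt (PosNum e0).
have cu : cvg (u @ \oo).
  apply/cauchy_cvgP; apply: cauchy_exP => e e0.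
  have e4 : 0 < (e / 4) ^+ 2 by rewrite exprn_gt0// divr_gt0.
  have [N _ NP] := small _ e4.
  exists (u N); exists N => // n /= Nn.
  rewrite -ball_normE/=.
  (* [Fn N] and [Fn n] need not be nested, so both are compared with their union. *)
  have Go := onbseq_undup_cat (Fo N) (Fo n).
  have h1 : `|proj_on (undup (Fn N ++ Fn n)) x - u N| <= e / 4.
    apply: sqle; first by rewrite ltW// divr_gt0.
    apply: le_trans (NP N (leqnn N)); apply: sub_sup => //.
    by move=> z zF; rewrite mem_undup mem_cat zF.
  have h2 : `|proj_on (undup (Fn N ++ Fn n)) x - u n| <= e / 4.
    apply: sqle; first by rewrite ltW// divr_gt0.
    apply: le_trans (NP n Nn); apply: sub_sup => //.
    by move=> z zF; rewrite mem_undup mem_cat zF orbT.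
  apply: le_lt_trans (ler_distD (proj_on (undup (Fn N ++ Fn n)) x) _ _) _.
  rewrite [X in X + _ < _]distrC; apply: le_lt_trans (lerD h1 h2) _; lra.
pose y := lim (u @ \oo).
have uy : u n @[n --> \oo] --> y by [].
suff xy : x - y = 0.
  have : `|x - u n| ^+ 2 @[n --> \oo] --> `|x - y| ^+ 2.
    rewrite expr2; under eq_fun do rewrite expr2.
    by apply: cvgM; apply: cvg_norm; apply: cvgB => //; exact: cvg_cst.
  rewrite xy normr0 expr0n/= => /cvgrPdist_le/(_ _ eta0)[N _ /(_ N (leqnn N))].
  rewrite sub0r normrN ger0_norm ?sqr_ge0// => h.
  by exists (Fn N).
have [_ _ ob] := onbP; apply: ob => e Be.
apply/eqP; rewrite -normr_le0; apply/ler_addgt0Pl => eps eps0; rewrite addr0.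
have eps2 : 0 < (eps / 2) ^+ 2 by rewrite exprn_gt0// divr_gt0.
have [N1 _ N1P] := small _ eps2.
have eps2' : 0 < eps / 2 by rewrite divr_gt0.
have := uy; move=> /cvgrPdist_le/(_ _ eps2')[N2 _ N2P].
pose N := maxn N1 N2.
have -> : x - y = (x - u N) - (y - u N) by rewrite opprB addrA subrK.
rewrite innerBl (le_trans (ler_normB _ _))//.
have e1 : `|e| = 1 by case: onbP => bas1 _ _; exact: bas1.
have h2 : `|inner (y - u N) e| <= eps / 2.
  rewrite (le_trans (normr_inner_le _ _))// e1 mulr1.
  by apply: N2P; exact: leq_maxr.
suff h1 : `|inner (x - u N) e| <= eps / 2 by lra.
rewrite innerBl.
have [eN|eN] := boolP (e \in Fn N).
  by rewrite inner_proj_on// subrr normr0 ltW.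
have o2 e' : e' \in Fn N -> inner e' e = 0.
  move=> e'F; have [_ bas2 _] := @onbP; apply: bas2 => //; first exact: (Fo N).2.
  by move=> e'e; rewrite -e'e e'F in eN.
have -> : inner (u N) e = 0.
  by rewrite inner_suml big_seq big1// => i iF; rewrite innerZl o2// mulr0.
rewrite subr0; apply: sqle; first exact: ltW.
rewrite real_normK ?num_real//; apply: le_trans (N1P N (leq_maxl _ _)).
(* Adjoining [e] raises [coord_sq] by [inner x e ^+ 2], so this square is bounded by the gap to the
   supremum. *)
have eFo : onbseq (e :: Fn N).
  split; first by rewrite /= eN (Fo N).1.
  by move=> z; rewrite inE => /orP[/eqP->//|]; exact: (Fo N).2.
have : coord_sq (e :: Fn N) x <= sup A.
  by apply: ub_le_sup; [exact: supA.2|exists (e :: Fn N)].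
rewrite /coord_sq big_cons; have := (FnP N).2; rewrite /coord_sq; move: (_%:R^-1) => z; lra.
Unshelve. all: by end_near. Qed.

Lemma parseval_approx_seq (s : seq Xi) (eta : R) : 0 < eta ->
  exists2 F, onbseq F & forall x, x \in s -> `|x - proj_on F x| ^+ 2 <= eta.
Proof.
move=> eta0.
suff [F Fo Fs] : exists2 F, onbseq F & forall G, onbseq G -> {subset F <= G} ->
    forall x, x \in s -> `|x - proj_on G x| ^+ 2 <= eta.
  by exists F => // x; exact: Fs.
elim: s => [|x s [F Fo Fs]]; first by exists [::].
have [F' F'o F'x] := parseval_approx x eta0.
exists (undup (F ++ F')) => [|G Go FG y]; first exact: onbseq_undup_cat.
rewrite inE => /orP[/eqP->|ys].
  by apply: F'x => // z zF; apply: FG; rewrite mem_undup mem_cat zF orbT.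
by apply: Fs => // z zF; apply: FG; rewrite mem_undup mem_cat zF.
Qed.

End basis.

Section hilbert_schmidt_lower_bound.
Context {R : realType} {Xi H : hilbertType R}.

Lemma hs_norm2_ge (L : Xi -> H) F : onbseq F ->
  ((\sum_(e <- F) `|L e| ^+ 2)%:E <= hs_norm2 L)%E.
Proof.
move=> [uF Fo]; apply: esum_ge; exists [set` F].
  by split; [exact: finite_seq|move=> e /= /Fo].
by rewrite -sumEFin fsbig_seq.
Qed.

(* The Hilbert-Schmidt norm of the finite rank operator
   [xi |-> \sum_i (al i * inner (d i) xi) *: v i] is almost attained
   on finitely many basis vectors, uniformly for bounded coefficients. *)
Lemma finite_rank_hs_approx n (d : 'I_n -> Xi) (v : 'I_n -> H) (M eps : R) :
  0 < eps -> exists2 F, onbseq F & forall al : 'I_n -> R,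
    (forall i, `|al i| <= M) ->
    \sum_i \sum_j al i * al j * inner (d i) (d j) * inner (v i) (v j) <=
    \sum_(e <- F) `|\sum_i (al i * inner (d i) e) *: v i| ^+ 2 + eps.
Proof.
move=> eps0.
(* Bounds the total weight of the residual inner products uniformly in [al]. The absolute value is
   there because the sign of [M] is not prescribed; the [+ 1] below keeps the divisor positive. *)
pose K := \sum_i \sum_j `|M| * `|M| * (`|v i| * `|v j|).
have K0 : 0 <= K.
  by apply: sumr_ge0 => i _; apply: sumr_ge0 => j _; rewrite !mulr_ge0.
have eta0 : 0 < eps / (K + 1) by rewrite divr_gt0// ltr_wpDl.
have [F Fo Fd] := parseval_approx_seq [seq d i | i <- enum 'I_n] eta0.
exists F => // al alM.
have dF i : `|d i - proj_on F (d i)| ^+ 2 <= eps / (K + 1).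
  by apply: Fd; apply/mapP; exists i => //; rewrite mem_enum.
rewrite -lerBlDl.
have -> : \sum_(e <- F) `|\sum_i (al i * inner (d i) e) *: v i| ^+ 2 =
   \sum_i \sum_j al i * al j *
     (\sum_(e <- F) inner (d i) e * inner (d j) e) * inner (v i) (v j).
  under eq_bigr do rewrite sqnorm_sum.
  rewrite exchange_big; apply: eq_bigr => i _.
  rewrite exchange_big; apply: eq_bigr => j _.
  rewrite mulr_sumr mulr_suml; apply: eq_bigr => e _.
  by rewrite innerZl innerZr; ring.
rewrite -sumrB; under eq_bigr do rewrite -sumrB.
apply: (@le_trans _ _ (K * (eps / (K + 1)))); last first.
  have K1 : 0 < K + 1 by rewrite ltr_wpDl.
  rewrite mulrCA ler_piMr ?(ltW eps0)// ler_pdivrMr// mul1r.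
  by rewrite lerDl.
rewrite /K mulr_suml; apply: ler_sum => i _.
rewrite mulr_suml; apply: ler_sum => j _.
(* Truncation to [F] loses exactly the Gram entry of the residuals, each of squared norm at most
   [eps / (K + 1)]. *)
have -> : al i * al j * inner (d i) (d j) * inner (v i) (v j) -
    al i * al j * (\sum_(e <- F) inner (d i) e * inner (d j) e) *
    inner (v i) (v j) = al i * al j * inner (v i) (v j) *
    inner (d i - proj_on F (d i)) (d j - proj_on F (d j)).
  by rewrite inner_proj_on_compl//; ring.
apply: le_trans (ler_norm _) _; rewrite !normrM.
apply: ler_pM; rewrite ?mulr_ge0//.
  apply: ler_pM; rewrite ?mulr_ge0// ?normr_inner_le//.
  by apply: ler_pM => //; exact: le_trans (ler_norm _).
apply: le_trans (normr_inner_le _ _) _.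
have : 0 <= (`|d i - proj_on F (d i)| - `|d j - proj_on F (d j)|) ^+ 2.
  exact: sqr_ge0.
by have := dF i; have := dF j; rewrite sqrrB; lra.
Qed.

End hilbert_schmidt_lower_bound.

(** * Borel maps into separable spaces *)

Section borel_on.
Context {R : realType} {T : Type}.
Implicit Types (F : set (set T)) (D : set T).

Lemma sigma_algebra_cup F A B :
  sigma_algebra setT F -> F A -> F B -> F (A `|` B).
Proof.
move=> [s0 _ sU] FA FB; rewrite -bigcup2E; apply: sU => -[|[|n]] //=.
Qed.

Lemma sigma_algebraI F A B : sigma_algebra setT F -> F A -> F B -> F (A `&` B).
Proof.
move=> sF FA FB; rewrite -(setCK (A `&` B)) setCI -!setTD.
have [_ sC _] := sF.
by apply: (sC); apply: sigma_algebra_cup => //; exact: (sC).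
Qed.

Lemma sigma_algebra_countable_bigcup F (I : countType) (A : I -> set T) :
  sigma_algebra setT F -> (forall i, F (A i)) -> F (\bigcup_i A i).
Proof.
move=> [s0 _ sU] FA.
rewrite (_ : \bigcup_i A i =
  \bigcup_n (if unpickle n is Some i then A i else set0)).
  by apply: sU => n; case: unpickle.
apply/seteqP; split=> [x [i _ Ax]|x [n _]].
  by exists (pickle i) => //; rewrite pickleK.
by case: unpickle => // i Ax; exists i.
Qed.

(** The point of [E] taken as first argument makes the dense set nonempty, as an enumeration by
    [nat] requires. *)
Lemma separable_seq (E : pseudoMetricType R) : E -> separable E ->
  exists q : nat -> E, forall x (e : R), 0 < e -> exists n, ball x e (q n).
Proof.
move=> x0 [Q cQ dQ].
have ballQ x (e : R) : 0 < e -> exists2 y, Q y & ball x e y.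
  (* A ball of a pseudometric space need not be open here, hence the interior. *)
  move=> e0; have [|y [/interior_subset xy Qy]] := dQ (ball x e)° _ (@open_interior _ _).
    by exists x; apply: nbhsx_ballx.
  by exists y.
have /pfcard_geP[Q0|[q]] := cQ.
  by have [y] := ballQ x0 1 ltr01; rewrite Q0.
exists q => x e /(ballQ x)[y Qy xy].
by have [n _ qn] := @surj _ _ _ _ q y Qy; exists n; rewrite qn.
Qed.

Lemma borel_on_comp (E1 E2 : topologicalType) F D (f : T -> E1) (h : E1 -> E2) :
  continuous h -> borel_on F D f -> borel_on F D (h \o f).
Proof. by move=> /continuousP ch bf U oU; exact: bf (ch _ oU). Qed.

(** Separability provides countably many rectangles that exhaust any open set of the product. Joint
    measurability further on, including that of sums, rests on this. *)
Lemma borel_on_pair (E1 E2 : pseudoMetricType R) F D (f : T -> E1) (g : T -> E2) :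
  separable E1 -> separable E2 -> sigma_algebra setT F ->
  borel_on F D f -> borel_on F D g -> borel_on F D (fun x => (f x, g x)).
Proof.
move=> sE1 sE2 sF bf bg U oU.
have [[x0 Dx0]|D0] := pselect (exists x, D x); last first.
  rewrite (_ : _ `&` _ = set0); first by case: sF.
  by apply/seteqP; split=> [x [Dx]|//]; case: D0; exists x.
have [q1 q1P] := separable_seq (f x0) sE1.
have [q2 q2P] := separable_seq (g x0) sE2.
pose V (i : nat * nat * nat) :=
  (D `&` f @^-1` (ball (q1 i.1.1) i.2.+1%:R^-1)°) `&`
  (D `&` g @^-1` (ball (q2 i.1.2) i.2.+1%:R^-1)°).
pose G i := if `[< ball (q1 i.1.1) i.2.+1%:R^-1 `*` ball (q2 i.1.2) i.2.+1%:R^-1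
   `<=` U >] then V i else set0.
have -> : D `&` (fun x => (f x, g x)) @^-1` U = \bigcup_i G i.
  apply/seteqP; split=> [x [Dx /= Ux]|x [i _]]; last first.
    rewrite /G; case: asboolP => // sub [[Dx fx] [_ gx]]; split => //=.
    by apply: sub; split => /=; exact: interior_subset.
  have /nbhs_ballP[e /= e0 eU] : nbhs (f x, g x) U by exact: open_nbhs_nbhs.
  (* A rectangle of radius [r = n.+1%:R^-1] with centres within [r / 2] of the point contains the
     point in its interior and stays within [2 * r <= e] of it. *)
  have [n ne] : exists n, n.+1%:R^-1 + n.+1%:R^-1 <= e.
    have e2 : 0 < e / 2 by rewrite divr_gt0.
    have [n _ /(_ n (leqnn n)) /= ne] := near_infty_natSinv_lt (PosNum e2).
    by exists n; rewrite (splitr e) lerD// ltW.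
  have n0 : (0 : R) < n.+1%:R^-1 by rewrite invr_gt0.
  have n0' : (0 : R) < n.+1%:R^-1 / 2 by rewrite divr_gt0.
  have half : n.+1%:R^-1 / 2 <= n.+1%:R^-1 :> R by rewrite ler_piMr ?(ltW n0)//; lra.
  have int (E : pseudoMetricType R) (y z : E) : ball y (n.+1%:R^-1 / 2) z ->
      (ball z n.+1%:R^-1)° y.
    move=> yz; apply/nbhs_ballP; exists (n.+1%:R^-1 / 2) => //= w yw.
    by rewrite (splitr n.+1%:R^-1); apply: ball_triangle yw; exact: ball_sym.
  have [i1 i1P] := q1P (f x) _ n0'.
  have [i2 i2P] := q2P (g x) _ n0'.
  exists (i1, i2, n) => //; rewrite /G asboolT.
    by split; split => //=; exact: int.
  move=> [y1 y2] [/= h1 h2]; apply: eU; split => /=; apply: (le_ball ne).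
    by apply: ball_triangle h1; apply: (le_ball half); exact: i1P.
  by apply: ball_triangle h2; apply: (le_ball half); exact: i2P.
apply: sigma_algebra_countable_bigcup => // i; rewrite /G; case: ifPn => _.
  by apply: sigma_algebraI => //; [apply: bf|apply: bg]; exact: open_interior.
by case: sF.
Qed.

Lemma borel_on_pair_comp (E1 E2 : pseudoMetricType R) (E : topologicalType) F D
    (f : T -> E1) (g : T -> E2) (h : E1 * E2 -> E) :
  separable E1 -> separable E2 -> sigma_algebra setT F -> continuous h ->
  borel_on F D f -> borel_on F D g -> borel_on F D (fun x => h (f x, g x)).
Proof.
move=> s1 s2 sF ch bf bg.
exact: (borel_on_comp ch (borel_on_pair s1 s2 sF bf bg)).
Qed.

(** Serves the running cost [l], which is continuous only where the control lies in [Lam0]: an open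
    set of the subspace is the trace of an open set. *)
Lemma borel_on_within (E1 E2 : topologicalType) F D A (f : T -> E1)
    (h : E1 -> E2) : {within A, continuous h} -> (forall x, D x -> A (f x)) ->
  borel_on F D f -> borel_on F D (h \o f).
Proof.
move=> /continuousP ch DA bf U /ch /open_subspaceP[V oV VA].
rewrite (_ : D `&` _ = D `&` f @^-1` V); first exact: bf.
apply/seteqP; split=> x [Dx /= Ux]; split => //=.
  have : (V `&` A) (f x) by rewrite VA; split => //; exact: DA.
  by case.
have : (h @^-1` U `&` A) (f x) by rewrite -VA; split => //; exact: DA.
by case.
Qed.

Lemma borel_on_sub (E : topologicalType) F F' D (f : T -> E) :
  F `<=` F' -> borel_on F D f -> borel_on F' D f.
Proof. by move=> FF' bf U oU; apply: FF'; exact: bf. Qed.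

Lemma borel_on_eq (E : topologicalType) F D (f g : T -> E) :
  (forall x, D x -> f x = g x) -> borel_on F D f -> borel_on F D g.
Proof.
move=> fg bf U oU; rewrite (_ : _ `&` _ = D `&` f @^-1` U); first exact: bf.
by apply/seteqP; split=> x [Dx /=]; rewrite fg.
Qed.

Lemma borel_on_cst (E : topologicalType) F D (y : E) :
  sigma_algebra setT F -> F D -> borel_on F D (fun=> y).
Proof.
move=> sF FD U oU; have [Uy|Uy] := pselect (U y).
  by rewrite (_ : _ `&` _ = D)//; apply/seteqP; split=> [x []|].
rewrite (_ : _ `&` _ = set0); first by case: sF.
by apply/seteqP; split=> [x []|].
Qed.

End borel_on.

Section borel_on_algebra.
Context {R : realType} {T : Type} (F : set (set T)) (D : set T).
Hypothesis sF : sigma_algebra setT F.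

Lemma separable_realType : separable R.
Proof.
exists (ratr @` setT); last exact: dense_rat.
exact: (card_le_trans (card_image_le _ _) (countableP _)).
Qed.

Section normed.
Context {E : normedModType R} (sE : separable E).
Implicit Types f g : T -> E.

Lemma borel_onD f g : borel_on F D f -> borel_on F D g ->
  borel_on F D (fun x => f x + g x).
Proof.
apply: (@borel_on_pair_comp _ _ _ _ _ _ _ f g (fun z => z.1 + z.2)) => //.
exact: add_continuous.
Qed.

Lemma borel_onZ (c : T -> R) f : borel_on F D c -> borel_on F D f ->
  borel_on F D (fun x => c x *: f x).
Proof.
apply: (@borel_on_pair_comp _ _ _ _ _ _ _ c f (fun z => z.1 *: z.2)) => //.
  exact: separable_realType.
exact: scale_continuous.
Qed.

Lemma borel_onZl k f : borel_on F D f -> borel_on F D (fun x => k *: f x).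
Proof.
move=> bf; apply: (@borel_on_comp _ E E _ _ f (fun y => k *: y)) => //.
exact: scaler_continuous.
Qed.

Lemma borel_onB f g : borel_on F D f -> borel_on F D g ->
  borel_on F D (fun x => f x - g x).
Proof.
move=> bf bg; have := borel_onD bf (borel_onZl (-1) bg).
by apply: borel_on_eq => x _; rewrite scaleN1r.
Qed.

Lemma borel_on_sum I (r : seq I) (f : I -> T -> E) : F D ->
  (forall i, borel_on F D (f i)) ->
  borel_on F D (fun x => \sum_(i <- r) f i x).
Proof.
move=> FD bf; elim: r => [|i r IH].
  by under eq_fun do rewrite big_nil; exact: borel_on_cst.
by under eq_fun do rewrite big_cons; exact: borel_onD.
Qed.

Lemma borel_on_norm f : borel_on F D f -> borel_on F D (fun x => `|f x|).
Proof.
by move=> bf; apply: borel_on_comp bf; exact: norm_continuous.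
Qed.

End normed.
End borel_on_algebra.

(** The sets whose preimage lies in [F] form a sigma-algebra, and it contains the open intervals
    that generate the Borel sets. *)
Lemma borel_on_preimage (R : realType) (T : Type) (F : set (set T)) (D : set T)
    (f : T -> R) : sigma_algebra setT F -> F D -> borel_on F D f ->
  forall B, measurable B -> F (D `&` f @^-1` B).
Proof.
move=> sF FD bf B mB.
have : <<s @RGenOpens.G R >> B.
  suff <- : (@ocitv R).-sigma.-measurable = <<s @RGenOpens.G R >> by [].
  exact: RGenOpens.measurableE.
move: B {mB}.
apply: (@smallest_sub _ (sigma_algebra setT) _ [set B | F (D `&` f @^-1` B)]); last first.
  by move=> _ [x [y ->]]; apply: bf; exact: interval_open.
have [s0 sC sU] := sF; split => /=.
- by rewrite preimage_set0 setI0.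
- move=> A FA; rewrite (_ : _ `&` _ = D `&` (setT `\` (D `&` f @^-1` A))).
    by apply: sigma_algebraI => //; exact: sC.
  apply/seteqP; split=> x /= [Dx]; first by move=> [_ ?]; split => //; split => // -[].
  by move=> [_ h]; split => //; split => // Afx; exact: h.
- by move=> A FA; rewrite preimage_bigcup setI_bigcupr; exact: sU.
Qed.

Section borel_on_measurable_fun.
Context {R : realType} {d : measure_display} {T : measurableType d}.

Lemma borel_on_measurable_fun (D : set T) (f : T -> R) : measurable D ->
  borel_on measurable D f <-> measurable_fun D f.
Proof.
move=> mD; split=> [bf|mf U oU]; last first.
  by apply: mf => //; exact: open_measurable.
by move=> _ B; exact: borel_on_preimage (@sigma_algebra_measurable _ T) mD bf B.
Qed.

End borel_on_measurable_fun.

(** * Wiener increments *)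

Section independence.
Context {R : realType} {d : measure_display} {Omega : measurableType d}
  (P : probability Omega R).

(** Independence says that the law of the pair is the product of the two laws. Tonelli on that
    product gives integrability, Fubini the product formula. *)
Lemma indep_expectation_mul (X Y : Omega -> R) :
  (forall A B, measurable A -> measurable B ->
    P (X @^-1` A `&` Y @^-1` B) = (P (X @^-1` A) * P (Y @^-1` B))%E) ->
  P.-integrable setT (EFin \o X) -> P.-integrable setT (EFin \o Y) ->
  P.-integrable setT (EFin \o (fun w => X w * Y w)) /\
  (\int[P]_w (X w * Y w) = (\int[P]_w X w) * (\int[P]_w Y w))%R.
Proof.
move=> ind iX iY.
have mX : measurable_fun setT X by apply/measurable_EFinP; exact: measurable_int iX.
have mY : measurable_fun setT Y by apply/measurable_EFinP; exact: measurable_int iY.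
pose X' : {mfun Omega >-> R} := HB.pack X (isMeasurableFun.Build _ _ _ _ _ mX).
pose Y' : {mfun Omega >-> R} := HB.pack Y (isMeasurableFun.Build _ _ _ _ _ mY).
have mZ : measurable_fun setT (fun w => (X w, Y w)) by exact/measurable_fun_pair.
pose Z' : {mfun Omega >-> (R * R)%type} :=
  HB.pack (fun w => (X w, Y w)) (isMeasurableFun.Build _ _ _ _ _ mZ).
have prodE A : measurable A ->
    (distribution P X' \x distribution P Y')%E A = distribution P Z' A.
  apply: product_measure_unique => B C mB mC; exact: ind.
have mmul : measurable_fun setT (fun z : (R * R)%type => (z.1 * z.2)%:E).
  by apply/measurable_EFinP; exact: measurable_funM.
have mabs : measurable_fun setT (fun z : (R * R)%type => `|(z.1 * z.2)%R%:E|%E).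
  by apply: (@measurableT_comp _ _ _ _ _ _ abse) => //.
have iXY : P.-integrable setT (EFin \o (fun w => X w * Y w)).
  apply/integrableP; split.
    by apply/measurable_EFinP; exact: measurable_funM.
  have -> : (\int[P]_x `|(EFin \o (fun w => X w * Y w)%R) x| =
     \int[P]_x ((fun z : (R * R)%type => `|(z.1 * z.2)%R%:E|) \o Z') x)%E by [].
  rewrite -ge0_integral_distribution//.
  rewrite (eq_measure_integral (distribution P X' \x distribution P Y')%E); last first.
    by move=> A mA _; apply/esym; exact: prodE.
  rewrite (fubini_tonelli1 _ mabs _)//= /fubini_F/=.
  under eq_integral => x _.
    under eq_integral do rewrite normrM EFinM.
    rewrite ge0_integralZl//=; last first.
      by apply/measurable_EFinP; exact: normr_measurable.
    over.
  rewrite ge0_integralZr//=; last 2 first.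
  - by apply/measurable_EFinP; exact: normr_measurable.
  - exact: integral_ge0.
  rewrite !ge0_integral_distribution//; try by apply/measurable_EFinP; exact: normr_measurable.
  have /integrableP[_ fX] := iX; have /integrableP[_ fY] := iY.
  have X0 : (0 <= \int[P]_x `|(X x)%:E|)%E by apply: integral_ge0.
  apply: lte_mul_pinfty; [exact: X0| |exact: fY].
  by rewrite ge0_fin_numE; [exact: fX|exact: X0].
split => //.
rewrite /Rintegral -fineM; [|exact: integrable_fin_num..].
congr fine.
have -> : (\int[P]_x (X x * Y x)%:E =
   \int[P]_x ((fun z : (R * R)%type => (z.1 * z.2)%:E) \o Z') x)%E by [].
rewrite -integral_distribution//.
rewrite (eq_measure_integral (distribution P X' \x distribution P Y')%E); last first.
  by move=> A mA _; apply/esym; exact: prodE.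
have iprod : (distribution P X' \x distribution P Y')%E.-integrable setT
    (fun z : (R * R)%type => (z.1 * z.2)%:E).
  apply/integrableP; split => //.
  rewrite (eq_measure_integral (distribution P Z')); last first.
    by move=> A mA _; exact: prodE.
  by rewrite ge0_integral_distribution//; have /integrableP[] := iXY.
rewrite -integral12_prod_meas1//.
have iX' : (distribution P X').-integrable setT EFin.
  by apply: integrable_pushforward.
have iY' : (distribution P Y').-integrable setT EFin.
  by apply: integrable_pushforward.
rewrite /fubini_F/=.
under eq_integral => x _.
  under eq_integral do rewrite EFinM.
  rewrite integralZl//.
  over.
have finY := integrable_fin_num measurableT iY'.
rewrite /= -(fineK finY) integralZr// fineK//.
by rewrite !integral_distribution.
Qed.

End independence.

(** * Finiteness of the second moment of a normal law *)

Section gaussian_second_moment.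
Context {R : realType}.
Local Notation mu := (@lebesgue_measure R).

(** Doubling the deviation absorbs the square: with [u = x ^+ 2 / (2 * s ^+ 2)] the claim reduces to
    [2 * u <= 8 * expR (3 / 4 * u)], a consequence of [1 + y <= expR y]. The second moment is thus
    finite by comparison with another normal density. *)
Lemma sqr_normal_pdf_le (s x : R) : 0 < s ->
  x ^+ 2 * normal_pdf 0 s x <=
  8 * s ^+ 2 * normal_peak s / normal_peak (2 * s) * normal_pdf 0 (2 * s) x.
Proof.
move=> s0; have s20 : 0 < 2 * s by rewrite mulr_gt0.
have p0 := normal_peak_gt0 (lt0r_neq0 s20).
pose u := x ^+ 2 / (s ^+ 2 *+ 2).
have s2 : 0 < s ^+ 2 by rewrite exprn_gt0.
have u0 : 0 <= u by rewrite divr_ge0 ?sqr_ge0 ?mulrn_wge0 ?sqr_ge0.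
have uE : - (x - 0) ^+ 2 / (s ^+ 2 *+ 2) = - u by rewrite subr0 /u mulNr.
have u'E : - (x - 0) ^+ 2 / ((2 * s) ^+ 2 *+ 2) = - u + (3 / 4) * u.
  by rewrite subr0 /u; field; rewrite gt_eqF.
have xu : x ^+ 2 = s ^+ 2 * (2 * u) by rewrite /u; field; rewrite gt_eqF.
rewrite !normal_pdfE ?gt_eqF// /normal_fun uE u'E [leRHS]mulrA divfK ?gt_eqF//.
rewrite expRD xu.
have -> : s ^+ 2 * (2 * u) * (normal_peak s * expR (- u)) =
  s ^+ 2 * normal_peak s * expR (- u) * (2 * u) by ring.
have -> : 8 * s ^+ 2 * normal_peak s * (expR (- u) * expR (3 / 4 * u)) =
  s ^+ 2 * normal_peak s * expR (- u) * (8 * expR (3 / 4 * u)) by ring.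
apply: ler_wpM2l; first by rewrite !mulr_ge0 ?expR_ge0 ?normal_peak_ge0 ?ltW.
by have := expR_ge1Dx (3 / 4 * u); lra.
Qed.

(** Change of variables brings in the Radon-Nikodym derivative, which agrees with [normal_pdf] only
    almost everywhere. *)
Lemma integral_normal_prob (s : R) (f : R -> \bar R) :
  measurable_fun setT f -> (forall x, 0 <= f x)%E ->
  (\int[normal_prob 0 s]_x f x = \int[mu]_x (f x * (normal_pdf 0 s x)%:E))%E.
Proof.
move=> mf f0.
rewrite -(Radon_Nikodym_SigmaFinite.change_of_variables (normal_prob_dominates 0 s))//.
have dom := @normal_prob_dominates R 0 s.
have iRN := Radon_Nikodym_SigmaFinite.f_integrable dom.
have mpdf : measurable_fun setT (fun x => (normal_pdf 0 s x)%:E).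
  by apply/measurable_EFinP; exact: measurable_normal_pdf.
have mRN := measurable_int _ iRN.
apply: ge0_ae_eq_integral => //.
- exact: emeasurable_funM.
- exact: emeasurable_funM.
- by move=> x _; rewrite mule_ge0// Radon_Nikodym_SigmaFinite.f_ge0.
- by move=> x _; rewrite mule_ge0// lee_fin normal_pdf_ge0.
have : ae_eq mu setT (Radon_Nikodym_SigmaFinite.f (normal_prob 0 s) mu)
    (fun x => (normal_pdf 0 s x)%:E).
  apply: integral_ae_eq => // E _ mE.
  by rewrite -Radon_Nikodym_SigmaFinite.f_integral.
by apply: filterS => x /= h _; rewrite h.
Qed.

Lemma normal_second_moment_lty (s : R) : 0 < s ->
  (\int[normal_prob 0 s]_x (x ^+ 2)%:E < +oo)%E.
Proof.
move=> s0.
have mx2 : measurable_fun setT (fun x : R => (x ^+ 2)%:E).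
  by apply/measurable_EFinP; exact: measurable_funX.
have x2 (x : R) : (0 <= (x ^+ 2)%:E)%E by rewrite lee_fin sqr_ge0.
rewrite integral_normal_prob//.
pose K := 8 * s ^+ 2 * normal_peak s / normal_peak (2 * s).
have K0 : 0 <= K.
  apply: divr_ge0; last exact: normal_peak_ge0.
  apply: mulr_ge0; last exact: normal_peak_ge0.
  by apply: mulr_ge0; rewrite ?sqr_ge0.
apply: (@le_lt_trans _ _ (\int[mu]_x (K%:E * (normal_pdf 0 (2 * s) x)%:E))%E).
  apply: ge0_le_integral => //.
  - by move=> x _; rewrite -EFinM lee_fin mulr_ge0 ?sqr_ge0 ?normal_pdf_ge0.
  - apply: emeasurable_funM => //; apply/measurable_EFinP.
    exact: measurable_normal_pdf.
  - by apply: emeasurable_funM => //; apply/measurable_EFinP;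
      exact: measurable_normal_pdf.
  - by move=> x _; rewrite -!EFinM lee_fin sqr_normal_pdf_le.
rewrite ge0_integralZl//.
- by rewrite integral_normal_pdf mule1 ltry.
- by apply/measurable_EFinP; exact: measurable_normal_pdf.
- by move=> x _; rewrite lee_fin normal_pdf_ge0.
Qed.

End gaussian_second_moment.

Section expectation.
Context {R : realType} {d : measure_display} {T : measurableType d}
  (P : {measure set T -> \bar R}).
Implicit Types f g c : T -> R.

Lemma integrable_measurable_fun f :
  P.-integrable setT (EFin \o f) -> measurable_fun setT f.
Proof. by move=> iF; apply/measurable_EFinP; exact: measurable_int iF. Qed.

Lemma integrable_le f g : measurable_fun setT f -> (forall w, `|f w| <= g w) ->
  P.-integrable setT (EFin \o g) -> P.-integrable setT (EFin \o f).
Proof.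
move=> mf fg; apply: le_integrable => //; first exact/measurable_EFinP.
by move=> w _ /=; rewrite lee_fin (le_trans (fg w))// ler_norm.
Qed.

Lemma integrable_bounded_mul c f : measurable_fun setT c ->
  (exists M, forall w, `|c w| <= M) -> P.-integrable setT (EFin \o f) ->
  P.-integrable setT (EFin \o (fun w => c w * f w)).
Proof.
move=> mc [M cM] iF; have mf := integrable_measurable_fun iF.
apply: (@integrable_le _ (fun w => M * `|f w|)).
- exact: measurable_funM.
- by move=> w; rewrite normrM ler_wpM2r.
- have := integrableZl measurableT M (integrable_norm iF).
  by apply: eq_integrable => // w _; rewrite /= EFinM.
Qed.

Lemma integrable_ae_eq f g : measurable_fun setT g ->
  {ae P, forall w, f w = g w} -> P.-integrable setT (EFin \o f) ->
  P.-integrable setT (EFin \o g) /\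
  (\int[P]_w f w = \int[P]_w g w)%R.
Proof.
move=> mg fg iF.
have mf := integrable_measurable_fun iF.
have mg' : measurable_fun setT (EFin \o g) by exact/measurable_EFinP.
have mf' : measurable_fun setT (EFin \o f) by exact/measurable_EFinP.
have aeE : ae_eq P setT (EFin \o f) (EFin \o g).
  by apply: filterS fg => w /= ->.
split; last first.
  by rewrite /Rintegral; congr fine; exact: ae_eq_integral.
apply/integrableP; split => //.
move/integrableP : iF => [_]; rewrite (ae_eq_integral (abse \o (EFin \o g)))//.
- exact: measurableT_comp.
- exact: measurableT_comp.
- by apply: filterS fg => w /= -> _.
Qed.

End expectation.

Section wiener.
Context {R : realType} {d : measure_display} {Omega : measurableType d}
  (P : probability Omega R) {Xi : hilbertType R}
  (W : R -> Xi -> Omega -> R) (t T : R).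
Hypothesis refW : reference_space P W t T.

Local Notation F := (wiener_filtration P W t).

Lemma wiener_filtration_sigma_algebra s : sigma_algebra setT (F s).
Proof. exact: smallest_sigma_algebra. Qed.
Let sF := wiener_filtration_sigma_algebra.

Lemma wiener_filtrationT s : F s setT.
Proof.
have [s0 sC _] := sF s.
by rewrite -(setD0 setT); exact: sC.
Qed.

Lemma wiener_filtration_sub r s : r <= s -> F r `<=` F s.
Proof.
move=> rs; apply: sub_smallest2r; first exact: sF.
apply: setSU => E [u [xi [B [/andP[tu ur] mB EB]]]].
by exists u, xi, B; split => //; rewrite tu (le_trans ur).
Qed.

Lemma wiener_measurable s xi : t <= s <= T -> measurable_fun setT (W s xi).
Proof. by case: refW => _ [h _ _ _ _]; exact: h. Qed.

Lemma wiener_filtration_measurable s : s <= T -> F s `<=` measurable.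
Proof.
move=> sT; apply: smallest_sub; first exact: sigma_algebra_measurable.
move=> E [[r [xi [B [/andP[tr rs] mB ->]]]]|nE].
  rewrite -[X in measurable X]setTI; apply: wiener_measurable => //.
  by rewrite tr (le_trans rs).
by case: refW => cP _; exact: cP.
Qed.

Lemma borel_on_wiener r s xi : t <= r <= s -> borel_on (F s) setT (W r xi).
Proof.
move=> trs U oU; rewrite setTI; apply: sub_sigma_algebra; left.
by exists r, xi, U; split => //; exact: open_measurable.
Qed.

Definition increment r s (xi : Xi) w : R := W s xi w - W r xi w.

Lemma increment_split a b c xi w :
  increment a c xi w = increment a b xi w + increment b c xi w.
Proof. by rewrite /increment; ring. Qed.

Lemma increment_self a xi w : increment a a xi w = 0.
Proof. by rewrite /increment subrr. Qed.

Section increment.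
Variables r s : R.
Hypotheses (tr : t <= r) (rs : r <= s) (sT : s <= T).
Local Notation dW := (increment r s).

Let trT : t <= r <= T. Proof. by rewrite tr (le_trans rs). Qed.
Let tsT : t <= s <= T. Proof. by rewrite (le_trans tr). Qed.

Lemma increment_measurable xi : measurable_fun setT (dW xi).
Proof. by apply: measurable_funB; exact: wiener_measurable. Qed.

Lemma borel_on_increment xi : borel_on (F s) setT (dW xi).
Proof.
apply: borel_onB => //; first exact: separable_realType.
- by apply: borel_on_wiener; rewrite lexx andbT (le_trans tr).
- by apply: borel_on_wiener; rewrite tr.
Qed.

Lemma increment_linear k xi eta :
  {ae P, forall w, dW (k *: xi + eta) w = k * dW xi w + dW eta w}.
Proof.
case: refW => _ [_ lin _ _ _].
apply: filterS2 (lin r k xi eta trT) (lin s k xi eta tsT) => w h1 h2.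
by rewrite /increment h1 h2; ring.
Qed.

(** The law of an increment is prescribed only for [xi != 0]; here additivity gives
    [dW 0 = dW 0 + dW 0] almost surely. *)
Lemma increment0 : {ae P, forall w, dW 0 w = 0}.
Proof.
apply: filterS (increment_linear 1 0 0) => w; rewrite scaler0 addr0 => h.
by move: h; lra.
Qed.

Lemma incrementZ k xi : {ae P, forall w, dW (k *: xi) w = k * dW xi w}.
Proof.
apply: filterS2 increment0 (increment_linear k xi 0) => w h0 h.
by rewrite -[k *: xi]addr0 h h0 addr0.
Qed.

Lemma increment_law xi B : r < s -> xi != 0 -> measurable B ->
  P (dW xi @^-1` B) = normal_prob 0 (Num.sqrt (s - r) * `|xi|) B.
Proof.
by move=> rls xi0 mB; case: refW => _ [_ _ _ _ h]; exact: (h r s xi tr rls sT).1.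
Qed.

Lemma increment_indep xi (c : Omega -> R) A B : borel_on (F r) setT c ->
  measurable A -> measurable B ->
  P (c @^-1` A `&` dW xi @^-1` B) = (P (c @^-1` A) * P (dW xi @^-1` B))%E.
Proof.
move=> bc mA mB.
have FA : F r (c @^-1` A).
  rewrite -[X in F r X]setTI.
  by apply: (borel_on_preimage (sF r) _ bc mA); exact: wiener_filtrationT.
(* Independence is postulated for [r < s]; for [r = s] the increment is zero and its events are
   trivial. *)
move: rs; rewrite le_eqVlt => /predU1P[rse|rls]; last first.
  by case: refW => _ [_ _ _ _ h]; exact: (h r s xi tr rls sT).2.
have dW0 w : dW xi w = 0 by rewrite /increment rse subrr.
have [B0|B0] := pselect (B 0).
  have -> : dW xi @^-1` B = setT by apply/seteqP; split => w //= _; rewrite dW0.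
  by rewrite setIT probability_setT mule1.
have -> : dW xi @^-1` B = set0.
  by apply/seteqP; split => w //=; rewrite dW0 => /B0.
by rewrite setI0 measure0 mule0.
Qed.


Let ge0_integral_increment xi (f : R -> \bar R) : r < s -> xi != 0 ->
  measurable_fun setT f -> (forall x, 0 <= f x)%E ->
  (\int[P]_w f (dW xi w) =
   \int[normal_prob 0 (Num.sqrt (s - r) * `|xi|)]_x f x)%E.
Proof.
move=> rls xi0 mf f0.
have mdW : @measurable_fun _ _ Omega (measurableTypeR R) setT (dW xi).
  exact: increment_measurable.
pose Y : {mfun Omega >-> measurableTypeR R} := HB.pack (dW xi)
  (isMeasurableFun.Build _ _ _ _ _ mdW).
have -> : (\int[P]_w f (dW xi w) = \int[P]_w (f \o Y) w)%E by [].
rewrite -ge0_integral_distribution//.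
apply: (@eq_measure_integral _ _ R setT (normal_prob 0 (Num.sqrt (s - r) * `|xi|)) (distribution P Y) f) => B mB _.
exact: increment_law.
Qed.

(** The second moment of the standard normal law, left unevaluated: the estimates need only that it
    is finite and nonnegative. *)
Definition gaussian_variance : R :=
  fine (\int[@normal_prob R 0 1]_x (x ^+ 2)%:E)%E.

Let msqr : measurable_fun setT (fun x : R => (x ^+ 2)%:E).
Proof. by apply/measurable_EFinP; exact: measurable_funX. Qed.

Let sqr0 (x : R) : (0 <= (x ^+ 2)%:E)%E.
Proof. by rewrite lee_fin sqr_ge0. Qed.

Let integral_increment_sqr xi :
  (\int[P]_w (dW xi w ^+ 2)%:E =
   (gaussian_variance * (s - r) * `|xi| ^+ 2)%:E)%E.
Proof.
move: (rs); rewrite le_eqVlt => /predU1P[rse|rls].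
  rewrite -rse subrr mulr0 mul0r integral0_eq// => w _.
  by rewrite increment_self expr0n.
have mdW := increment_measurable xi.
have mdW2 : measurable_fun setT (fun w => (dW xi w ^+ 2)%:E).
  by apply/measurable_EFinP; exact: measurable_funX.
have [->|xi0] := eqVneq xi 0.
  rewrite normr0 expr0n mulr0 (ae_eq_integral (cst 0%E))//.
  - by rewrite integral0.
  - apply/measurable_EFinP; apply: measurable_funX; exact: increment_measurable.
  - by apply: filterS increment0 => w h _ /=; rewrite h expr0n.
(* Dividing [xi] by the standard deviation of its increment gives a direction [e] with standard
   normal increment; the factor [c] returns by linearity in the direction. *)
pose c := Num.sqrt (s - r) * `|xi|.
have c0 : 0 < c by rewrite mulr_gt0 ?sqrtr_gt0 ?subr_gt0 ?normr_gt0.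
pose e := c^-1 *: xi.
have e0 : e != 0 by rewrite scaler_eq0 invr_eq0 gt_eqF//= xi0.
have law1 : Num.sqrt (s - r) * `|e| = 1.
  by rewrite /e normrZ ger0_norm ?invr_ge0 ?(ltW c0)// mulrCA mulVf// gt_eqF.
have xiE : xi = c *: e by rewrite scalerA divff ?scale1r// gt_eqF.
have c2 : c ^+ 2 = (s - r) * `|xi| ^+ 2.
  by rewrite exprMn sqr_sqrtr// subr_ge0.
rewrite -mulrA -c2 (ae_eq_integral (fun w => (c ^+ 2)%:E * (dW e w ^+ 2)%:E)%E)//.
- rewrite ge0_integralZl//; last first.
    by apply/measurable_EFinP; apply: measurable_funX; exact: increment_measurable.
  rewrite (@ge0_integral_increment e (fun x => (x ^+ 2)%:E))// law1.
  rewrite [RHS]EFinM muleC; congr (_ * _)%E.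
  rewrite fineK// ge0_fin_numE; first exact: normal_second_moment_lty.
  by apply: integral_ge0 => x _; exact: sqr0.
- apply: emeasurable_funM => //; apply/measurable_EFinP.
  by apply: measurable_funX; exact: increment_measurable.
- by apply: filterS (incrementZ c e) => w h _ /=; rewrite {1}xiE h exprMn EFinM.
Qed.

Lemma integrable_increment_sqr xi :
  P.-integrable setT (EFin \o (fun w => dW xi w ^+ 2)).
Proof.
apply/integrableP; split.
  by apply/measurable_EFinP; apply: measurable_funX; exact: increment_measurable.
under eq_integral do rewrite /= ger0_norm ?sqr_ge0//.
by rewrite integral_increment_sqr ltry.
Qed.

Lemma integrable_increment xi : P.-integrable setT (EFin \o dW xi).
Proof.
apply: (@integrable_le _ _ _ _ _ (fun w => 1 + dW xi w ^+ 2)).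
- exact: increment_measurable.
- move=> w; have : 0 <= (`|dW xi w| - 1) ^+ 2 by exact: sqr_ge0.
  by rewrite sqrrB real_normK ?num_real//; have := sqr_ge0 (dW xi w); lra.
- have := integrableD measurableT (finite_measure_integrable_cst P 1 measurableT)
    (integrable_increment_sqr xi).
  by apply: eq_integrable => // w _ /=; rewrite EFinD.
Qed.

(** By symmetry: the law depends on [xi] through its norm only, so the increments along [xi] and
    [-1 *: xi] have the same mean, while linearity makes the two means opposite. *)
Lemma expectation_increment xi : (\int[P]_w dW xi w = 0)%R.
Proof.
move: (rs); rewrite le_eqVlt => /predU1P[rse|rls].
  rewrite -rse (@eq_Rintegral _ _ _ _ _ (cst 0)) ?Rintegral_cst ?mul0r// => w _.
  by rewrite increment_self.
have [->|xi0] := eqVneq xi 0.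
  rewrite (integrable_ae_eq _ increment0 (integrable_increment 0)).2//.
  by rewrite Rintegral_cst// mul0r.
have lawE eta : eta != 0 -> (\int[P]_w (dW eta w)%:E =
    \int[normal_prob 0 (Num.sqrt (s - r) * `|eta|)]_x x%:E)%E.
  have mdW : @measurable_fun _ _ Omega (measurableTypeR R) setT (dW eta).
    exact: increment_measurable.
  move=> eta0; pose Y : {mfun Omega >-> measurableTypeR R} := HB.pack (dW eta)
    (isMeasurableFun.Build _ _ _ _ _ mdW).
  have -> : (\int[P]_w (dW eta w)%:E = \int[P]_w (EFin \o Y) w)%E by [].
  rewrite -integral_distribution//; last exact: integrable_increment.
  apply: (@eq_measure_integral _ _ R setT (normal_prob 0 (Num.sqrt (s - r) * `|eta|)) (distribution P Y) EFin) => B mB _.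
exact: increment_law.
have xin0 : (-1) *: xi != 0 by rewrite scaler_eq0 oppr_eq0 oner_eq0.
have mN : measurable_fun setT (fun w => -1 * dW xi w).
  by apply: measurable_funM => //; exact: increment_measurable.
have /= h := (integrable_ae_eq mN (incrementZ (-1) xi) (integrable_increment _)).2.
have : \int[P]_w dW ((-1) *: xi) w = \int[P]_w dW xi w.
  rewrite /Rintegral; congr fine; apply: (etrans (lawE _ xin0)).
  by apply: esym; rewrite (lawE _ xi0) normrZ normrN1 mul1r.
by rewrite h RintegralZl//; [lra|exact: integrable_increment].
Qed.

Lemma expectation_increment_sqr xi :
  (\int[P]_w (dW xi w ^+ 2) = gaussian_variance * (s - r) * `|xi| ^+ 2)%R.
Proof. by rewrite /Rintegral integral_increment_sqr. Qed.

End increment.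
End wiener.

Lemma normrM_le_sqrD (R : realDomainType) (x y : R) :
  `|x * y| <= x ^+ 2 + y ^+ 2.
Proof. by rewrite ler_norml; apply/andP; split; nra. Qed.

(** * Covariances of weighted Wiener increments *)

Section ito_isometry.
Context {R : realType} {d : measure_display} {Omega : measurableType d}
  (P : probability Omega R) {Xi : hilbertType R}
  (W : R -> Xi -> Omega -> R) (t T : R).
Hypothesis refW : reference_space P W t T.
Local Notation F := (wiener_filtration P W t).
Local Notation M := (@gaussian_variance R).
Local Notation dW := (increment W).
Let sF := wiener_filtration_sigma_algebra P W t.

Lemma borel_on_wiener_measurable s (c : Omega -> R) : s <= T ->
  borel_on (F s) setT c -> measurable_fun setT c.
Proof.
move=> sT bc; apply/borel_on_measurable_fun => //.
exact: borel_on_sub (wiener_filtration_measurable refW sT) bc.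
Qed.

Section one_interval.
Variables r s : R.
Hypotheses (tr : t <= r) (rs : r <= s) (sT : s <= T).
Let rT : r <= T. Proof. exact: le_trans sT. Qed.

Lemma expectation_mul_increment (c : Omega -> R) xi : borel_on (F r) setT c ->
  P.-integrable setT (EFin \o c) ->
  P.-integrable setT (EFin \o (fun w => c w * dW r s xi w)) /\
  (\int[P]_w (c w * dW r s xi w) = 0)%R.
Proof.
move=> bc ic.
have [|h1 h2] := @indep_expectation_mul R d Omega P c (dW r s xi) _ ic
    (integrable_increment refW tr rs sT xi).
  by move=> A B mA mB; exact: (increment_indep refW tr rs sT).
by rewrite h2 (expectation_increment refW tr rs sT) mulr0.
Qed.

Lemma expectation_mul_increment_sqr (c : Omega -> R) xi : borel_on (F r) setT c ->
  P.-integrable setT (EFin \o c) ->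
  P.-integrable setT (EFin \o (fun w => c w * dW r s xi w ^+ 2)) /\
  (\int[P]_w (c w * dW r s xi w ^+ 2) =
   (\int[P]_w c w) * (M * (s - r) * `|xi| ^+ 2))%R.
Proof.
move=> bc ic.
have [|h1 h2] := @indep_expectation_mul R d Omega P c (fun w => dW r s xi w ^+ 2) _ ic
    (integrable_increment_sqr refW tr rs sT xi).
  move=> A B mA mB.
  have mB' : measurable ((fun x : R => x ^+ 2) @^-1` B).
    rewrite -[X in measurable X]setTI.
    by apply: (measurable_funX 2 (@measurable_id _ R setT)).
  exact: (increment_indep refW tr rs sT xi bc mA mB').
by rewrite h2 (expectation_increment_sqr refW tr rs sT).
Qed.

(** Polarisation: the mixed term is isolated from the squares along [xi], [eta] and [xi + eta],
    increments being almost surely additive in the direction. *)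
Lemma expectation_mul_increment2 (c : Omega -> R) xi eta :
  borel_on (F r) setT c -> P.-integrable setT (EFin \o c) ->
  P.-integrable setT (EFin \o (fun w => c w * (dW r s xi w * dW r s eta w))) /\
  (\int[P]_w (c w * (dW r s xi w * dW r s eta w)) =
   (\int[P]_w c w) * (M * (s - r) * inner xi eta))%R.
Proof.
move=> bc ic.
have mc := borel_on_wiener_measurable rT bc.
have mdW := increment_measurable refW tr rs sT.
have [i1 e1] := expectation_mul_increment_sqr xi bc ic.
have [i2 e2] := expectation_mul_increment_sqr eta bc ic.
have [i3 e3] := expectation_mul_increment_sqr (xi + eta) bc ic.
have i4 : P.-integrable setT
    (EFin \o (fun w => c w * (dW r s xi w * dW r s eta w))).
  apply: (@integrable_le _ _ _ _ _
    (fun w => `|c w * dW r s xi w ^+ 2| + `|c w * dW r s eta w ^+ 2|)).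
  - by apply: measurable_funM => //; apply: measurable_funM.
  - move=> w; rewrite !(normrM (c w)) -mulrDr ler_wpM2l//.
    by rewrite !(ger0_norm (sqr_ge0 _)) normrM_le_sqrD.
  - have := integrableD measurableT (integrable_norm i1) (integrable_norm i2).
    by apply: eq_integrable => // w _ /=; rewrite EFinD.
split => //.
have mg : measurable_fun setT (fun w => c w * dW r s xi w ^+ 2 +
    (c w * dW r s eta w ^+ 2 + 2 * (c w * (dW r s xi w * dW r s eta w)))).
  apply: measurable_funD.
    by apply: measurable_funM => //; exact: measurable_funX.
  apply: measurable_funD.
    by apply: measurable_funM => //; exact: measurable_funX.
  by apply: measurable_funM => //; apply: measurable_funM => //; apply: measurable_funM.
have aeg : {ae P, forall w, c w * dW r s (xi + eta) w ^+ 2 =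
    c w * dW r s xi w ^+ 2 +
    (c w * dW r s eta w ^+ 2 + 2 * (c w * (dW r s xi w * dW r s eta w)))}.
  apply: filterS (increment_linear refW tr rs sT 1 xi eta) => w.
  by rewrite scale1r => ->; ring.
have [_] := integrable_ae_eq mg aeg i3.
have i4' : P.-integrable setT
    (EFin \o (fun w => 2 * (c w * (dW r s xi w * dW r s eta w)))).
  have := integrableZl measurableT 2 i4.
  by apply: eq_integrable => // w _ /=; rewrite EFinM.
have i5 : P.-integrable setT (EFin \o (fun w => c w * dW r s eta w ^+ 2 +
    2 * (c w * (dW r s xi w * dW r s eta w)))).
  have := integrableD measurableT i2 i4'.
  by apply: eq_integrable => // w _ /=; rewrite EFinD.
rewrite RintegralD// RintegralD// RintegralZl// e1 e2 e3 sqnormD.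
set I1 := \int[P]_w c w; set I2 := Rintegral _ _ _; move=> h.
lra.
Qed.

End one_interval.

Lemma borel_onM s (f g : Omega -> R) : borel_on (F s) setT f ->
  borel_on (F s) setT g -> borel_on (F s) setT (fun w => f w * g w).
Proof. by move=> bf bg; exact: (borel_onZ (sF s) (@separable_realType R) bf bg). Qed.

Lemma borel_on_wiener_sub r s (c : Omega -> R) : r <= s ->
  borel_on (F r) setT c -> borel_on (F s) setT c.
Proof. by move=> rs; apply: borel_on_sub; exact: wiener_filtration_sub. Qed.

Lemma integrable_adapted_bounded s (c : Omega -> R) : s <= T ->
  borel_on (F s) setT c -> (exists K, forall w, `|c w| <= K) ->
  P.-integrable setT (EFin \o c).
Proof.
move=> sT bc [K cK]; have mc := borel_on_wiener_measurable sT bc.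
apply: (@integrable_le _ _ _ _ _ (fun=> K)) => //.
exact: finite_measure_integrable_cst.
Qed.

(** Overlapping intervals are cut at [a'] and at [m = min b b']. Only the common piece between these
    points contributes: every other product either contains an increment independent of all
    remaining factors or vanishes identically. The order [a <= a'] makes both coefficients known at
    time [a']. *)
Lemma expectation_mul_increments_le a b a' b' (c c' : Omega -> R) xi eta :
  t <= a -> a <= b -> b <= T -> a <= a' -> a' <= b' -> b' <= T ->
  (exists K, forall w, `|c w| <= K) -> (exists K, forall w, `|c' w| <= K) ->
  borel_on (F a) setT c -> borel_on (F a') setT c' ->
  P.-integrable setT
    (EFin \o (fun w => (c w * dW a b xi w) * (c' w * dW a' b' eta w))) /\
  (\int[P]_w ((c w * dW a b xi w) * (c' w * dW a' b' eta w)) =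
   (\int[P]_w (c w * c' w)) *
     (M * Num.max 0 (Num.min b b' - Num.max a a') * inner xi eta))%R.
Proof.
move=> ta ab bT aa' a'b' b'T bdc bdc' bc bc'.
have aT : a <= T by exact: le_trans bT.
have a'T : a' <= T by exact: le_trans b'T.
have ta' : t <= a' by exact: le_trans aa'.
have bc2 : borel_on (F a') setT c by exact: borel_on_wiener_sub bc.
have bcc : borel_on (F a') setT (fun w => c w * c' w) by exact: borel_onM.
have bdcc : exists K, forall w, `|c w * c' w| <= K.
  have [K cK] := bdc; have [K' cK'] := bdc'.
  exists (K * K') => w; rewrite normrM; apply: ler_pM => //.
have icc := integrable_adapted_bounded a'T bcc bdcc.
have mcc := borel_on_wiener_measurable a'T bcc.
(* Intervals without overlap: the first increment is already known at time [a'], and the truncation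
   at [0] in the formula takes effect. *)
have [ba'|a'b] := leP b a'.
  have bcdW : borel_on (F a') setT (fun w => (c w * c' w) * dW a b xi w).
    apply: borel_onM => //; apply: borel_on_wiener_sub ba' _.
    exact: borel_on_increment.
  have icdW : P.-integrable setT (EFin \o (fun w => (c w * c' w) * dW a b xi w)).
    apply: integrable_bounded_mul => //.
    exact: (integrable_increment refW ta ab bT xi).
  have [h1 h2] := expectation_mul_increment ta' a'b' b'T eta bcdW icdW.
  have E : (fun w => c w * c' w * dW a b xi w * dW a' b' eta w) =
      (fun w => c w * dW a b xi w * (c' w * dW a' b' eta w)).
    by apply/funext => w; ring.
  rewrite E in h1; split => //; move: h2; rewrite E => ->.
  have -> : Num.max 0 (Num.min b b' - Num.max a a') = 0.
    apply/max_idPl; rewrite subr_le0 ge_min; apply/orP; left.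
    by rewrite le_max ba' orbT.
  by rewrite mulr0 mul0r mulr0.
pose m := Num.min b b'.
have a'm : a' <= m by rewrite le_min (ltW a'b).
have mb : m <= b by rewrite ge_min lexx.
have mb' : m <= b' by rewrite ge_min lexx orbT.
have mT : m <= T by exact: le_trans bT.
have tm : t <= m by exact: le_trans a'm.
have bcm : borel_on (F m) setT (fun w => c w * c' w).
  exact: borel_on_wiener_sub bcc.
have bi1 : borel_on (F a') setT (fun w => (c w * c' w) * dW a a' xi w).
  by apply: borel_onM => //; exact: borel_on_increment.
have ii1 : P.-integrable setT (EFin \o (fun w => (c w * c' w) * dW a a' xi w)).
  apply: integrable_bounded_mul => //.
  exact: (integrable_increment refW ta aa' a'T _).
have [i1 e1] := expectation_mul_increment ta' a'b' b'T eta bi1 ii1.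
have [i2 e2] := expectation_mul_increment2 ta' a'm mT xi eta bcc icc.
have bi x : borel_on (F m) setT (fun w => (c w * c' w) * dW a' m x w).
  by apply: borel_onM => //; exact: borel_on_increment.
have ii x : P.-integrable setT (EFin \o (fun w => (c w * c' w) * dW a' m x w)).
  apply: integrable_bounded_mul => //.
  exact: (integrable_increment refW ta' a'm mT _).
have [i3 e3] := expectation_mul_increment tm mb' b'T eta (bi xi) (ii xi).
have [i4 e4] := expectation_mul_increment tm mb bT xi (bi eta) (ii eta).
(* One of the two intervals ends at [m], so one factor is an increment over a single point. *)
have dW0 w : dW m b xi w * dW m b' eta w = 0.
  rewrite /m minEle; case: ifP => _.
    by rewrite increment_self mul0r.
  by rewrite [X in _ * X]increment_self mulr0.
have E : (fun w => c w * dW a b xi w * (c' w * dW a' b' eta w)) =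
  (fun w => c w * c' w * dW a a' xi w * dW a' b' eta w +
    (c w * c' w * (dW a' m xi w * dW a' m eta w) +
      (c w * c' w * dW a' m xi w * dW m b' eta w +
       c w * c' w * dW a' m eta w * dW m b xi w))).
  apply/funext => w; apply/eqP; rewrite -subr_eq0; apply/eqP.
  transitivity (c w * c' w * (dW m b xi w * dW m b' eta w)); last first.
    by rewrite dW0 mulr0.
  by rewrite (increment_split W a a' b) (increment_split W a' m b)
    (increment_split W a' m b'); ring.
have i34 := integrableD measurableT i3 i4.
have i234 := integrableD measurableT i2 i34.
have i1234 := integrableD measurableT i1 i234.
rewrite E; split => //.
rewrite RintegralD// RintegralD// RintegralD// e1 e2 e3 e4.
have -> : Num.max 0 (Num.min b b' - Num.max a a') = m - a'.
  by rewrite (max_idPr aa') -/m; apply/max_idPr; rewrite subr_ge0.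
by rewrite !addr0 add0r.
Qed.

End ito_isometry.

(** * The Ito inequality *)

Section integral_sums.
Context {R : realType} {d : measure_display} {T : measurableType d}
  (m : {measure set T -> \bar R}).

Lemma Rintegral_sum (D : set T) I (r : seq I) (f : I -> T -> R) : measurable D ->
  (forall i, m.-integrable D (EFin \o f i)) ->
  m.-integrable D (EFin \o (fun x => \sum_(i <- r) f i x)) /\
  (\int[m]_(x in D) (\sum_(i <- r) f i x) =
   \sum_(i <- r) \int[m]_(x in D) f i x)%R.
Proof.
move=> mD iF; elim: r => [|i r [IH1 IH2]].
  have -> : (fun x => \sum_(i <- [::]) f i x) = cst 0.
    by apply/funext => x; rewrite big_nil.
  by rewrite big_nil Rintegral_cst// mul0r; split => //; exact: integrable0.
have E : (fun x => \sum_(j <- i :: r) f j x) =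
    (fun x => f i x + \sum_(j <- r) f j x).
  by apply/funext => x; rewrite big_cons.
rewrite E big_cons RintegralD// IH2; split => //.
by have := integrableD mD (iF i) IH1; apply: eq_integrable.
Qed.

Lemma Rintegral_sum2 (D : set T) I J (r : seq I) (s : seq J)
    (f : I -> J -> T -> R) : measurable D ->
  (forall i j, m.-integrable D (EFin \o f i j)) ->
  m.-integrable D (EFin \o (fun x => \sum_(i <- r) \sum_(j <- s) f i j x)) /\
  (\int[m]_(x in D) (\sum_(i <- r) \sum_(j <- s) f i j x) =
   \sum_(i <- r) \sum_(j <- s) \int[m]_(x in D) f i j x)%R.
Proof.
move=> mD iF.
have h i := @Rintegral_sum D J s (f i) mD (iF i).
have [h1 h2] := @Rintegral_sum D I r (fun i x => \sum_(j <- s) f i j x) mD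
  (fun i => (h i).1).
by split => //; rewrite h2; apply: eq_bigr => i _; exact: (h i).2.
Qed.

Lemma EFin_Rintegral (D : set T) (f : T -> R) : measurable D ->
  m.-integrable D (EFin \o f) ->
  ((\int[m]_(x in D) f x)%R%:E = \int[m]_(x in D) (f x)%:E)%E.
Proof. by move=> mD iF; rewrite /Rintegral fineK//; exact: integrable_fin_num. Qed.

(** [f] may be negative, hence the passage through its positive part; this serves quadratic forms
    and inner products whose sign is left open. *)
Lemma le_integral_ge0 (D : set T) (f g : T -> \bar R) : measurable D ->
  measurable_fun D f -> measurable_fun D g ->
  (forall x, D x -> 0 <= g x)%E -> (forall x, D x -> f x <= g x)%E ->
  (\int[m]_(x in D) f x <= \int[m]_(x in D) g x)%E.
Proof.
move=> mD mf mg g0 fg; rewrite integralE.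
apply: (@le_trans _ _ (\int[m]_(x in D) f^\+ x)%E).
  have n0 : (0 <= \int[m]_(x in D) f^\- x)%E by apply: integral_ge0.
  rewrite -[leRHS]sube0; apply: leeB => //.
apply: ge0_le_integral => //; first exact: measurable_funepos.
by move=> x Dx; rewrite funeposE ge_max fg//= g0.
Qed.

(* No measurability is needed: the integral of a nonnegative function is a
   supremum over the simple functions below it. *)
Lemma ge0_le_integral_nonmeasurable (D : set T) (f g : T -> \bar R) :
  (forall x, D x -> 0 <= f x)%E -> (forall x, D x -> f x <= g x)%E ->
  (\int[m]_(x in D) f x <= \int[m]_(x in D) g x)%E.
Proof.
move=> f0 fg.
have g0 x : D x -> (0 <= g x)%E by move=> Dx; exact: le_trans (f0 x Dx) (fg x Dx).
rewrite !ge0_integralE//.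
apply: ereal_sup_le => _ [h /= hf <-]; exists h => //= x.
apply: le_trans (hf x) _; rewrite /patch; case: ifPn => // /set_mem.
exact: fg.
Qed.

End integral_sums.

Section elementary.
Context {R : realType} {d : measure_display} {Omega : measurableType d}
  (P : probability Omega R) {H Xi : hilbertType R}
  (W : R -> Xi -> Omega -> R) (t T : R).
Hypothesis refW : reference_space P W t T.
Local Notation F := (wiener_filtration P W t).
Local Notation M := (@gaussian_variance R).
Local Notation mu := (@lebesgue_measure R).
Let sF := wiener_filtration_sigma_algebra P W t.
Local Notation eterm := (@elementary_term R d Omega H Xi).

Definition stoch_term (e : eterm) w : R :=
  e_coef e w * increment W (e_left e) (e_right e) (e_dir e) w.

Definition overlap (e e' : eterm) : R :=
  Num.max 0 (Num.min (e_right e) (e_right e') - Num.max (e_left e) (e_left e')).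

(** The Hilbert-Schmidt inner product of the two rank-one operators. *)
Definition gram (e e' : eterm) : R :=
  inner (e_dir e) (e_dir e') * inner (e_val e) (e_val e').

Lemma overlapC e e' : overlap e e' = overlap e' e.
Proof. by rewrite /overlap minC [Num.max (e_left e) _]maxC. Qed.

Section bounded_horizon.
Variable s : R.
Hypothesis sT : s <= T.

Lemma expectation_stoch_termM (e e' : eterm) :
  elementary_adapted P W t s e -> elementary_adapted P W t s e' ->
  P.-integrable setT (EFin \o (fun w => stoch_term e w * stoch_term e' w)) /\
  (\int[P]_w (stoch_term e w * stoch_term e' w) =
   (\int[P]_w (e_coef e w * e_coef e' w)) *
     (M * overlap e e' * inner (e_dir e) (e_dir e')))%R.
Proof.
wlog le : e e' / e_left e <= e_left e'.
  move=> h ad ad'; have [le|/ltW le] := leP (e_left e) (e_left e').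
    exact: h.
  have [h1 h2] := h _ _ le ad' ad.
  have E : (fun w => stoch_term e' w * stoch_term e w) =
    (fun w => stoch_term e w * stoch_term e' w) by apply/funext => w; rewrite mulrC.
  rewrite E in h1; split => //; move: h2; rewrite E => ->.
  rewrite overlapC innerC; congr (_ * _).
  by apply: eq_Rintegral => w _; rewrite mulrC.
move=> [ta ab bs bd bc] [ta' ab' bs' bd' bc'].
by apply: (expectation_mul_increments_le refW) => //; exact: le_trans sT.
Qed.

Lemma integral_indic_overlap (e e' : eterm) :
  elementary_adapted P W t s e -> elementary_adapted P W t s e' ->
  mu.-integrable `[t, s] (EFin \o (fun r =>
    \1_`]e_left e, e_right e] r * \1_`]e_left e', e_right e'] r)) /\
  (\int[mu]_(r in `[t, s])
     (\1_`]e_left e, e_right e] r * \1_`]e_left e', e_right e'] r) =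
   overlap e e')%R.
Proof.
move=> [ta ab bs _ _] [ta' ab' bs' _ _].
pose A := `]e_left e, e_right e]%classic `&` `]e_left e', e_right e']%classic : set R.
have E : (fun r : R => \1_`]e_left e, e_right e] r * \1_`]e_left e', e_right e'] r)
   = (\1_A : R -> R) by rewrite indicI.
have AE : A = `](Num.max (e_left e) (e_left e')), (Num.min (e_right e) (e_right e'))]%classic.
  apply/seteqP; split => x; rewrite /A /= !in_itv/= gt_max le_min.
    by move=> [/andP[-> ->] /andP[-> ->]].
  by move=> /andP[/andP[-> ->] /andP[-> ->]].
have mA : measurable (A : set (measurableTypeR R)).
  by apply: measurableI; exact: measurable_itv.
rewrite E; split.
  apply: (@integrableS _ _ _ _ setT) => //.
  by rewrite AE; exact: integrable_indic_itv.
rewrite /Rintegral integral_indic//.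
have -> : A `&` `[t, s]%classic = A.
  apply/setIidl => x; rewrite /A /= !in_itv/= => -[/andP[h1 h2] _].
  by rewrite (le_trans ta (ltW h1)) (le_trans h2 bs).
rewrite AE; have := lebesgue_measure_itv
  `](Num.max (e_left e) (e_left e')), (Num.min (e_right e) (e_right e'))].
rewrite /= lte_fin /overlap => ->.
case: ltP => h.
  by rewrite -EFinB/=; apply/esym/max_idPr; rewrite subr_ge0 ltW.
by apply/esym/max_idPl; rewrite subr_le0.
Qed.

End bounded_horizon.
End elementary.

(** * Tonelli on a strip of time and chance *)

Section iterated_integral.
Context {R : realType} {d : measure_display} {Omega : measurableType d}
  (P : probability Omega R).
Local Notation mu := (@lebesgue_measure R).
Local Notation RT := (measurableTypeR R).
Variables (D : set R) (f : R -> Omega -> \bar R).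
Hypothesis mD : measurable (D : set RT).
Hypothesis mf : measurable_fun (D `*` setT : set (RT * Omega)%type)
  (fun z => f z.1 z.2).

(** Extension by zero, so that Tonelli on the full product applies to data that are measurable only
    on a strip. *)
Let g : (RT * Omega)%type -> \bar R := (fun z => f z.1 z.2) \_ (D `*` setT).

Let mDT : measurable (D `*` setT : set (RT * Omega)%type).
Proof. exact: measurableX. Qed.

Let mg : measurable_fun setT g.
Proof. exact/(measurable_restrictT _ mDT). Qed.

Let gE r w : g (r, w) = ((f ^~ w) \_ D) r.
Proof.
rewrite /g /patch; case: ifPn => [/set_mem/= [Dr _]|].
  by rewrite mem_set.
by rewrite notin_setE => h; rewrite memNset// => Dr; apply: h.
Qed.

Lemma measurable_fun_section w : measurable_fun (D : set RT) (f ^~ w).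
Proof.
apply/(measurable_restrictT _ mD).
have -> : (f ^~ w) \_ D = (fun r => g (r, w)) by apply/funext => r; rewrite gE.
exact: measurableT_comp mg (pair2_measurable w).
Qed.

Lemma measurable_fun_section2 r : D r -> measurable_fun setT (f r).
Proof.
move=> Dr; have -> : f r = (fun w => g (r, w)).
  by apply/funext => w; rewrite gE patchE mem_set.
exact: measurableT_comp mg (pair1_measurable r).
Qed.

Hypothesis f0 : forall r w, D r -> (0 <= f r w)%E.

Let g0 z : (0 <= g z)%E.
Proof.
by rewrite /g /patch; case: ifPn => // /set_mem[Dz _]; exact: f0.
Qed.

Let fubGE w : fubini_G mu g w = (\int[mu]_(r in D) f r w)%E.
Proof.
rewrite [RHS]integral_mkcond /fubini_G; apply: eq_integral => r _.
exact: gE.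
Qed.

Let fubFE r : fubini_F P g r = ((fun r => \int[P]_w f r w) \_ D)%E r.
Proof.
rewrite /fubini_F /patch; case: ifPn => Dr.
  by apply: eq_integral => w _; rewrite gE patchE Dr.
rewrite integral0_eq// => w _; rewrite gE patchE.
by rewrite (negbTE Dr).
Qed.

Lemma measurable_fun_integral1 :
  measurable_fun setT (fun w => \int[mu]_(r in D) f r w)%E.
Proof.
have := measurable_fun_fubini_tonelli_G g mg g0 (m1 := mu).
by apply: eq_measurable_fun => w _; rewrite fubGE.
Qed.

Lemma measurable_fun_integral2 :
  measurable_fun (D : set RT) (fun r => \int[P]_w f r w)%E.
Proof.
apply/(measurable_restrictT _ mD).
have := measurable_fun_fubini_tonelli_F g mg g0 (m2 := P).
by apply: eq_measurable_fun => r _; rewrite fubFE.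
Qed.

Lemma iterated_integral_prod : (\int[P]_w \int[mu]_(r in D) f r w =
  \int[mu \x P]_(z in D `*` setT) f z.1 z.2)%E.
Proof.
rewrite [RHS]integral_mkcond (fubini_tonelli2 g mg g0).
by apply: eq_integral => w _; rewrite fubGE.
Qed.

Lemma iterated_integral_swap : (\int[P]_w \int[mu]_(r in D) f r w =
  \int[mu]_(r in D) \int[P]_w f r w)%E.
Proof.
rewrite iterated_integral_prod [LHS]integral_mkcond (fubini_tonelli1 g mg g0).
by rewrite [RHS]integral_mkcond; apply: eq_integral => r _; rewrite fubFE.
Qed.

End iterated_integral.

Section elementary_bound.
Context {R : realType} {d : measure_display} {Omega : measurableType d}
  (P : probability Omega R) {H Xi : hilbertType R}
  (W : R -> Xi -> Omega -> R) (t T : R).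
Hypothesis refW : reference_space P W t T.
Local Notation M := (@gaussian_variance R).
Local Notation mu := (@lebesgue_measure R).
Local Notation RT := (measurableTypeR R).
Local Notation eterm := (@elementary_term R d Omega H Xi).
Variables (s : R) (n : nat) (e : nat -> eterm).
Hypotheses (ts : t <= s) (sT : s <= T).
Hypothesis ad : forall i, (i < n)%N -> elementary_adapted P W t s (e i).

Let mts : measurable (`[t, s]%classic : set RT).
Proof. exact: measurable_itv. Qed.

Lemma gaussian_variance_ge0 : 0 <= M.
Proof. by apply: fine_ge0; apply: integral_ge0 => x _; rewrite lee_fin sqr_ge0. Qed.

Definition ecoef i r w : R := \1_`]e_left (e i), e_right (e i)] r * e_coef (e i) w.

(** The squared Hilbert-Schmidt norm of the elementary process, expanded through Gram matrices: a
    finite sum in which no basis appears. *)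
Definition quadratic_form r w : R := \sum_(i < n) \sum_(j < n)
  ecoef i r w * ecoef j r w * inner (e_dir (e i)) (e_dir (e j)) *
  inner (e_val (e i)) (e_val (e j)).

Let cc (i j : 'I_n) w := e_coef (e i) w * e_coef (e j) w.

Let coef_measurable (i : 'I_n) : measurable_fun setT (e_coef (e i)).
Proof.
have [ta ab bs _ bc] := ad (ltn_ord i).
apply: (borel_on_wiener_measurable refW _ bc).
exact: le_trans (le_trans ab bs) sT.
Qed.

Let coef_bounded (i : 'I_n) : exists K, forall w, `|e_coef (e i) w| <= K.
Proof. by have [] := ad (ltn_ord i). Qed.

Let integrable_cc i j : P.-integrable setT (EFin \o cc i j).
Proof.
apply: integrable_bounded_mul => //.
have [K cK] := coef_bounded j; apply: (@integrable_le _ _ _ _ _ (fun=> K)) => //.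
exact: finite_measure_integrable_cst.
Qed.

Lemma expectation_sqnorm_elementary_integral :
  P.-integrable setT (EFin \o (fun w => `|elementary_integral W n e w| ^+ 2)) /\
  (\int[P]_w (`|elementary_integral W n e w| ^+ 2) = M * \sum_(i < n) \sum_(j < n)
    (\int[P]_w cc i j w) * (overlap (e i) (e j) * gram (e i) (e j)))%R.
Proof.
pose f (i j : 'I_n) w := inner (e_val (e i)) (e_val (e j)) *
  (stoch_term W (e i) w * stoch_term W (e j) w).
have E : (fun w => `|elementary_integral W n e w| ^+ 2) =
    (fun w => \sum_(i < n) \sum_(j < n) f i j w).
  apply/funext => w; rewrite /elementary_integral sqnorm_sum.
  apply: eq_bigr => i _; apply: eq_bigr => j _.
  by rewrite innerZl innerZr /f /stoch_term /increment; ring.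
have h i j := expectation_stoch_termM refW sT (ad (ltn_ord i)) (ad (ltn_ord j)).
have iF (i j : 'I_n) : P.-integrable setT (EFin \o f i j).
  have := integrableZl measurableT (inner (e_val (e i)) (e_val (e j))) (h i j).1.
  by apply: eq_integrable => // w _ /=; rewrite EFinM.
have [i1 e1] := Rintegral_sum2 (index_enum 'I_n) (index_enum 'I_n) measurableT iF.
rewrite E; split => //; rewrite e1 mulr_sumr.
apply: eq_bigr => i _; rewrite mulr_sumr; apply: eq_bigr => j _.
rewrite /f RintegralZl//; last exact: (h i j).1.
by rewrite (h i j).2 /gram /cc; ring.
Qed.

Let integral_quadratic_form w :
  (\int[mu]_(r in `[t, s]) (quadratic_form r w)%:E =
   (\sum_(i < n) \sum_(j < n) cc i j w * (overlap (e i) (e j) * gram (e i) (e j)))%:E)%E.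
Proof.
pose f (i j : 'I_n) (r : R) := cc i j w * gram (e i) (e j) *
  (\1_`]e_left (e i), e_right (e i)] r * \1_`]e_left (e j), e_right (e j)] r).
have h i j := integral_indic_overlap (ad (ltn_ord i)) (ad (ltn_ord j)).
have iF (i j : 'I_n) : mu.-integrable `[t, s] (EFin \o f i j).
  have := integrableZl mts (cc i j w * gram (e i) (e j)) (h i j).1.
  by apply: eq_integrable => // r _ /=; rewrite EFinM.
have [i1 e1] := Rintegral_sum2 (index_enum 'I_n) (index_enum 'I_n) mts iF.
transitivity (\int[mu]_(r in `[t, s]) (\sum_(i < n) \sum_(j < n) f i j r)%:E)%E.
  apply: eq_integral => r _; congr EFin; rewrite /quadratic_form.
  apply: eq_bigr => i _; apply: eq_bigr => j _.
  by rewrite /ecoef /f /cc /gram; ring.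
rewrite -EFin_Rintegral// e1; congr EFin.
apply: eq_bigr => i _; apply: eq_bigr => j _.
by rewrite /f RintegralZl//; [rewrite (h i j).2; ring|exact: (h i j).1].
Qed.

(** Both sides become the same double sum over pairs of terms: on the left the overlaps come from
    expectations of products of increments, on the right from time integrals of products of
    indicators. *)
Lemma ito_isometry : (\int[P]_w (`|elementary_integral W n e w| ^+ 2)%:E =
  M%:E * \int[P]_w \int[mu]_(r in `[t, s]) (quadratic_form r w)%:E)%E.
Proof.
have [i1 e1] := expectation_sqnorm_elementary_integral.
under [in RHS]eq_integral do rewrite integral_quadratic_form.
pose f (i j : 'I_n) w := cc i j w * (overlap (e i) (e j) * gram (e i) (e j)).
have iF (i j : 'I_n) : P.-integrable setT (EFin \o f i j).
  have := integrableZr measurableT (overlap (e i) (e j) * gram (e i) (e j))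
    (integrable_cc i j).
  by apply: eq_integrable => // w _ /=; rewrite EFinM.
have [i2 e2] := Rintegral_sum2 (index_enum 'I_n) (index_enum 'I_n) measurableT iF.
rewrite -(EFin_Rintegral measurableT i1) e1 -(EFin_Rintegral measurableT i2) e2.
rewrite -EFinM; congr (_ * _)%:E.
apply: eq_bigr => i _; apply: eq_bigr => j _.
by rewrite /f RintegralZr.
Qed.

Lemma ecoef_measurable (i : 'I_n) :
  measurable_fun setT (fun z : (RT * Omega)%type => ecoef i z.1 z.2).
Proof.
apply: measurable_funM.
  have mi : measurable_fun (setT : set RT) (\1_`]e_left (e i), e_right (e i)] : RT -> R).
    by apply: measurable_indic; exact: measurable_itv.
  exact: measurableT_comp mi measurable_fst.
exact: measurableT_comp.
Qed.

Lemma measurable_sqnorm_elementary_process (xi : Xi) :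
  measurable_fun setT (fun z : (RT * Omega)%type =>
    `|elementary_process n e z.1 z.2 xi| ^+ 2).
Proof.
under eq_fun do rewrite /elementary_process sqnorm_sum.
apply: measurable_sum => i; apply: measurable_sum => j.
under eq_fun do rewrite innerZl innerZr.
apply: measurable_funM; first by apply: measurable_funM => //; exact: ecoef_measurable.
apply: measurable_funM => //.
by apply: measurable_funM => //; exact: ecoef_measurable.
Qed.

(** A square sum over [F] replaces the exact norm [quadratic_form]. One [F] serves all times and
    outcomes because the coefficients are uniformly bounded. *)
Lemma elementary_integral_bound (eps : R) : 0 < eps -> exists2 F, @onbseq R Xi F &
  (\int[P]_w (`|elementary_integral W n e w| ^+ 2)%:E <=
   M%:E * \int[P]_w \int[mu]_(r in `[t, s])
     (\sum_(xi <- F) `|elementary_process n e r w xi| ^+ 2 + eps)%:E)%E.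
Proof.
move=> eps0.
have [K cK] : exists K, forall (i : 'I_n) w, `|e_coef (e i) w| <= K.
  have /choice[K KP] := coef_bounded.
  exists (\sum_i `|K i|) => i w; apply: le_trans (KP i w) _.
  rewrite (bigD1 i)//=; apply: le_trans (ler_norm _) _.
  by rewrite lerDl sumr_ge0.
have [F Fo Fle] := finite_rank_hs_approx (fun i : 'I_n => e_dir (e i))
  (fun i : 'I_n => e_val (e i)) K eps0.
exists F => //; rewrite ito_isometry.
apply: lee_wpmul2l; first by rewrite lee_fin gaussian_variance_ge0.
pose G (r : R) w : \bar R :=
  (\sum_(xi <- F) `|elementary_process n e r w xi| ^+ 2 + eps)%:E.
have mG : measurable_fun (`[t, s]%classic `*` setT : set (RT * Omega)%type)
    (fun z => G z.1 z.2).
  apply/measurable_funTS/measurable_EFinP; apply: measurable_funD => //.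
  by apply: measurable_sum => xi; exact: measurable_sqnorm_elementary_process.
have G0 r w : `[t, s]%classic r -> (0 <= G r w)%E.
  move=> _; rewrite lee_fin; apply: addr_ge0; last exact: ltW.
  by apply: sumr_ge0 => xi _; exact: exprn_ge0.
apply: le_integral_ge0 => //.
- under eq_fun do rewrite integral_quadratic_form.
  apply/measurable_EFinP; apply: measurable_sum => i; apply: measurable_sum => j.
  by apply: measurable_funM => //; apply: measurable_funM.
- exact: (measurable_fun_integral1 mts mG G0).
- by move=> w _; apply: integral_ge0 => r; exact: G0.
move=> w _; apply: le_integral_ge0 => //.
- apply/measurable_EFinP; apply: measurable_funTS.
  apply: measurable_sum => i; apply: measurable_sum => j.
  have h (k : 'I_n) : measurable_fun setT (fun r : RT => ecoef k r w).
    exact: (measurableT_comp (ecoef_measurable k) (pair2_measurable w)).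
  by do 2! apply: measurable_funM => //; exact: measurable_funM.
- exact: measurable_fun_section mts mG w.
- by move=> r; exact: G0.
move=> r _; rewrite lee_fin; apply: Fle => i.
rewrite normrM; apply: le_trans (cK i w); rewrite ler_piMl//.
by rewrite indicE; case: (_ \in _); rewrite ?normr1 ?normr0.
Qed.

End elementary_bound.

Section ge0_integral_bounds.
Context {R : realType} {d : measure_display} {T : measurableType d}
  (m : {measure set T -> \bar R}).

Lemma ge0_integral_le2 (D : set T) (a b : R) (u v w : T -> R) : measurable D ->
  0 <= a -> 0 <= b -> measurable_fun D v -> measurable_fun D w ->
  (forall x, D x -> 0 <= u x) -> (forall x, D x -> 0 <= v x) ->
  (forall x, D x -> 0 <= w x) ->
  (forall x, D x -> u x <= a * v x + b * w x) ->
  (\int[m]_(x in D) (u x)%:E <=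
   a%:E * \int[m]_(x in D) (v x)%:E + b%:E * \int[m]_(x in D) (w x)%:E)%E.
Proof.
move=> mD a0 b0 mv mw u0 v0 w0 uvw.
have mv' : measurable_fun D (fun x => (v x)%:E) by exact/measurable_EFinP.
have mw' : measurable_fun D (fun x => (w x)%:E) by exact/measurable_EFinP.
rewrite -!ge0_integralZl_EFin// -ge0_integralD//.
- apply: ge0_le_integral_nonmeasurable => x Dx; first by rewrite lee_fin u0.
  by rewrite -!EFinM -EFinD lee_fin uvw.
- by move=> x Dx; rewrite -EFinM lee_fin mulr_ge0// v0.
- exact: measurable_funeM.
- by move=> x Dx; rewrite -EFinM lee_fin mulr_ge0// w0.
- exact: measurable_funeM.
Qed.

End ge0_integral_bounds.

Section iterated_bounds.
Context {R : realType} {d : measure_display} {Omega : measurableType d}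
  (P : probability Omega R).
Local Notation mu := (@lebesgue_measure R).
Local Notation RT := (measurableTypeR R).

Lemma iterated_integral_le2 (D : set R) (a b : R) (u v w : R -> Omega -> R) :
  measurable (D : set RT) -> 0 <= a -> 0 <= b ->
  measurable_fun (D `*` setT : set (RT * Omega)%type) (fun z => v z.1 z.2) ->
  measurable_fun (D `*` setT : set (RT * Omega)%type) (fun z => w z.1 z.2) ->
  (forall r x, D r -> 0 <= u r x) -> (forall r x, D r -> 0 <= v r x) ->
  (forall r x, D r -> 0 <= w r x) ->
  (forall r x, D r -> u r x <= a * v r x + b * w r x) ->
  (\int[P]_x \int[mu]_(r in D) (u r x)%:E <=
   a%:E * \int[P]_x \int[mu]_(r in D) (v r x)%:E +
   b%:E * \int[P]_x \int[mu]_(r in D) (w r x)%:E)%E.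
Proof.
move=> mD a0 b0 mv mw u0 v0 w0 uvw.
have mv' : measurable_fun (D `*` setT : set (RT * Omega)%type)
  (fun z => (v z.1 z.2)%:E) by exact/measurable_EFinP.
have mw' : measurable_fun (D `*` setT : set (RT * Omega)%type)
  (fun z => (w z.1 z.2)%:E) by exact/measurable_EFinP.
have v0' r x : D r -> (0 <= (v r x)%:E)%E by move=> Dr; rewrite lee_fin v0.
have w0' r x : D r -> (0 <= (w r x)%:E)%E by move=> Dr; rewrite lee_fin w0.
have mv1 := measurable_fun_integral1 mD mv' v0'.
have mw1 := measurable_fun_integral1 mD mw' w0'.
have Iv0 x : (0 <= \int[mu]_(r in D) (v r x)%:E)%E.
  by apply: integral_ge0 => r; exact: v0'.
have Iw0 x : (0 <= \int[mu]_(r in D) (w r x)%:E)%E.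
  by apply: integral_ge0 => r; exact: w0'.
rewrite -!ge0_integralZl_EFin// -ge0_integralD//.
- apply: ge0_le_integral_nonmeasurable => x _.
    by apply: integral_ge0 => r Dr; rewrite lee_fin u0.
  have mvx : measurable_fun (D : set RT) (v ^~ x).
    by apply/measurable_EFinP; exact: (@measurable_fun_section _ _ _ D (fun r y => (v r y)%:E) mD mv' x).
  have mwx : measurable_fun (D : set RT) (w ^~ x).
    by apply/measurable_EFinP; exact: (@measurable_fun_section _ _ _ D (fun r y => (w r y)%:E) mD mw' x).
  by apply: ge0_integral_le2 => // r Dr; [exact: u0|exact: v0|exact: w0|exact: uvw].
- by move=> x _; rewrite mule_ge0.
- exact: measurable_funeM.
- by move=> x _; rewrite mule_ge0.
- exact: measurable_funeM.
Qed.

End iterated_bounds.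

Section sqnorms.
Context {R : realType} {H : hilbertType R}.

Lemma sqnormD_le (x y : H) : `|x + y| ^+ 2 <= 2 * `|x| ^+ 2 + 2 * `|y| ^+ 2.
Proof.
have : 0 <= `|x - y| ^+ 2 by exact: sqr_ge0.
by rewrite sqnormB sqnormD; lra.
Qed.

Lemma borel_on_sqnorm {d : measure_display} {T : measurableType d} (D : set T)
    (f : T -> H) : measurable D -> borel_on measurable D f ->
  measurable_fun D (fun x => `|f x| ^+ 2).
Proof.
move=> mD bf; apply: measurable_funX.
by apply/borel_on_measurable_fun => //; exact: borel_on_norm.
Qed.

End sqnorms.

Section progressive.
Context {R : realType} {d : measure_display} {Omega : measurableType d}
  (P : probability Omega R) {Xi : hilbertType R}
  (W : R -> Xi -> Omega -> R) (t T : R).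
Hypothesis refW : reference_space P W t T.
Local Notation RT := (measurableTypeR R).

Lemma borel_prod_measurable s : s <= T ->
  borel_prod (wiener_filtration P W t s) `<=`
  (measurable : set (set (RT * Omega)%type)).
Proof.
move=> sT; apply: smallest_sub; first exact: sigma_algebra_measurable.
move=> _ [A mA [B FB <-]]; apply: measurableX => //.
exact: (wiener_filtration_measurable refW sT FB).
Qed.

Lemma progressive_borel_on (E : topologicalType) s s' (f : R -> Omega -> E) :
  t <= s -> s <= s' -> s' <= T -> progressive P W t s' f ->
  borel_on (measurable : set (set (RT * Omega)%type)) (`[t, s]%classic `*` setT)
    (fun z => f z.1 z.2).
Proof.
move=> ts ss' s'T pf; apply: borel_on_sub (pf s _); last by rewrite ts.
by apply: borel_prod_measurable; exact: le_trans s'T.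
Qed.

End progressive.

(** * Ito integrals as limits of elementary integrals *)

Section ito_approximation.
Context {R : realType} {d : measure_display} {Omega : measurableType d}
  (P : probability Omega R) {H Xi : hilbertType R} (sepH : separable H)
  (W : R -> Xi -> Omega -> R) (t T : R).
Hypothesis refW : reference_space P W t T.
Local Notation M := (@gaussian_variance R).
Local Notation mu := (@lebesgue_measure R).
Local Notation RT := (measurableTypeR R).
Local Notation eterm := (@elementary_term R d Omega H Xi).
Variable s : R.
Hypotheses (ts : t <= s) (sT : s <= T).
Implicit Types (Phi Psi : R -> Omega -> Xi -> H) (I J : Omega -> H) (F : seq Xi).

Let mts : measurable (`[t, s]%classic : set RT).
Proof. exact: measurable_itv. Qed.

Let D : set (RT * Omega)%type := `[t, s]%classic `*` setT.

Let mD : measurable D.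
Proof. exact: measurableX. Qed.

Let sm := @sigma_algebra_measurable _ (RT * Omega)%type.

Definition sumsq F Phi r w : R := \sum_(xi <- F) `|Phi r w xi| ^+ 2.

Definition operator_measurable Phi := forall xi,
  borel_on (measurable : set (set (RT * Omega)%type)) D
    (fun z => Phi z.1 z.2 xi).

(* Finite partial sums replace the Hilbert-Schmidt norm, so that all the
   integrands are measurable without a measurability theory for this norm. *)
Definition ito_approx Phi I := forall delta : R, 0 < delta ->
  exists n (e : nat -> eterm),
  [/\ forall i, (i < n)%N -> elementary_adapted P W t s (e i),
      forall F, onbseq F -> (\int[P]_w \int[mu]_(r in `[t, s])
        (sumsq F (fun r w xi => (Phi r w xi - elementary_process n e r w xi)%R) r w)%:E
        <= delta%:E)%E
    & (\int[P]_w (`|I w - elementary_integral W n e w|%R ^+ 2)%:E <= delta%:E)%E].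

Lemma sumsq_ge0 F Phi r w : 0 <= sumsq F Phi r w.
Proof. by apply: sumr_ge0 => xi _; exact: exprn_ge0. Qed.

Lemma sumsq_lin F Phi Psi Th k r w :
  (forall xi, Th r w xi = Phi r w xi + k *: Psi r w xi) ->
  sumsq F Th r w <= 2 * sumsq F Phi r w + (2 * k ^+ 2) * sumsq F Psi r w.
Proof.
move=> ThE; rewrite /sumsq !mulr_sumr -big_split/=; apply: ler_sum => xi _.
apply: le_trans (_ : 2 * `|Phi r w xi| ^+ 2 + 2 * `|k *: Psi r w xi| ^+ 2 <= _).
  by rewrite ThE sqnormD_le.
by rewrite normrZ exprMn real_normK ?num_real//; lra.
Qed.

Lemma measurable_sumsq F Phi : operator_measurable Phi ->
  measurable_fun D (fun z => sumsq F Phi z.1 z.2).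
Proof. by move=> mPhi; apply: measurable_sum => xi; exact: borel_on_sqnorm. Qed.

Lemma operator_measurable_lin Phi Psi k : operator_measurable Phi ->
  operator_measurable Psi ->
  operator_measurable (fun r w xi => Phi r w xi + k *: Psi r w xi).
Proof.
by move=> mPhi mPsi xi; apply: borel_onD => //; exact: borel_onZl.
Qed.

Lemma operator_measurable_elementary n (e : nat -> eterm) :
  (forall i, (i < n)%N -> elementary_adapted P W t s (e i)) ->
  operator_measurable (elementary_process n e).
Proof.
move=> ad xi; apply: (borel_on_sum sm sepH) => // i.
apply: borel_onZ => //; last exact: borel_on_cst.
apply/borel_on_measurable_fun => //; apply: measurable_funTS.
apply: measurable_funM => //; exact: (ecoef_measurable refW sT ad i).
Qed.

(** The scalar goes into [e_val], a field on which adaptedness imposes nothing, so the scaled term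
    stays adapted. *)
Definition scale_term k (e : eterm) : eterm :=
  ElementaryTerm (e_left e) (e_right e) (e_coef e) (e_dir e) (k *: e_val e).

Definition cat_terms n (e1 e2 : nat -> eterm) i :=
  if (i < n)%N then e1 i else e2 (i - n)%N.

Lemma elementary_lin n1 (e1 : nat -> eterm) n2 (e2 : nat -> eterm) k :
  (forall i, (i < n1)%N -> elementary_adapted P W t s (e1 i)) ->
  (forall i, (i < n2)%N -> elementary_adapted P W t s (e2 i)) ->
  exists n e, [/\ forall i, (i < n)%N -> elementary_adapted P W t s (e i),
    forall r w xi, elementary_process n e r w xi =
      elementary_process n1 e1 r w xi + k *: elementary_process n2 e2 r w xi
  & forall w, elementary_integral W n e w =
      elementary_integral W n1 e1 w + k *: elementary_integral W n2 e2 w].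
Proof.
move=> ad1 ad2.
exists (n1 + n2)%N, (cat_terms n1 e1 (fun i => scale_term k (e2 i))).
have El (i : 'I_n1) : cat_terms n1 e1 (fun i => scale_term k (e2 i)) (lshift n2 i) = e1 i.
  by rewrite /cat_terms /= ltn_ord.
have Er (i : 'I_n2) : cat_terms n1 e1 (fun i => scale_term k (e2 i)) (rshift n1 i) =
    scale_term k (e2 i).
  by rewrite /cat_terms /= ltnNge leq_addr /= addKn.
split.
- move=> i i12; rewrite /cat_terms; case: ltnP => i1; first exact: ad1.
  have [|? ? ? ? ?] := ad2 (i - n1)%N; first by rewrite ltn_subLR.
  by split.
- move=> r w xi; rewrite /elementary_process big_split_ord scaler_sumr; congr (_ + _).
    by apply: eq_bigr => i _; rewrite El.
  by apply: eq_bigr => i _; rewrite Er/= !scalerA mulrC.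
- move=> w; rewrite /elementary_integral big_split_ord scaler_sumr; congr (_ + _).
    by apply: eq_bigr => i _; rewrite El.
  by apply: eq_bigr => i _; rewrite Er/= !scalerA mulrC.
Qed.

Lemma borel_on_elementary_integral n (e : nat -> eterm) :
  (forall i, (i < n)%N -> elementary_adapted P W t s (e i)) ->
  borel_on measurable setT (elementary_integral W n e).
Proof.
move=> ad; rewrite /elementary_integral.
have sO := @sigma_algebra_measurable _ Omega.
have -> : (fun w => elementary_integral W n e w) =
   (fun w => \sum_(i < n) stoch_term W (e i) w *: e_val (e i)) by [].
apply: (borel_on_sum sO sepH) => // i.
apply: borel_onZ => //; last exact: borel_on_cst.
apply/borel_on_measurable_fun => //.
have [ta ab bs _ bc] := ad _ (ltn_ord i).
have bT := le_trans bs sT.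
apply: measurable_funM.
  by apply: (borel_on_wiener_measurable refW _ bc); exact: le_trans bT.
exact: (increment_measurable refW ta ab bT).
Qed.

Lemma ito_approx_lin Phi Psi I J k :
  operator_measurable Phi -> operator_measurable Psi ->
  borel_on measurable setT I -> borel_on measurable setT J ->
  ito_approx Phi I -> ito_approx Psi J ->
  ito_approx (fun r w xi => Phi r w xi + k *: Psi r w xi)
             (fun w => I w + k *: J w).
Proof.
move=> mPhi mPsi mI mJ aPhi aPsi delta delta0.
(* The accuracies match the weights [2] and [2 * k ^+ 2] in the bound for the squared norm of a sum;
   [1 + k ^+ 2] instead of [k ^+ 2] allows [k = 0]. *)
have d1 : 0 < delta / 4 by rewrite divr_gt0.
have k2 : 0 < 1 + k ^+ 2 by rewrite ltr_wpDr// sqr_ge0.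
have d2 : 0 < delta / (4 * (1 + k ^+ 2)) by rewrite divr_gt0// mulr_gt0.
have [n1 [e1 [ad1 A1 B1]]] := aPhi _ d1.
have [n2 [e2 [ad2 A2 B2]]] := aPsi _ d2.
have [n [e [ad pE iE]]] := elementary_lin k ad1 ad2.
have small : 2 * (delta / 4) + 2 * k ^+ 2 * (delta / (4 * (1 + k ^+ 2))) <= delta.
  have zE : delta / (4 * (1 + k ^+ 2)) * (1 + k ^+ 2) = delta / 4.
    by field; rewrite gt_eqF.
  by move: zE d2; move: (_ / (4 * _)) => z; lra.
have k0 : 0 <= 2 * k ^+ 2 by rewrite mulr_ge0// sqr_ge0.
have op1 := operator_measurable_elementary ad1.
have op2 := operator_measurable_elementary ad2.
exists n, e; split => // [F Fo|].
- pose v := sumsq F (fun r w xi => Phi r w xi - elementary_process n1 e1 r w xi).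
  pose u := sumsq F (fun r w xi => Psi r w xi - elementary_process n2 e2 r w xi).
  have h : (\int[P]_w \int[mu]_(r in `[t, s]) (sumsq F (fun r w xi =>
        (Phi r w xi + k *: Psi r w xi - elementary_process n e r w xi)%R) r w)%:E <=
      2%:E * \int[P]_w \int[mu]_(r in `[t, s]) (v r w)%:E +
      (2 * k ^+ 2)%:E * \int[P]_w \int[mu]_(r in `[t, s]) (u r w)%:E)%E.
    apply: iterated_integral_le2 => //.
    + by apply: measurable_sumsq => xi; exact: borel_onB.
    + by apply: measurable_sumsq => xi; exact: borel_onB.
    + by move=> *; exact: sumsq_ge0.
    + by move=> *; exact: sumsq_ge0.
    + by move=> *; exact: sumsq_ge0.
    + move=> r w _; apply: sumsq_lin => xi.
      by rewrite pE scalerBr opprD addrACA.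
  apply: (le_trans h); apply: (@le_trans _ _ (2%:E * (delta / 4)%:E +
      (2 * k ^+ 2)%:E * (delta / (4 * (1 + k ^+ 2)))%:E)%E).
    by apply: leeD; apply: lee_wpmul2l; rewrite ?lee_fin//; [exact: A1|exact: A2].
  by rewrite -!EFinM -EFinD lee_fin.
- have bI1 := borel_on_elementary_integral ad1.
  have bI2 := borel_on_elementary_integral ad2.
  have sO := @sigma_algebra_measurable _ Omega.
  pose v w := `|I w - elementary_integral W n1 e1 w| ^+ 2.
  pose u w := `|J w - elementary_integral W n2 e2 w| ^+ 2.
  have h : (\int[P]_w (`|I w + k *: J w - elementary_integral W n e w|%R ^+ 2)%:E <=
      2%:E * \int[P]_w (v w)%:E + (2 * k ^+ 2)%:E * \int[P]_w (u w)%:E)%E.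
    apply: ge0_integral_le2 => //.
    + by apply: borel_on_sqnorm => //; exact: borel_onB.
    + by apply: borel_on_sqnorm => //; exact: borel_onB.
    + by move=> *; rewrite ?/v ?/u exprn_ge0.
    + by move=> *; rewrite ?/v ?/u exprn_ge0.
    + move=> w _; rewrite iE.
      have -> : I w + k *: J w - (elementary_integral W n1 e1 w +
          k *: elementary_integral W n2 e2 w) = (I w - elementary_integral W n1 e1 w) +
          k *: (J w - elementary_integral W n2 e2 w).
        by rewrite scalerBr opprD addrACA.
      apply: le_trans (sqnormD_le _ _) _.
      by rewrite normrZ exprMn real_normK ?num_real// /v /u; lra.
  apply: (le_trans h); apply: (@le_trans _ _ (2%:E * (delta / 4)%:E +
      (2 * k ^+ 2)%:E * (delta / (4 * (1 + k ^+ 2)))%:E)%E).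
    by apply: leeD; apply: lee_wpmul2l; rewrite ?lee_fin.
  by rewrite -!EFinM -EFinD lee_fin.
Qed.

(** The limit passage. Splitting once for the integral and once for the process gives the factor
    [4 = 2 * 2]. The bound [B] has to hold for all families, since the relevant [F] is known only
    after the elementary process has been chosen. *)
Lemma ito_approx_le Phi I (B : R) :
  operator_measurable Phi -> borel_on measurable setT I -> ito_approx Phi I ->
  (forall F, onbseq F ->
    (\int[P]_w \int[mu]_(r in `[t, s]) (sumsq F Phi r w)%:E <= B%:E)%E) ->
  (\int[P]_w (`|I w|%R ^+ 2)%:E <= (4 * M * B)%:E)%E.
Proof.
move=> mPhi mI aPhi hB.
have M0 := @gaussian_variance_ge0 R.
have st0 : 0 <= s - t by rewrite subr_ge0.
(* The total coefficient of [delta] in the final estimate [2 * delta + 2 * (M * (2 * B + 2 * delta +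
   delta * (s - t)))]. *)
pose K := 2 + 4 * M + 2 * M * (s - t).
have K0 : 0 < K.
  have : 0 <= M * (s - t) by rewrite mulr_ge0.
  by rewrite /K; lra.
apply/lee_addgt0Pr => eps eps0.
pose delta := eps / K.
have delta0 : 0 < delta by rewrite divr_gt0.
have [n [e [ad A1 B1]]] := aPhi _ delta0.
have [F Fo hF] := elementary_integral_bound refW sT ad delta0.
have op1 := operator_measurable_elementary ad.
have bI1 := borel_on_elementary_integral ad.
have sO := @sigma_algebra_measurable _ Omega.
have h1 : (\int[P]_w (`|I w|%R ^+ 2)%:E <=
    2%:E * \int[P]_w (`|I w - elementary_integral W n e w|%R ^+ 2)%:E +
    2%:E * \int[P]_w (`|elementary_integral W n e w|%R ^+ 2)%:E)%E.
  apply: ge0_integral_le2 => //.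
  - by apply: borel_on_sqnorm => //; exact: borel_onB.
  - exact: borel_on_sqnorm.
  - by move=> w _; apply: le_trans (sqnormD_le _ _); rewrite subrK.
have h2 : (\int[P]_w \int[mu]_(r in `[t, s])
      (\sum_(xi <- F) `|elementary_process n e r w xi|%R ^+ 2 + delta)%:E <=
    1%:E * \int[P]_w \int[mu]_(r in `[t, s]) (sumsq F (elementary_process n e) r w)%:E +
    1%:E * \int[P]_w \int[mu]_(r in `[t, s]) delta%:E)%E.
  apply: (iterated_integral_le2 P (v := sumsq F (elementary_process n e))
    (w := fun _ _ => delta)) => //.
  - exact: measurable_sumsq.
  - by move=> r w _; rewrite addr_ge0 ?(ltW delta0)//; exact: sumsq_ge0.
  - by move=> r w _; exact: sumsq_ge0.
  - by move=> r w _; exact: ltW.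
  - by move=> r w _; rewrite !mul1r.
have h3 : (\int[P]_w \int[mu]_(r in `[t, s]) (sumsq F (elementary_process n e) r w)%:E <=
    2%:E * \int[P]_w \int[mu]_(r in `[t, s]) (sumsq F Phi r w)%:E +
    2%:E * \int[P]_w \int[mu]_(r in `[t, s]) (sumsq F (fun r w xi =>
      (Phi r w xi - elementary_process n e r w xi)%R) r w)%:E)%E.
  apply: iterated_integral_le2 => //.
  - exact: measurable_sumsq.
  - by apply: measurable_sumsq => xi; exact: borel_onB.
  - by move=> *; exact: sumsq_ge0.
  - by move=> *; exact: sumsq_ge0.
  - by move=> *; exact: sumsq_ge0.
  - move=> r w _.
    have := @sumsq_lin F Phi (fun r w xi =>
      (Phi r w xi - elementary_process n e r w xi)%R) (elementary_process n e) (-1) r w.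
    rewrite sqrrN expr1n mulr1; apply => xi.
    by rewrite scaleN1r opprB addrC subrK.
have h4 : (\int[P]_w \int[mu]_(r in `[t, s]) delta%:E = (delta * (s - t))%:E)%E.
  have hin : (\int[mu]_(r in `[t, s]) delta%:E = (delta * (s - t))%:E)%E.
    rewrite (integral_cst mu mts); have := lebesgue_measure_itv `[t, s]; rewrite /= lte_fin => ->.
    move: ts; rewrite le_eqVlt => /predU1P[->|->].
      by rewrite ltxx subrr mulr0 mule0.
    by rewrite -EFinB -EFinM.
  rewrite hin; transitivity ((delta * (s - t))%:E * P setT)%E; first exact: integral_cst.
  by rewrite probability_setT mule1.
apply: (le_trans h1).
have h5 : (\int[P]_w (`|elementary_integral W n e w|%R ^+ 2)%:E <=
    (M * (2 * B + 2 * delta + delta * (s - t)))%:E)%E.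
  apply: (le_trans hF); rewrite EFinM; apply: lee_wpmul2l; first by rewrite lee_fin.
  apply: (le_trans h2); rewrite !mul1e h4 EFinD; apply: leeD => //.
  apply: (le_trans h3); rewrite (EFinD (2 * B)) (EFinM 2 B) (EFinM 2 delta).
  by apply: leeD; apply: lee_wpmul2l => //; [exact: hB|exact: A1].
apply: (@le_trans _ _ (2%:E * delta%:E +
    2%:E * (M * (2 * B + 2 * delta + delta * (s - t)))%:E)%E).
  by apply: leeD; apply: lee_wpmul2l.
rewrite -!EFinM -!EFinD lee_fin.
have : delta * K = eps by rewrite /delta divfK// gt_eqF.
by rewrite /K; move: (s - t) => z; lra.
Qed.

Lemma ereal_cvg0_near (u : nat -> \bar R) (delta : R) : 0 < delta ->
  u k @[k --> \oo] --> 0%E -> \forall k \near \oo, (u k <= delta%:E)%E.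
Proof.
move=> delta0 cu; apply: (cu [set x | (x <= delta%:E)%E]).
by apply: filterS (lt_nbhsl delta0) => x /ltW h; rewrite /= lee_fin.
Qed.

(** The integrand [hs_norm2] has no established measurability, so it is compared with finite sums
    through the monotonicity that holds for arbitrary nonnegative functions. *)
Lemma is_ito_integral_approx Phi I : is_ito_integral P W t s Phi I ->
  [/\ operator_measurable Phi, borel_on measurable setT I & ito_approx Phi I].
Proof.
move=> [hs prog mI [n [e [ad c1 c2]]]]; split => //.
  move=> xi; exact: (progressive_borel_on refW ts (lexx s) sT (prog xi)).
move=> delta delta0.
have [N _ NP] : \forall k \near \oo, ((\int[P]_w \int[mu]_(r in `[t, s])
             hs_norm2 (fun xi =>
               (Phi r w xi - elementary_process (n k) (e k) r w xi)%R)) <= delta%:E)%E /\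
   ((\int[P]_w (`|I w - elementary_integral W (n k) (e k) w| ^+ 2)%:E) <= delta%:E)%E.
  by near=> k; split; near: k; exact: ereal_cvg0_near.
have [N1 N2] := NP N (leqnn N).
exists (n N), (e N); split => //; first exact: ad.
move=> F Fo; apply: le_trans N1.
apply: ge0_le_integral_nonmeasurable => w _.
  by apply: integral_ge0 => r _; rewrite lee_fin sumsq_ge0.
apply: ge0_le_integral_nonmeasurable => r _; first by rewrite lee_fin sumsq_ge0.
exact: hs_norm2_ge.
Unshelve. all: by end_near. Qed.

End ito_approximation.

(** * The Bochner inequality *)

Section bochner_bound.
Context {R : realType} {H : hilbertType R} (sepH : separable H).
Local Notation mu := (@lebesgue_measure R).
Local Notation RT := (measurableTypeR R).
Variables t s : R.

Let D : set RT := `[t, s]%classic.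

Let mD : measurable D. Proof. exact: measurable_itv. Qed.

Let sm := @sigma_algebra_measurable _ RT.

Let muD_fin A : measurable (A : set RT) -> mu (D `&` A) \is a fin_num.
Proof.
move=> mA; rewrite ge0_fin_numE//; apply: (@le_lt_trans _ _ (mu D)).
  by apply: le_measure; rewrite ?inE//; exact: measurableI.
have := lebesgue_measure_itv `[t, s]; rewrite /= lte_fin => ->.
by case: ifP => _; rewrite -?EFinB ltry.
Qed.

Definition simple_map n (A : nat -> set R) (h : nat -> H) (r : R) : H :=
  \sum_(i < n) \1_(A i) r *: h i.

Definition simple_integral n (A : nat -> set R) (h : nat -> H) : H :=
  \sum_(i < n) fine (mu (`[t, s] `&` A i)) *: h i.

(** Convergence of sequences is restated as approximation at each accuracy, so that two
    approximations combine without reindexing. *)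
Definition bochner_approx (f : R -> H) (v : H) :=
  borel_on (measurable : set (set RT)) D f /\
  forall delta : R, 0 < delta -> exists n A h,
  [/\ forall i, (i < n)%N -> measurable (A i : set RT),
      (\int[mu]_(r in `[t, s]) (`|f r - simple_map n A h r|%R)%:E <= delta%:E)%E
    & `|simple_integral n A h - v| <= delta].

Lemma borel_on_simple_map n A h :
  (forall i, (i < n)%N -> measurable (A i : set RT)) ->
  borel_on (measurable : set (set RT)) D (simple_map n A h).
Proof.
move=> mA; apply: (borel_on_sum sm sepH) => // i.
apply: borel_onZ => //; last exact: borel_on_cst.
apply/borel_on_measurable_fun => //; apply: measurable_indic.
exact: mA.
Qed.

Let measurable_norm (f : R -> H) : borel_on (measurable : set (set RT)) D f ->
  measurable_fun D (fun r => `|f r|).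
Proof. by move=> bf; apply/borel_on_measurable_fun => //; exact: borel_on_norm. Qed.

(** The sets [A i] may overlap, so a term by term bound would be too large. Pairing the integral [v]
    with itself gives [|v| ^+ 2] as the integral of [inner (simple_map n A h r) v], and
    Cauchy-Schwarz applies pointwise. *)
Lemma norm_simple_integral_le n A h :
  (forall i, (i < n)%N -> measurable (A i : set RT)) ->
  (`|simple_integral n A h|%:E <=
   \int[mu]_(r in `[t, s]) (`|simple_map n A h r|%R)%:E)%E.
Proof.
move=> mA; set v := simple_integral n A h.
have [->|v0] := eqVneq v 0; first by rewrite normr0; exact: integral_ge0.
have vp : 0 < `|v| by rewrite normr_gt0.
have bS := borel_on_simple_map h mA.
pose f (i : 'I_n) r := inner (h i) v * (\1_(A i) r : R).
have mAi (i : 'I_n) : measurable (A i : set RT) by exact: mA.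
have i1 (i : 'I_n) : mu.-integrable D (EFin \o (\1_(A i) : R -> R)).
  apply/integrableP; split.
    by apply/measurable_EFinP; exact: measurable_indic.
  under eq_integral do rewrite /= ger0_norm//.
  by rewrite integral_indic// setIC -ge0_fin_numE// muD_fin.
have i2 (i : 'I_n) : mu.-integrable D (EFin \o f i).
  have := integrableZl mD (inner (h i) v) (i1 i).
  by apply: eq_integrable => // r _ /=; rewrite EFinM.
have [i3 e3] := Rintegral_sum (index_enum 'I_n) mD i2.
have vE : \int[mu]_(r in D) (\sum_(i < n) f i r) = `|v| ^+ 2.
  rewrite e3 -inner_norm {1}/v inner_suml; apply: eq_bigr => i _.
  rewrite /f RintegralZl// innerZl mulrC; congr (_ * _).
  by rewrite /Rintegral integral_indic// setIC.
have h1 : ((`|v| ^+ 2)%:E <=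
    `|v|%:E * \int[mu]_(r in `[t, s]) (`|simple_map n A h r|%R)%:E)%E.
  rewrite -vE EFin_Rintegral// -ge0_integralZl_EFin//; last first.
    by apply/measurable_EFinP; exact: measurable_norm.
  apply: le_integral_ge0 => //.
  - exact: measurable_int i3.
  - apply: measurable_funeM; apply/measurable_EFinP; exact: measurable_norm.
  - move=> r _; rewrite -EFinM lee_fin.
    have -> : \sum_(i < n) f i r = inner (simple_map n A h r) v.
      by rewrite inner_suml; apply: eq_bigr => i _; rewrite innerZl mulrC.
    by rewrite mulrC inner_ler_norm.
by move: h1; rewrite expr2 EFinM lee_pmul2l// lte_fin.
Qed.

Lemma bochner_approx_le f v : bochner_approx f v ->
  (`|v|%:E <= \int[mu]_(r in `[t, s]) (`|f r|%R)%:E)%E.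
Proof.
move=> [bf af]; apply/lee_addgt0Pr => eps eps0.
have e2 : 0 < eps / 2 by rewrite divr_gt0.
have [n [A [h [mA h1 h2]]]] := af _ e2.
have bS := borel_on_simple_map h mA.
have h3 : (\int[mu]_(r in `[t, s]) (`|simple_map n A h r|%R)%:E <=
    1%:E * \int[mu]_(r in `[t, s]) (`|f r|%R)%:E +
    1%:E * \int[mu]_(r in `[t, s]) (`|f r - simple_map n A h r|%R)%:E)%E.
  apply: ge0_integral_le2 => //.
  - exact: measurable_norm.
  - by apply: measurable_norm; exact: borel_onB.
  - move=> r _; rewrite !mul1r.
    by have := ler_normB (f r) (f r - simple_map n A h r); rewrite opprB addrC subrK.
apply: (@le_trans _ _ (`|simple_integral n A h|%:E + (eps / 2)%:E)%E).
  rewrite -EFinD lee_fin -lerBlDl; apply: le_trans h2.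
  by rewrite distrC; exact: lerB_dist.
rewrite [X in (_ <= _ + X)%E](_ : eps%:E = (eps / 2)%:E + (eps / 2)%:E)%E; last first.
  by rewrite -EFinD -splitr.
rewrite addeA; apply: leeD => //.
apply: (le_trans (norm_simple_integral_le h mA)); apply: (le_trans h3).
by rewrite !mul1e; apply: leeD.
Qed.

Lemma bochner_approx_lin f g v w k :
  bochner_approx f v -> bochner_approx g w ->
  bochner_approx (fun r => f r + k *: g r) (v + k *: w).
Proof.
move=> [bf af] [bg ag]; split; first by apply: borel_onD => //; exact: borel_onZl.
move=> delta delta0.
have d1 : 0 < delta / 2 by rewrite divr_gt0.
have k1 : 0 < 1 + `|k| by rewrite ltr_wpDr.
have d2 : 0 < delta / (2 * (1 + `|k|)) by rewrite divr_gt0// mulr_gt0.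
have [n1 [A1 [h1 [m1 I1 S1]]]] := af _ d1.
have [n2 [A2 [h2 [m2 I2 S2]]]] := ag _ d2.
have small : delta / 2 + `|k| * (delta / (2 * (1 + `|k|))) <= delta.
  have zE : delta / (2 * (1 + `|k|)) * (1 + `|k|) = delta / 2.
    by field; rewrite gt_eqF.
  by move: zE d2; move: (_ / (2 * _)) => z; lra.
pose A i := if (i < n1)%N then A1 i else A2 (i - n1)%N.
pose h i := if (i < n1)%N then h1 i else k *: h2 (i - n1)%N.
have Al (i : 'I_n1) : A (lshift n2 i) = A1 i by rewrite /A /= ltn_ord.
have Ar (i : 'I_n2) : A (rshift n1 i) = A2 i.
  by rewrite /A /= ltnNge leq_addr /= addKn.
have hl (i : 'I_n1) : h (lshift n2 i) = h1 i by rewrite /h /= ltn_ord.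
have hr (i : 'I_n2) : h (rshift n1 i) = k *: h2 i.
  by rewrite /h /= ltnNge leq_addr /= addKn.
have mapE r : simple_map (n1 + n2) A h r =
    simple_map n1 A1 h1 r + k *: simple_map n2 A2 h2 r.
  rewrite /simple_map big_split_ord scaler_sumr; congr (_ + _).
    by apply: eq_bigr => i _; rewrite Al hl.
  by apply: eq_bigr => i _; rewrite Ar hr !scalerA mulrC.
have intE : simple_integral (n1 + n2) A h =
    simple_integral n1 A1 h1 + k *: simple_integral n2 A2 h2.
  rewrite /simple_integral big_split_ord scaler_sumr; congr (_ + _).
    by apply: eq_bigr => i _; rewrite Al hl.
  by apply: eq_bigr => i _; rewrite Ar hr !scalerA mulrC.
exists (n1 + n2)%N, A, h; split.
- move=> i i12; rewrite /A; case: ltnP => i1; first exact: m1.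
  by apply: m2; rewrite ltn_subLR.
- have hh : (\int[mu]_(r in `[t, s])
      (`|f r + k *: g r - simple_map (n1 + n2) A h r|%R)%:E <=
      1%:E * \int[mu]_(r in `[t, s]) (`|f r - simple_map n1 A1 h1 r|%R)%:E +
      `|k|%:E * \int[mu]_(r in `[t, s]) (`|g r - simple_map n2 A2 h2 r|%R)%:E)%E.
    have bS1 := borel_on_simple_map h1 m1; have bS2 := borel_on_simple_map h2 m2.
    apply: ge0_integral_le2 => //.
    + by apply: measurable_norm; exact: borel_onB.
    + by apply: measurable_norm; exact: borel_onB.
    + move=> r _; rewrite mul1r -normrZ scalerBr mapE opprD addrACA.
      exact: ler_normD.
  apply: (le_trans hh); rewrite mul1e.
  apply: (@le_trans _ _ ((delta / 2)%:E + `|k|%:E * (delta / (2 * (1 + `|k|)))%:E)%E).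
    by apply: leeD => //; apply: lee_wpmul2l => //; rewrite lee_fin.
  by rewrite -EFinM -EFinD lee_fin.
- rewrite intE opprD addrACA -scalerBr.
  apply: le_trans (ler_normD _ _) _; rewrite normrZ; apply: le_trans small.
  by apply: lerD => //; apply: ler_wpM2l.
Qed.

Lemma is_bochner_integral_approx f v : is_bochner_integral t s f v ->
  bochner_approx f v.
Proof.
move=> [bf [n [A [h [mA c1 c2]]]]]; split => // delta delta0.
have [N _ NP] : \forall k \near \oo, (\int[mu]_(r in `[t, s])
         `|f r - \sum_(i < n k) \1_(A k i) r *: h k i|%:E <= delta%:E)%E /\
   `|v - \sum_(i < n k) fine (mu (`[t, s] `&` A k i)) *: h k i| <= delta.
  near=> k; split; near: k; first exact: ereal_cvg0_near.
  by move: c2 => /cvgrPdist_le; apply.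
have [N1 N2] := NP N (leqnn N).
exists (n N), (A N), (h N); split => //; first exact: mA.
by rewrite distrC.
Unshelve. all: by end_near. Qed.

End bochner_bound.

(** * Uniqueness of mild solutions *)

Section gronwall.
Context {R : realType}.
Local Notation mu := (@lebesgue_measure R).
Local Notation RT := (measurableTypeR R).
Variables (t T K : R) (phi : R -> \bar R).
Hypothesis phi0 : forall s, t <= s <= T -> (0 <= phi s)%E.
Hypothesis mphi : measurable_fun (`[t, T]%classic : set RT) phi.
Hypothesis iphi : (\int[mu]_(r in `[t, T]) phi r < +oo)%E.
Hypothesis K0 : 0 <= K.
Hypothesis phi_le : forall s, t <= s <= T ->
  (phi s <= K%:E * \int[mu]_(r in `[t, s]) phi r)%E.

Let Phi s : \bar R := (\int[mu]_(r in `[t, s]) phi r)%E.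

Let mitv (i : interval R) : measurable ([set` i] : set RT).
Proof. exact: measurable_itv. Qed.

Let mphiS s : s <= T -> measurable_fun (`[t, s]%classic : set RT) phi.
Proof.
move=> sT; apply: (measurable_funS (mitv _) _ mphi).
by move=> x /=; rewrite !in_itv/= => /andP[-> xs]; exact: le_trans sT.
Qed.

Let Phi0 s : s <= T -> (0 <= Phi s)%E.
Proof.
move=> sT; apply: integral_ge0 => r /=; rewrite in_itv/= => /andP[tr rs].
by apply: phi0; rewrite tr (le_trans rs).
Qed.

Let Phi_mono r s : r <= s -> s <= T -> (Phi r <= Phi s)%E.
Proof.
move=> rs sT; apply: ge0_subset_integral; [exact: mitv|exact: mitv| | |].
- exact: mphiS.
- move=> x /=; rewrite in_itv/= => /andP[tx xs].
  by apply: phi0; rewrite tx (le_trans xs).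
- by move=> x /=; rewrite !in_itv/= => /andP[-> xr]; rewrite (le_trans xr).
Qed.

Let Phi_fin s : s <= T -> Phi s \is a fin_num.
Proof.
move=> sT; rewrite ge0_fin_numE ?Phi0//.
by apply: le_lt_trans iphi; exact: Phi_mono.
Qed.

(** On a short interval the hypothesis yields [Phi s <= Phi s / 2], so a zero of the finite function
    [Phi] propagates; no exponential is involved. *)
Let Phi_step r s : t <= r -> r <= s -> s <= T -> (s - r) * K <= 2^-1 ->
  Phi r = 0%E -> Phi s = 0%E.
Proof.
move=> tr rs sT small Pr0.
have sub : `[t, s]%classic = `[t, r]%classic `|` `]r, s]%classic :> set R.
  apply/seteqP; split => x /=; rewrite !in_itv/=.
    by move=> /andP[tx xs]; case: (leP x r) => xr; [left|right]; rewrite ?tx ?xs.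
  move=> [/andP[-> xr]|/andP[rx ->]]; first by rewrite (le_trans xr).
  by rewrite (le_trans tr (ltW rx)).
have h : (Phi s <= 0 + \int[mu]_(x in `]r, s]) (cst (K%:E * Phi s)) x)%E.
  rewrite {1}/Phi sub ge0_integral_setU//.
  - rewrite -/(Phi r) Pr0; apply: leeD => //.
    apply: ge0_le_integral_nonmeasurable => x /=; rewrite in_itv/= => /andP[rx xs].
      by apply: phi0; rewrite (le_trans tr (ltW rx)) (le_trans xs).
    have txT : t <= x <= T by rewrite (le_trans tr (ltW rx)) (le_trans xs).
    apply: (le_trans (phi_le txT)); apply: lee_wpmul2l; first by rewrite lee_fin.
    exact: Phi_mono.
  - by rewrite -sub; exact: mphiS.
  - rewrite -sub => x /=; rewrite in_itv/= => /andP[tx xs].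
    by apply: phi0; rewrite tx (le_trans xs).
  - rewrite disj_set2E; apply/eqP; rewrite -subset0 => x /=.
    by rewrite !in_itv/= => -[/andP[_ xr] /andP[rx _]]; rewrite ltNge xr in rx.
move: h; rewrite add0e integral_cst//.
have := lebesgue_measure_itv `]r, s]; rewrite /= lte_fin => ->.
have -> : (if (r < s)%R then s%:E - r%:E else 0)%E = (s - r)%:E.
  move: rs; rewrite le_eqVlt => /predU1P[->|->]; last by rewrite EFinB.
  by rewrite ltxx subrr.
have z0 : 0 <= fine (Phi s) by apply: fine_ge0; exact: Phi0.
rewrite -(fineK (Phi_fin sT)); move: (fine _) z0 => z z0.
rewrite -!EFinM lee_fin => h; congr EFin; apply/eqP; rewrite eq_le z0 andbT.
by nra.
Qed.

Lemma gronwall_eq0 s : t <= s <= T -> phi s = 0%E.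
Proof.
move=> tsT; suff P0 : Phi s = 0%E.
  by apply/eqP; rewrite eq_le phi0// andbT; have := phi_le tsT; rewrite -/(Phi s) P0 mule0.
(* A step length with [de * K <= 1 / 2]; the [+ 1] covers [K = 0]. *)
pose de := (2 * (K + 1))^-1.
have K1 : 0 < 2 * (K + 1) by rewrite mulr_gt0// ltr_wpDl.
have de0 : 0 < de by rewrite invr_gt0.
have deK : de * K <= 2^-1.
  have : de * (2 * (K + 1)) = 1 by rewrite mulVf// gt_eqF.
  by nra.
(* Induction on the number of steps of length [de] after [t]; with no step the integral is over a
   single point. *)
suff H n : forall s, t <= s <= T -> s <= t + n%:R * de -> Phi s = 0%E.
  have [n hn] : exists n : nat, (s - t) / de <= n%:R.
    exists (Num.truncn ((s - t) / de)).+1; rewrite ltW//.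
    by apply: truncnS_gt.
  apply: (H n s tsT); move: hn; rewrite ler_pdivrMr//; lra.
elim: n => [|n IH] {tsT}s /andP[ts sT] sn.
  have -> : s = t by apply/eqP; rewrite eq_le ts andbT; move: sn; rewrite mul0r addr0.
  by rewrite /Phi set_itv1 integral_set1.
pose r := Num.max t (s - de).
have tr : t <= r by rewrite le_max lexx.
have rs : r <= s by rewrite ge_max ts gerBl ltW.
apply: (@Phi_step r) => //.
  apply: le_trans deK; apply: ler_wpM2r => //.
  by rewrite lerBlDl -lerBlDr le_max lexx orbT.
apply: IH; first by rewrite tr (le_trans rs).
rewrite ge_max lerDl mulr_ge0 ?(ltW de0)//=.
by move: sn; rewrite -natr1 mulrDl mul1r; lra.
Qed.

End gronwall.

(** * Lipschitz bounds for continuous affine maps *)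

Section affine_maps.
Context {R : realType}.

Lemma affine_homogeneous (E F : lmodType R) (f : E -> F) k u : affine f ->
  f (k *: u) - f 0 = k *: (f u - f 0).
Proof.
move=> af; have := af k u 0; rewrite scaler0 addr0 => ->.
rewrite scalerBr scalerBl scale1r -addrA; congr (_ + _).
by rewrite addrAC subrr add0r.
Qed.

(** [u] is the midpoint of [2 *: (u - v)] and [2 *: v], and homogeneity of [f - f 0] removes the
    factors [2]. *)
Lemma affineB (E F : lmodType R) (f : E -> F) u v : affine f ->
  f u - f v = f (u - v) - f 0.
Proof.
move=> af; have h2 : (1 - 2^-1 : R) = 2^-1 by lra.
have := af 2^-1 (2 *: (u - v)) (2 *: v).
rewrite h2 !scalerA mulVf// !scale1r subrK => ->.
have e1 : f (2 *: (u - v)) = 2 *: (f (u - v) - f 0) + f 0.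
  by rewrite -(affine_homogeneous _ _ af) subrK.
have e2 : f (2 *: v) = 2 *: (f v - f 0) + f 0.
  by rewrite -(affine_homogeneous _ _ af) subrK.
rewrite e1 e2 -[X in _ - X](subrK (f 0)).
move: (f (u - v) - f 0) (f v - f 0) => A B.
rewrite !scalerDr !(scalerA 2^-1) mulVf// !scale1r addrACA -scalerDl.
have -> : 2^-1 + 2^-1 = 1 :> R by lra.
by rewrite scale1r -addrA addrK.
Qed.

(** A vector is rescaled to norm [delta]. Stated for functions homogeneous of degree two, to cover
    squared norms and square sums over finite families alike. *)
Lemma quadratic_bounded (E : normedModType R) (q : E -> R) (delta : R) :
  0 < delta -> (forall k v, q (k *: v) = k ^+ 2 * q v) ->
  (forall v, `|v| <= delta -> q v <= 1) ->
  forall v, q v <= delta ^- 2 * `|v| ^+ 2.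
Proof.
move=> d0 hom bd v.
have [->|v0] := eqVneq v 0.
  by have := hom 0 0; rewrite scaler0 expr0n/= mul0r normr0 expr0n mulr0 => ->.
have vp : 0 < `|v| by rewrite normr_gt0.
have := bd ((delta / `|v|) *: v).
rewrite normrZ normrM normfV !normr_id (gtr0_norm d0) divfK ?gt_eqF// => /(_ (lexx _)).
rewrite hom exprMn exprVn => h.
have ab : 0 < delta ^+ 2 * (`|v| ^+ 2)^-1 by rewrite divr_gt0 ?exprn_gt0.
rewrite -(ler_pM2l ab); apply: (le_trans h).
by rewrite mulrACA mulfV ?mulVf ?mulr1// gt_eqF ?exprn_gt0.
Qed.

Lemma affine_continuous_lipschitz (E F : normedModType R) (f : E -> F) :
  affine f -> continuous f ->
  exists2 C, 0 <= C & forall u v, `|f u - f v| <= C * `|u - v|.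
Proof.
move=> af cf.
have /cvgrPdist_le/(_ _ ltr01)/nbhs_ballP[e /= e0 he] := cf 0.
have e2 : 0 < e / 2 by rewrite divr_gt0.
have bd v : `|v| <= e / 2 -> `|f v - f 0| ^+ 2 <= 1.
  move=> ve; rewrite expr_le1// distrC; apply: he.
  by rewrite -ball_normE/= sub0r normrN; lra.
have hom k v : `|f (k *: v) - f 0| ^+ 2 = k ^+ 2 * `|f v - f 0| ^+ 2.
  by rewrite affine_homogeneous// normrZ exprMn real_normK ?num_real.
exists (e / 2)^-1; first by rewrite invr_ge0 ltW.
move=> u v; rewrite affineB//.
have := quadratic_bounded e2 hom bd (u - v).
by rewrite -exprVn -exprMn ler_sqr ?nnegrE ?mulr_ge0 ?invr_ge0 ?(ltW e2).
Qed.

End affine_maps.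

Section hs_lipschitz.
Context {R : realType} {Xi H : hilbertType R} {E : normedModType R}.

(** The constant is common to all families: the ball comes from the continuity of the full
    Hilbert-Schmidt norm at [0], before [F] is given. *)
Lemma hs_affine_lipschitz (f : E -> Xi -> H) :
  (forall xi, affine (fun u => f u xi)) -> hs_continuous f ->
  exists2 C, 0 <= C & forall F, onbseq F -> forall u v,
    \sum_(xi <- F) `|f u xi - f v xi| ^+ 2 <= C * `|u - v| ^+ 2.
Proof.
move=> af cf.
have : \forall v \near (0 : E), (hs_norm2 (fun xi => (f v xi - f 0 xi)%R) <= 1)%E.
  apply: (cf 0 [set x | (x <= 1)%E]).
  by apply: filterS (lt_nbhsl (@ltr01 R)) => x /ltW h; rewrite /= lee_fin.
move=> /nbhs_ballP[e /= e0 he].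
have e2 : 0 < e / 2 by rewrite divr_gt0.
exists ((e / 2) ^- 2); first by rewrite invr_ge0 sqr_ge0.
move=> F Fo u v.
under eq_bigr do rewrite (affineB _ _ (af _)).
apply: (quadratic_bounded e2 (q := fun v => \sum_(xi <- F) `|f v xi - f 0 xi| ^+ 2)).
  move=> k w; rewrite mulr_sumr; apply: eq_bigr => xi _.
  by rewrite (affine_homogeneous _ _ (af xi)) normrZ exprMn real_normK ?num_real.
move=> w we; rewrite -lee_fin; apply: le_trans (hs_norm2_ge _ Fo) _.
by apply: he; rewrite -ball_normE/= sub0r normrN; lra.
Qed.

End hs_lipschitz.

Section cauchy_schwarz_itv.
Context {R : realType}.
Local Notation mu := (@lebesgue_measure R).
Local Notation RT := (measurableTypeR R).

Lemma integral_itv_cst (t s c : R) : t <= s ->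
  (\int[mu]_(r in `[t, s]) c%:E = (c * (s - t))%:E)%E.
Proof.
move=> ts; rewrite (integral_cst mu (measurable_itv `[t, s])).
have := lebesgue_measure_itv `[t, s]; rewrite /= lte_fin => ->.
move: ts; rewrite le_eqVlt => /predU1P[->|->].
  by rewrite ltxx subrr mulr0 mule0.
by rewrite -EFinB -EFinM.
Qed.

(* Adding [1] to the constant avoids the product [0 * +oo]. *)
Lemma sqr_integral_itv_le (t s C z : R) (y : R -> R) : t <= s -> 0 <= C ->
  measurable_fun (`[t, s]%classic : set RT) y -> (forall r, 0 <= y r) ->
  0 <= z -> (z%:E <= \int[mu]_(r in `[t, s]) (C * y r)%:E)%E ->
  ((z ^+ 2)%:E <= (C ^+ 2 * (s - t) + 1)%:E * \int[mu]_(r in `[t, s]) (y r ^+ 2)%:E)%E.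
Proof.
move=> ts C0 my y0 z0 hz.
have mts : measurable (`[t, s]%classic : set RT) by exact: measurable_itv.
set q := (\int[mu]_(r in `[t, s]) (y r ^+ 2)%:E)%E.
have q0 : (0 <= q)%E by apply: integral_ge0 => r _; rewrite lee_fin sqr_ge0.
have c0 : 0 < C ^+ 2 * (s - t) + 1.
  by rewrite ltr_wpDl// mulr_ge0 ?sqr_ge0// subr_ge0.
(* Young's inequality with a free parameter, integrated in time; the choice [eps = z / c] below
   turns it into Cauchy-Schwarz. *)
have amgm (eps : R) : 0 < eps ->
    (z%:E <= (C ^+ 2 * eps / 2 * (s - t))%:E + ((2 * eps)^-1)%:E * q)%E.
  move=> eps0; apply: (le_trans hz).
  rewrite -integral_itv_cst// -[X in (_ <= X + _)%E]mul1e.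
  apply: (ge0_integral_le2 mu (w := fun r => y r ^+ 2)) => //.
  - by rewrite invr_ge0 mulr_ge0// ltW.
  - exact: measurable_funX.
  - by move=> r _; rewrite mulr_ge0.
  - by move=> r _; rewrite divr_ge0 ?mulr_ge0 ?sqr_ge0// ltW.
  - by move=> r _; rewrite sqr_ge0.
  - move=> r _; have : 0 <= (C * eps - y r) ^+ 2 / (2 * eps).
      by rewrite divr_ge0 ?sqr_ge0// mulr_ge0// ltW.
    suff -> : (C * eps - y r) ^+ 2 / (2 * eps) =
      1 * (C ^+ 2 * eps / 2) + (2 * eps)^-1 * y r ^+ 2 - C * y r by rewrite subr_ge0.
    by field; rewrite gt_eqF.
have [->|zn0] := eqVneq z 0; first by rewrite expr0n/= mule_ge0// lee_fin ltW.
have zp : 0 < z by rewrite lt_neqAle eq_sym zn0.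
move: q0 amgm; case: q => [q| |]// q0 amgm; last first.
  by rewrite gt0_muley ?leey// lte_fin.
rewrite lee_fin in q0.
set c := C ^+ 2 * (s - t) + 1 in c0 *.
have e0 : 0 < z / c by rewrite divr_gt0.
have := amgm _ e0; rewrite -EFinM -EFinD !lee_fin => h.
have h1 : C ^+ 2 * (z / c) / 2 * (s - t) <= z / 2.
  have -> : C ^+ 2 * (z / c) / 2 * (s - t) = (c - 1) / c * (z / 2).
    by rewrite /c; field; rewrite gt_eqF.
  rewrite ler_piMl//; first by rewrite divr_ge0.
  by rewrite ler_pdivrMr// mul1r; lra.
have h2 : (2 * (z / c))^-1 * q = (c * q) / (2 * z).
  by field; rewrite !gt_eqF.
have h3 : z / 2 <= (c * q) / (2 * z) by rewrite -h2; lra.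
move: h3; rewrite ler_pdivlMr ?mulr_gt0//.
by rewrite [z / 2 * (2 * z)](_ : _ = z ^+ 2)//; field.
Qed.

End cauchy_schwarz_itv.

(** * The defect of a superposition *)

Section superposition.
Context {R : realType} {d : measure_display} {Omega : measurableType d}
  (P : probability Omega R) {H Xi : hilbertType R}
  {Lam : completeNormedModType R}.
Hypothesis sepH : separable H.
Variables (W : R -> Xi -> Omega -> R) (t T : R).
Hypotheses (tT : t <= T) (refW : reference_space P W t T).
Variable S : R -> H -> H.
Hypothesis semiS : c0_contraction_semigroup S.
Variables (b : H * Lam -> H) (sigma : H * Lam -> Xi -> H).
Hypotheses (affine_b : affine b) (affine_sigma : forall xi, affine (fun u => sigma u xi)).
Variables (Cb Cs : R).
Hypotheses (Cb0 : 0 <= Cb) (Cs0 : 0 <= Cs).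
Hypothesis lip_b : forall u v, `|b u - b v| <= Cb * `|u - v|.
Hypothesis lip_sigma : forall F, @onbseq R Xi F -> forall u v,
  \sum_(xi <- F) `|sigma u xi - sigma v xi| ^+ 2 <= Cs * `|u - v| ^+ 2.
Local Notation mu := (@lebesgue_measure R).
Local Notation RT := (measurableTypeR R).
Local Notation M := (@gaussian_variance R).
Implicit Types (x : H) (a : R -> Omega -> Lam) (X : R -> Omega -> H).
Local Notation mild := (mild_solution P W t T S b sigma).

Variables (k : R) (x1 x2 : H) (a1 a2 a : R -> Omega -> Lam)
  (X1 X2 X : R -> Omega -> H).
Hypothesis aE : forall s w, t <= s <= T ->
  a s w = k *: a1 s w + (1 - k) *: a2 s w.
Hypotheses (mX1 : mild x1 a1 X1) (mX2 : mild x2 a2 X2)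
  (mX : mild (k *: x1 + (1 - k) *: x2) a X).

(** Differences are written as sums with negative scalars, the shape that [ito_approx_lin] and
    [bochner_approx_lin] produce when applied twice. *)
Definition defect s w : H := X s w + (- k) *: X1 s w + (- (1 - k)) *: X2 s w.
Local Notation Y := defect.

Let linear3 (L : H -> H) u u1 u2 : linear L ->
  L u + (- k) *: L u1 + (- (1 - k)) *: L u2 =
  L (u + (- k) *: u1 + (- (1 - k)) *: u2).
Proof.
move=> lL; rewrite [in RHS]addrC lL [X in _ = _ + X](_ : _ = L u + (- k) *: L u1).
  by rewrite addrC.
by rewrite addrC lL addrC.
Qed.

Let linearP3 (L : H -> H) u1 u2 : linear L ->
  L (k *: u1 + (1 - k) *: u2) = k *: L u1 + (1 - k) *: L u2.
Proof.
move=> lL; have L0 : L 0 = 0.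
  by apply: (addrI (1 *: L 0)); rewrite -lL scaler0 !addr0 scale1r.
by rewrite lL -[(1 - k) *: u2]addr0 lL L0 addr0.
Qed.

(** Since [a] is exactly the combination of the two controls, the coefficients collapse to a
    difference at two states under the same control. *)
Let affine3 (E : lmodType R) (f : H * Lam -> E) s w : affine f -> t <= s <= T ->
  f (X s w, a s w) + (- k) *: f (X1 s w, a1 s w) + (- (1 - k)) *: f (X2 s w, a2 s w) =
  f (X s w, a s w) - f (k *: X1 s w + (1 - k) *: X2 s w, a s w).
Proof.
move=> af ts; rewrite (aE _ ts).
have := af k (X1 s w, a1 s w) (X2 s w, a2 s w).
rewrite [k *: _ + _](_ : _ = (k *: X1 s w + (1 - k) *: X2 s w,
   k *: a1 s w + (1 - k) *: a2 s w))// => ->.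
by rewrite [in RHS]opprD addrA !scaleNr.
Qed.

(** The product carries the maximum norm and the controls agree, so Lipschitz bounds in the pair
    become bounds in [Y] alone. *)
Let norm_pairB s w :
  `|(X s w, a s w) - (k *: X1 s w + (1 - k) *: X2 s w, a s w)| = `|Y s w|.
Proof.
have -> : (X s w, a s w) - (k *: X1 s w + (1 - k) *: X2 s w, a s w) = (Y s w, 0).
  by congr pair; rewrite /= ?subrr// /Y [in LHS]opprD addrA !scaleNr.
by rewrite prod_normE/= normr0; apply/max_idPl.
Qed.

Let mts s : measurable (`[t, s]%classic : set RT).
Proof. exact: measurable_itv. Qed.

Let mtsO s : measurable (`[t, s]%classic `*` setT : set (RT * Omega)%type).
Proof. exact: measurableX. Qed.

Let sm := @sigma_algebra_measurable _ (RT * Omega)%type.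

Let bY s : t <= s <= T -> borel_on (measurable : set (set (RT * Omega)%type))
  (`[t, s]%classic `*` setT) (fun z => Y z.1 z.2).
Proof.
move=> /andP[ts sT].
have h Z : progressive P W t T Z -> borel_on (measurable : set (set (RT * Omega)%type))
    (`[t, s]%classic `*` setT) (fun z => Z z.1 z.2).
  by move=> pZ; exact: (progressive_borel_on refW ts sT (lexx T) pZ).
apply: borel_onD => //; last by apply: borel_onZl; apply: h; case: mX2.
apply: borel_onD => //; first by apply: h; case: mX.
by apply: borel_onZl; apply: h; case: mX1.
Qed.

Let mY2 s : t <= s <= T -> measurable_fun (`[t, s]%classic `*` setT : set (RT * Omega)%type)
  (fun z => `|Y z.1 z.2| ^+ 2).
Proof. by move=> tsT; apply: borel_on_sqnorm => //; exact: bY. Qed.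

Let mY2E s : t <= s <= T -> measurable_fun (`[t, s]%classic `*` setT : set (RT * Omega)%type)
  (fun z => (`|Y z.1 z.2| ^+ 2)%:E).
Proof. by move=> tsT; apply/measurable_EFinP; exact: mY2. Qed.

Let sqY0 r w : (0 <= (`|Y r w| ^+ 2)%:E)%E.
Proof. by rewrite lee_fin exprn_ge0. Qed.

Let II s : \bar R := (\int[P]_w \int[mu]_(r in `[t, s]) (`|Y r w|%R ^+ 2)%:E)%E.

Let bmT (Z : R -> Omega -> H) := borel_on (measurable : set (set (RT * Omega)%type))
    (`[t, T]%classic `*` setT) (fun z => Z z.1 z.2).

Let sqnorm_lin_lty (Z1 Z2 : R -> Omega -> H) (c : R) : bmT Z1 -> bmT Z2 ->
  (\int[P]_w \int[mu]_(r in `[t, T]) (`|Z1 r w|%R ^+ 2)%:E < +oo)%E ->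
  (\int[P]_w \int[mu]_(r in `[t, T]) (`|Z2 r w|%R ^+ 2)%:E < +oo)%E ->
  (\int[P]_w \int[mu]_(r in `[t, T]) (`|Z1 r w + c *: Z2 r w|%R ^+ 2)%:E < +oo)%E.
Proof.
move=> b1 b2 l1 l2.
have c0 : 0 <= 2 * c ^+ 2 by rewrite mulr_ge0// sqr_ge0.
apply: (@le_lt_trans _ _
  (2%:E * \int[P]_w \int[mu]_(r in `[t, T]) (`|Z1 r w|%R ^+ 2)%:E +
   (2 * c ^+ 2)%:E * \int[P]_w \int[mu]_(r in `[t, T]) (`|Z2 r w|%R ^+ 2)%:E)%E).
  apply: (iterated_integral_le2 P (u := fun r w => `|Z1 r w + c *: Z2 r w| ^+ 2)
    (v := fun r w => `|Z1 r w| ^+ 2) (w := fun r w => `|Z2 r w| ^+ 2)) => //.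
  - exact: borel_on_sqnorm.
  - exact: borel_on_sqnorm.
  - move=> r w _; apply: le_trans (sqnormD_le _ _) _.
    by rewrite normrZ exprMn real_normK ?num_real//; lra.
have fin (Z : R -> Omega -> H) :
    (0 <= \int[P]_w \int[mu]_(r in `[t, T]) (`|Z r w|%R ^+ 2)%:E)%E.
  by apply: integral_ge0 => w _; apply: integral_ge0 => r _; rewrite lee_fin exprn_ge0.
by apply: lte_add_pinfty; apply: lte_mul_pinfty; rewrite ?lee_fin.
Qed.

Let bmT_mild x c Z : mild x c Z -> bmT Z.
Proof.
by case=> pZ _ _ _; exact: (progressive_borel_on refW tT (lexx T) (lexx T) pZ).
Qed.

(** The finiteness that Gronwall's argument needs; it comes from the square integrability demanded
    of mild solutions. *)
Lemma sqnorm_defect_lty : (II T < +oo)%E.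
Proof.
have [bX bX1 bX2] := And3 (bmT_mild mX) (bmT_mild mX1) (bmT_mild mX2).
apply: (@sqnorm_lin_lty (fun r w => X r w + (- k) *: X1 r w) X2 (- (1 - k))) => //.
- by apply: borel_onD => //; exact: borel_onZl.
- by apply: sqnorm_lin_lty => //; [case: mX|case: mX1].
- by case: mX2.
Qed.

Let II0 s : (0 <= II s)%E.
Proof. by apply: integral_ge0 => w _; apply: integral_ge0 => r _. Qed.

Let II_fin s : t <= s <= T -> II s \is a fin_num.
Proof.
move=> /andP[ts sT]; rewrite ge0_fin_numE//; apply: le_lt_trans sqnorm_defect_lty.
apply: ge0_le_integral_nonmeasurable => w _; first by apply: integral_ge0 => r _.
apply: ge0_subset_integral => //.
- have TT : t <= T <= T by rewrite tT lexx.
  exact: (@measurable_fun_section _ _ _ _ (fun r w => (`|Y r w| ^+ 2)%:E) (mts T) (mY2E TT)).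
- by move=> r /=; rewrite !in_itv/= => /andP[-> rs]; rewrite (le_trans rs).
Qed.

Let semi_linear q : 0 <= q -> linear (S q).
Proof. by case: semiS => h _ _ _ _; exact: h. Qed.

Let semi_contr q x : 0 <= q -> `|S q x| <= `|x|.
Proof. by case: semiS => _ _ _ _ h; exact: h. Qed.

Let phi s : \bar R := (\int[P]_w (`|Y s w|%R ^+ 2)%:E)%E.

(** Splitting the defect into drift and noise costs a factor [2]; Cauchy-Schwarz in time gives
    [Cb ^+ 2 * (T - t) + 1] for the drift, and [ito_approx_le] gives [4 * M * Cs] for the noise. *)
Lemma sqnorm_defect_le s : t <= s <= T ->
  (phi s <= (2 * (Cb ^+ 2 * (T - t) + 1) + 8 * M * Cs)%:E * II s)%E.
Proof.
move=> tsT; have /andP[ts sT] := tsT.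
have [_ _ _ /(_ s tsT)[B [I [hB hI hX]]]] := mX.
have [_ _ _ /(_ s tsT)[B1 [I1 [hB1 hI1 hX1]]]] := mX1.
have [_ _ _ /(_ s tsT)[B2 [I2 [hB2 hI2 hX2]]]] := mX2.
have [ op0 m0 j0] := is_ito_integral_approx refW ts sT hI.
have [ op1' m1 j1] := is_ito_integral_approx refW ts sT hI1.
have [ op2' m2 j2] := is_ito_integral_approx refW ts sT hI2.
have sO := @sigma_algebra_measurable _ Omega.
have j01 := ito_approx_lin sepH refW sT (- k) op0 op1' m0 m1 j0 j1.
have o01 := operator_measurable_lin sepH (- k) op0 op1'.
have m01 : borel_on measurable setT (fun w => I w + (- k) *: I1 w).
  by apply: borel_onD => //; exact: borel_onZl.
have j012 := ito_approx_lin sepH refW sT (- (1 - k)) o01 op2' m01 m2 j01 j2.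
have o012 := operator_measurable_lin sepH (- (1 - k)) o01 op2'.
pose ID w := I w + (- k) *: I1 w + (- (1 - k)) *: I2 w.
have mID : borel_on measurable setT ID.
  by apply: borel_onD => //; exact: borel_onZl.
have IIs := fineK (II_fin tsT).
have hID : (\int[P]_w (`|ID w|%R ^+ 2)%:E <= (4 * M * (Cs * fine (II s)))%:E)%E.
  apply: (ito_approx_le sepH refW ts sT o012 mID j012) => F Fo.
  (* The vanishing second summand only completes the two-term form of [iterated_integral_le2]. *)
  apply: (@le_trans _ _ (Cs%:E * II s + 0%:E * II s)%E); last first.
    by rewrite mul0e adde0 EFinM IIs.
  apply: (iterated_integral_le2 P (v := fun r w => `|Y r w| ^+ 2)
    (w := fun r w => `|Y r w| ^+ 2)) => //; [exact: mY2|exact: mY2| |].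
    by move=> r w _; exact: sumsq_ge0.
  move=> r w /=; rewrite in_itv/= => /andP[tr rs].
  have trT : t <= r <= T by rewrite tr (le_trans rs).
  have sr0 : 0 <= s - r by rewrite subr_ge0.
  rewrite mul0r addr0 -norm_pairB; apply: le_trans (lip_sigma Fo _ _).
  apply: ler_sum => xi _; rewrite ler_sqr ?nnegrE//.
  rewrite linear3; last exact: semi_linear.
  rewrite (affine3 w (affine_sigma xi) trT).
  exact: semi_contr.
pose c := Cb ^+ 2 * (s - t) + 1.
have c0 : 0 <= c by rewrite addr_ge0// mulr_ge0 ?sqr_ge0 ?subr_ge0.
have key : {ae P, forall w, setT w -> ((`|Y s w|%R ^+ 2)%:E <=
    2%:E * (c%:E * \int[mu]_(r in `[t, s]) (`|Y r w|%R ^+ 2)%:E) +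
    (2 * `|ID w|%R ^+ 2)%:E)%E}.
  pose BD w := B w + (- k) *: B1 w + (- (1 - k)) *: B2 w.
  have hBs : {ae P, forall w, bochner_approx t s (fun r =>
      S (s - r) (b (X r w, a r w)) + (- k) *: S (s - r) (b (X1 r w, a1 r w)) +
      (- (1 - k)) *: S (s - r) (b (X2 r w, a2 r w))) (BD w)}.
    apply: filterS3 hB hB1 hB2 => w b0 b1 b2.
    apply: bochner_approx_lin (is_bochner_integral_approx b2) => //.
    apply: bochner_approx_lin (is_bochner_integral_approx b1) => //.
    exact: is_bochner_integral_approx.
  have hXs : {ae P, forall w, Y s w = BD w + ID w}.
    apply: filterS3 hX hX1 hX2 => w e0 e1 e2.
    have s0 : 0 <= s - t by rewrite subr_ge0.
    rewrite /Y e0 e1 e2 (linearP3 _ _ (semi_linear s0)) /BD /ID.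
    rewrite !scalerDr !scaleNr.
    move: (k *: _) (k *: _) (k *: _) ((1 - k) *: _) ((1 - k) *: _) ((1 - k) *: _).
    move=> u1 u2 u3 v1 v2 v3; rewrite !addrA.
    (* Of the ten summands the four with the initial data cancel in pairs; the rest is regrouped
       into three drift and three noise terms. *)
    by rewrite [LHS](ACl (1*5*(2*8)*(3*6*9)*(4*7*10)))/= !subrr !add0r !addrA.
  apply: filterS2 hBs hXs => w b012 YE _.
  have hBD := bochner_approx_le sepH b012.
  have hy : (`|BD w|%:E <= \int[mu]_(r in `[t, s]) (Cb * `|Y r w|)%:E)%E.
    apply: (le_trans hBD); apply: ge0_le_integral_nonmeasurable => r; first by [].
    rewrite /= in_itv/= => /andP[tr rs].
    have trT : t <= r <= T by rewrite tr (le_trans rs).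
    have sr0 : 0 <= s - r by rewrite subr_ge0.
    rewrite lee_fin linear3; last exact: semi_linear.
    rewrite (affine3 w affine_b trT) -norm_pairB.
    by apply: le_trans (semi_contr _ sr0) _; exact: lip_b.
  have mYw : measurable_fun (`[t, s]%classic : set RT) (fun r => `|Y r w|).
    have mYn : measurable_fun (`[t, s]%classic `*` setT : set (RT * Omega)%type)
        (fun z => `|Y z.1 z.2|%:E).
      apply/measurable_EFinP; apply/borel_on_measurable_fun => //.
      by apply: borel_on_norm; exact: bY.
    apply/measurable_EFinP.
    exact: (@measurable_fun_section _ _ _ _ (fun r w => `|Y r w|%:E) (mts s) mYn w).
  have := sqr_integral_itv_le ts Cb0 mYw (fun r => normr_ge0 _) (normr_ge0 _) hy.
  rewrite -/c => hc.
  apply: (@le_trans _ _ ((2 * `|BD w| ^+ 2)%:E + (2 * `|ID w| ^+ 2)%:E)%E).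
    by rewrite -EFinD lee_fin YE sqnormD_le.
  by apply: leeD => //; rewrite EFinM; apply: lee_wpmul2l.
have mIn : measurable_fun setT (fun w => \int[mu]_(r in `[t, s]) (`|Y r w|%R ^+ 2)%:E)%E.
  exact: (measurable_fun_integral1 (mts s) (mY2E tsT) (fun r w _ => sqY0 r w)).
have In0 w : (0 <= \int[mu]_(r in `[t, s]) (`|Y r w|%R ^+ 2)%:E)%E.
  by apply: integral_ge0 => r _; exact: sqY0.
have mID2 : measurable_fun setT (fun w => (`|ID w|%R ^+ 2)%:E).
  by apply/measurable_EFinP; exact: borel_on_sqnorm.
have mID2' : measurable_fun setT (fun w => (2 * `|ID w|%R ^+ 2)%:E).
  by under eq_fun do rewrite EFinM; exact: measurable_funeM.
apply: (@le_trans _ _ (\int[P]_w (2%:E * (c%:E * \int[mu]_(r in `[t, s]) (`|Y r w|%R ^+ 2)%:E) +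
    (2 * `|ID w|%R ^+ 2)%:E))%E).
  apply: ae_ge0_le_integral => //.
  - have ss : `[t, s]%classic s by rewrite /= in_itv/= ts lexx.
    exact: (@measurable_fun_section2 _ _ _ _ (fun r w => (`|Y r w| ^+ 2)%:E) (mts s) (mY2E tsT) s ss).
  - move=> w _; rewrite adde_ge0 ?mule_ge0// lee_fin mulr_ge0// exprn_ge0.
  - by apply: emeasurable_funD => //; do 2! apply: measurable_funeM.
rewrite ge0_integralD//; [|by move=> w _; rewrite !mule_ge0|by do 2! apply: measurable_funeM].
under [X in (_ + X)%E]eq_integral do rewrite EFinM.
rewrite !ge0_integralZl//; try by [move=> w _; rewrite mule_ge0|exact: measurable_funeM].
rewrite -/(II s).
apply: (@le_trans _ _ (2%:E * (c%:E * II s) + 2%:E * (4 * M * (Cs * fine (II s)))%:E)%E).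
  by apply: leeD => //; apply: lee_wpmul2l.
rewrite -IIs -!EFinM -EFinD lee_fin.
have z0 : 0 <= fine (II s) by apply: fine_ge0.
have h : 0 <= Cb ^+ 2 * (T - s) * fine (II s).
  by rewrite !mulr_ge0 ?sqr_ge0 ?subr_ge0.
by move: h z0; set z := fine (II s); rewrite /c /=; lra.
Qed.

Let Y2 r w : \bar R := (`|Y r w| ^+ 2)%:E.

(** Tonelli identifies [II r] with the time integral of [phi], the form in which Gronwall's lemma
    applies. *)
Lemma sqnorm_defect_eq0 s : t <= s <= T -> phi s = 0%E.
Proof.
have TT : t <= T <= T by rewrite tT lexx.
have swap r : t <= r <= T -> II r = (\int[mu]_(u in `[t, r]) phi u)%E.
  move=> trT; exact: (@iterated_integral_swap _ _ _ P _ Y2 (mts r) (mY2E trT) (fun r w _ => sqY0 r w)).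
apply: (@gronwall_eq0 _ _ _ (2 * (Cb ^+ 2 * (T - t) + 1) + 8 * M * Cs)).
- by move=> r _; apply: integral_ge0 => w _; exact: sqY0.
- exact: (@measurable_fun_integral2 _ _ _ P _ Y2 (mts T) (mY2E TT) (fun r w _ => sqY0 r w)).
- by rewrite -swap//; exact: sqnorm_defect_lty.
- have := @gaussian_variance_ge0 R => M0.
  by rewrite addr_ge0 ?mulr_ge0// addr_ge0// mulr_ge0 ?sqr_ge0 ?subr_ge0.
- by move=> r trT; rewrite -swap//; exact: sqnorm_defect_le.
Qed.

Lemma defect_ae0 : {ae P, forall w, Y T w = 0}.
Proof.
have TT : t <= T <= T by rewrite tT lexx.
have TTi : `[t, T]%classic T by rewrite /= in_itv.
have mYT : measurable_fun setT (fun w => (`|Y T w| ^+ 2)%:E).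
  exact: (@measurable_fun_section2 _ _ _ _ Y2 (mts T) (mY2E TT) T TTi).
have := ae_eq_integral_abs P measurableT mYT.
under eq_integral do rewrite gee0_abs ?sqY0//.
move=> [/(_ (sqnorm_defect_eq0 TT)) h _].
apply: filterS h => w /(_ I) /= [].
by move=> /eqP; rewrite sqrf_eq0 normr_eq0 => /eqP.
Qed.

Lemma integral_norm_defect_eq0 :
  (\int[mu \x P]_(z in `[t, T]%classic `*` setT) `|Y z.1 z.2|%:E = 0)%E.
Proof.
have TT : t <= T <= T by rewrite tT lexx.
have II_T0 : II T = 0%E.
  rewrite /II (@iterated_integral_swap _ _ _ P _ Y2 (mts T) (mY2E TT) (fun r w _ => sqY0 r w)).
  apply: integral0_eq => r /=; rewrite in_itv/= => /andP[tr rT].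
  by apply: sqnorm_defect_eq0; rewrite tr.
have mYT : measurable_fun (`[t, T]%classic `*` setT : set (RT * Omega)%type)
    (fun z => `|Y z.1 z.2|%:E).
  apply/measurable_EFinP; apply/borel_on_measurable_fun => //.
  by apply: borel_on_norm; exact: bY.
have := ae_eq_integral_abs (mu \x P)%E (mtsO T) (mY2E TT).
under eq_integral do rewrite gee0_abs ?sqY0//.
rewrite -(@iterated_integral_prod _ _ _ P _ Y2 (mts T) (mY2E TT) (fun r w _ => sqY0 r w)).
move=> [/(_ II_T0) h _].
rewrite (ae_eq_integral (cst 0%E))//; first by rewrite integral0.
apply: filterS h => z /= h Dz; have := h Dz => -[/eqP].
by rewrite sqrf_eq0 => /eqP ->.
Qed.

End superposition.

(** * Convexity of the cost and of the value function *)

Section cost_of_mild_solution.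
Context {R : realType} {d : measure_display} {Omega : measurableType d}
  (P : probability Omega R) {H Xi : hilbertType R}
  {Lam : completeNormedModType R}.
Hypotheses (sepH : separable H) (sepLam : separable Lam).
Variables (W : R -> Xi -> Omega -> R) (t T p : R).
Hypotheses (tT : t <= T) (hp : 2 < p) (refW : reference_space P W t T).
Variable S : R -> H -> H.
Hypothesis semiS : c0_contraction_semigroup S.
Variables (b : H * Lam -> H) (sigma : H * Lam -> Xi -> H) (Cb : R).
Hypothesis Cb0 : 0 <= Cb.
Hypothesis lip_b : forall u v, `|b u - b v| <= Cb * `|u - v|.
Variables (Lam0 : set Lam) (l : H * Lam -> R) (g : H -> R) (C : R).
Hypothesis cont_l : {within setT `*` Lam0, continuous l}.
Hypothesis C0 : 0 < C.
Hypothesis growth_l :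
  forall x a, Lam0 a -> `|l (x, a)| <= C * (1 + `|x| + `|a| ^+ 2).
Hypothesis lip_g : forall x x', `|g x - g x'| <= C * `|x - x'|.
Local Notation mu := (@lebesgue_measure R).
Local Notation RT := (measurableTypeR R).
Local Notation adm := (admissible P W t T Lam0 p).
Local Notation mild := (mild_solution P W t T S b sigma).

Variables (x : H) (a : R -> Omega -> Lam) (X : R -> Omega -> H).
Hypotheses (aP : adm a) (mX : mild x a X).

Let D : set (RT * Omega)%type := `[t, T]%classic `*` setT.

Let mts : measurable (`[t, T]%classic : set RT).
Proof. exact: measurable_itv. Qed.

Let mD : measurable D. Proof. exact: measurableX. Qed.

Let sm := @sigma_algebra_measurable _ (RT * Omega)%type.

Let m := (mu \x P)%E.

Let bX : borel_on (measurable : set (set (RT * Omega)%type)) D (fun z => X z.1 z.2).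
Proof.
by case: mX => pX _ _ _; exact: (progressive_borel_on refW tT (lexx T) (lexx T) pX).
Qed.

Let ba : borel_on (measurable : set (set (RT * Omega)%type)) D (fun z => a z.1 z.2).
Proof.
by case: aP => pa _ _; exact: (progressive_borel_on refW tT (lexx T) (lexx T) pa).
Qed.

Let aLam0 z : D z -> Lam0 (a z.1 z.2).
Proof.
by case: aP => _ h _ [/= zt _]; apply: h; move: zt; rewrite /= in_itv.
Qed.

Let mnX : measurable_fun D (fun z => `|X z.1 z.2|).
Proof. by apply/borel_on_measurable_fun => //; exact: borel_on_norm. Qed.

Let mna : measurable_fun D (fun z => `|a z.1 z.2|).
Proof. by apply/borel_on_measurable_fun => //; exact: borel_on_norm. Qed.

Let mnap : measurable_fun D (fun z => `|a z.1 z.2| `^ p).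
Proof. exact: (@measurableT_comp _ _ _ _ _ _ (fun x : R => x `^ p) _ _ (measurable_powR p) mna). Qed.

Let iX : m.-integrable D (fun z => (`|X z.1 z.2| ^+ 2)%:E).
Proof.
have mX2 : measurable_fun D (fun z => (`|X z.1 z.2| ^+ 2)%:E).
  by apply/measurable_EFinP; exact: measurable_funX.
apply/integrableP; split => //.
under eq_integral do rewrite gee0_abs ?lee_fin ?exprn_ge0//.
rewrite -(@iterated_integral_prod _ _ _ P _ (fun r w => (`|X r w| ^+ 2)%:E) mts mX2).
  by case: mX.
by move=> r w _; rewrite lee_fin exprn_ge0.
Qed.

Let ia : m.-integrable D (fun z => (`|a z.1 z.2| `^ p)%:E).
Proof.
have ma2 : measurable_fun D (fun z => (`|a z.1 z.2| `^ p)%:E).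
  exact/measurable_EFinP.
apply/integrableP; split => //.
under eq_integral do rewrite gee0_abs ?lee_fin ?powR_ge0//.
rewrite -(@iterated_integral_prod _ _ _ P _ (fun r w => (`|a r w| `^ p)%:E) mts ma2).
  by case: aP.
by move=> r w _; rewrite lee_fin powR_ge0.
Qed.

Let icst c : m.-integrable D (fun=> c%:E).
Proof.
apply/integrableP; split => //.
rewrite -(@iterated_integral_prod _ _ _ P _ (fun _ _ => `|c%:E|%E) mts)//.
have hin : (\int[mu]_(r in `[t, T]) `|c%:E| = (`|c| * (T - t))%:E)%E.
  exact: integral_itv_cst.
rewrite hin (_ : (\int[P]_w _)%E = ((`|c| * (T - t))%:E * P setT)%E).
  by rewrite probability_setT mule1 ltry.
exact: integral_cst.
Qed.

(** A common integrable majorant, up to constants, of the running cost and of the drift: first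
    powers are bounded by [1] plus squares, and [|a| ^+ 2] by [1 + |a| ^ p] because [p > 2]. *)
Let dom z : R := 3 + `|X z.1 z.2| ^+ 2 + `|a z.1 z.2| `^ p.

Let idom : m.-integrable D (EFin \o dom).
Proof.
have := integrableD mD (integrableD mD (icst 3) iX) ia.
by apply: eq_integrable => // z _; rewrite /dom /= !EFinD.
Qed.

Let sqr_le_powR (y : R) : 0 <= y -> y ^+ 2 <= 1 + y `^ p.
Proof.
move=> y0; have [y1|y1] := leP y 1.
  have : y ^+ 2 <= 1 by rewrite expr_le1.
  by have := powR_ge0 y p; lra.
have : y `^ 2%:R <= y `^ p by apply: ler_powR; [exact: ltW|exact: ltW].
by rewrite powR_mulrn//; lra.
Qed.

Let sum_le_dom z : 1 + `|X z.1 z.2| + `|a z.1 z.2| ^+ 2 <= dom z.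
Proof.
rewrite /dom; have := sqr_le_powR (normr_ge0 (a z.1 z.2)).
by have := sqr_ge0 (`|X z.1 z.2| - 1); rewrite sqrrB; have := sqr_ge0 `|X z.1 z.2|; lra.
Qed.

Lemma measurable_running_cost : measurable_fun D (fun z => l (X z.1 z.2, a z.1 z.2)).
Proof.
apply/borel_on_measurable_fun => //.
apply: (borel_on_within (f := fun z => (X z.1 z.2, a z.1 z.2)) cont_l).
  by move=> z Dz; split => //=; exact: aLam0.
exact: (borel_on_pair sepH sepLam sm bX ba).
Qed.

Lemma integrable_running_cost :
  m.-integrable D (fun z => (l (X z.1 z.2, a z.1 z.2))%:E).
Proof.
have iCdom := integrableZl mD C idom.
apply: le_integrable iCdom => //.
  by apply/measurable_EFinP; exact: measurable_running_cost.
move=> z Dz /=; rewrite lee_fin; apply: le_trans (ler_norm _).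
apply: le_trans (growth_l _ (aLam0 Dz)) _.
by apply: ler_wpM2l; [exact: ltW|exact: sum_le_dom].
Qed.

Let TTi : `[t, T]%classic T.
Proof. by rewrite /= in_itv /= tT lexx. Qed.

Let measurable_terminal : measurable_fun setT (fun w => g (X T w)).
Proof.
have cg : continuous g.
  move=> y; apply/cvgrPdist_le => e e0.
  have eC : 0 < e / C by rewrite divr_gt0.
  have /cvgrPdist_le/(_ _ eC) hid : id z @[z --> y] --> y by exact: cvg_id.
  apply: filterS hid => z hz; apply: le_trans (lip_g _ _) _.
  by rewrite mulrC -ler_pdivlMr.
have mgX : measurable_fun D (fun z => (g (X z.1 z.2))%:E).
  apply/measurable_EFinP; apply/borel_on_measurable_fun => //.
  exact: (borel_on_comp cg bX).
apply/measurable_EFinP.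
exact: (@measurable_fun_section2 _ _ _ _ (fun r w => (g (X r w))%:E) mts mgX T TTi).
Qed.

Let mnXT : measurable_fun setT (fun w => `|X T w|).
Proof.
have h : measurable_fun D (fun z => `|X z.1 z.2|%:E) by exact/measurable_EFinP.
apply/measurable_EFinP.
exact: (@measurable_fun_section2 _ _ _ _ (fun r w => `|X r w|%:E) mts h T TTi).
Qed.

Let norm_drift_le r w : `|b (X r w, a r w)| <= (`|b 0| + Cb) * dom (r, w).
Proof.
apply: (@le_trans _ _ (`|b 0| + Cb * (`|X r w| + `|a r w|))).
  have -> : b (X r w, a r w) = b 0 + (b (X r w, a r w) - b 0) by rewrite addrC subrK.
  apply: le_trans (ler_normD _ _) _; rewrite lerD2l; apply: le_trans (lip_b _ _) _.
  apply: ler_wpM2l => //; rewrite subr0 prod_normE /= ge_max.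
  by rewrite lerDl lerDr !normr_ge0.
have h : 1 + `|X r w| + `|a r w| <= dom (r, w).
  rewrite /dom /=; have := sqr_le_powR (normr_ge0 (a r w)).
  have := sqr_ge0 (`|X r w| - 1); have := sqr_ge0 (`|a r w| - 1); rewrite !sqrrB.
  by have := sqr_ge0 `|X r w|; have := sqr_ge0 `|a r w|; lra.
have b0 : 0 <= `|b 0| by [].
have X0 : 0 <= `|X r w| by [].
have a0 : 0 <= `|a r w| by [].
apply: (@le_trans _ _ ((`|b 0| + Cb) * (1 + `|X r w| + `|a r w|))).
  have := mulr_ge0 b0 X0; have := mulr_ge0 b0 a0; move: Cb0 b0; lra.
by apply: ler_wpM2l h; rewrite addr_ge0.
Qed.

Let dom0 r w : 0 <= dom (r, w).
Proof. by rewrite /dom !addr_ge0// ?powR_ge0// exprn_ge0. Qed.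

(** A mild solution is square integrable only after integration in time. At [T] the equation itself
    is used: the initial datum contracts, the drift is dominated pathwise by the integral of [dom],
    and the Ito integral is in [L^2]. *)
Lemma integrable_norm_terminal : P.-integrable setT (fun w => `|X T w|%:E).
Proof.
have TT : t <= T <= T by rewrite tT lexx.
have [_ _ _ /(_ T TT)[B [I [hB hI hX]]]] := mX.
have [_ mI jI] := is_ito_integral_approx refW tT (lexx T) hI.
have sO := @sigma_algebra_measurable _ Omega.
have mI2 : measurable_fun setT (fun w => `|I w| ^+ 2) by exact: borel_on_sqnorm.
have I2fin : (\int[P]_w (`|I w| ^+ 2)%:E < +oo)%E.
  (* One elementary approximation at accuracy [1] suffices, elementary integrals being square
     integrable. *)
  have [n [e [ad _ B1]]] := jI _ (@ltr01 R).
  have bE := borel_on_elementary_integral sepH refW (lexx T) ad.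
  have [/integrableP[_ iE] _] := expectation_sqnorm_elementary_integral refW (lexx T) ad.
  apply: (@le_lt_trans _ _
    (2%:E * \int[P]_w (`|I w - elementary_integral W n e w|%R ^+ 2)%:E +
     2%:E * \int[P]_w (`|elementary_integral W n e w|%R ^+ 2)%:E)%E).
    apply: ge0_integral_le2 => //.
    - by apply: borel_on_sqnorm => //; exact: borel_onB.
    - exact: borel_on_sqnorm.
    - by move=> w _; apply: le_trans (sqnormD_le _ _); rewrite subrK.
  apply: lte_add_pinfty; apply: lte_mul_pinfty; rewrite ?lee_fin//.
    by apply: (le_lt_trans B1); rewrite ltry.
  by move: iE; under eq_integral do rewrite gee0_abs ?lee_fin ?exprn_ge0//.
have mdom : measurable_fun D (fun z => ((`|b 0| + Cb) * dom (z.1, z.2))%:E).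
  apply/measurable_EFinP; apply: measurable_funM => //.
  have := measurable_int m idom => /measurable_EFinP.
  by apply: eq_measurable_fun => -[].
have K0 : 0 <= `|b 0| + Cb by rewrite addr_ge0.
have kdom0 r w : (0 <= ((`|b 0| + Cb) * dom (r, w))%:E)%E.
  by rewrite lee_fin mulr_ge0.
pose V w := (\int[mu]_(r in `[t, T]) ((`|b 0| + Cb) * dom (r, w))%:E)%E.
have V0 w : (0 <= V w)%E by apply: integral_ge0 => r _; exact: kdom0.
have mV : measurable_fun setT V.
  exact: (@measurable_fun_integral1 _ _ _ _ (fun r w => ((`|b 0| + Cb) * dom (r, w))%:E)
    mts mdom (fun r w _ => kdom0 r w)).
have Vfin : (\int[P]_w V w < +oo)%E.
  rewrite /V (@iterated_integral_prod _ _ _ P _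
    (fun r w => ((`|b 0| + Cb) * dom (r, w))%:E) mts mdom (fun r w _ => kdom0 r w)).
  have /integrableP[_] := integrableZl mD (`|b 0| + Cb) idom.
  apply: le_lt_trans; apply: ge0_le_integral_nonmeasurable => -[r w] _ //=.
  by rewrite lee_fin ler_norm.
have mI2E : measurable_fun setT (fun w => (`|I w| ^+ 2)%:E) by exact/measurable_EFinP.
have c1 : (0 <= (`|x| + 1)%:E)%E by rewrite lee_fin addr_ge0.
have VI0 w : (0 <= V w + (`|I w| ^+ 2)%:E)%E.
  by apply: adde_ge0 => //; rewrite lee_fin exprn_ge0.
apply/integrableP; split; first exact/measurable_EFinP.
(* The added [1] comes from [|I w| <= 1 + |I w| ^+ 2]. *)
apply: (@le_lt_trans _ _ (\int[P]_w ((`|x| + 1)%:E + (V w + (`|I w| ^+ 2)%:E)))%E).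
  apply: ae_ge0_le_integral => //.
  - by apply/measurable_EFinP; exact: measurableT_comp.
  - by move=> w _; exact: adde_ge0.
  - by apply: emeasurable_funD => //; exact: emeasurable_funD.
  apply: filterS2 hB hX => w hBw hXw _.
  have hb := bochner_approx_le sepH (is_bochner_integral_approx hBw).
  have hBV : (`|B w|%:E <= V w)%E.
    apply: (le_trans hb); apply: ge0_le_integral_nonmeasurable => r; first by [].
    rewrite /= in_itv/= => /andP[tr rT]; rewrite lee_fin.
    apply: le_trans (norm_drift_le r w).
    by case: semiS => _ _ _ _; apply; rewrite subr_ge0.
  rewrite gee0_abs ?lee_fin// hXw.
  apply: (@le_trans _ _ ((`|x| + 1)%:E + (`|B w|%:E + (`|I w| ^+ 2)%:E))%E); last first.
    by apply: leeD => //; exact: leeD.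
  rewrite -!EFinD lee_fin.
  apply: le_trans (ler_normD _ _) _; apply: le_trans (lerD (ler_normD _ _) (lexx _)) _.
  have hS : `|S (T - t) x| <= `|x|.
    by case: semiS => _ _ _ _; apply; rewrite subr_ge0.
  have := sqr_ge0 (`|I w| - 1); rewrite sqrrB.
  have := sqr_ge0 `|I w|; lra.
have mVI : measurable_fun setT (fun w => V w + (`|I w| ^+ 2)%:E)%E.
  exact: emeasurable_funD.
have I20 w : (0 <= (`|I w| ^+ 2)%:E)%E by rewrite lee_fin exprn_ge0.
rewrite (ge0_integralD P)// (ge0_integralD P)//.
apply: lte_add_pinfty; last exact: lte_add_pinfty.
rewrite (_ : (\int[P]_w _)%E = ((`|x| + 1)%:E * P setT)%E).
  by rewrite probability_setT mule1 ltry.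
exact: integral_cst.
Qed.

Lemma integrable_terminal_cost : P.-integrable setT (fun w => (g (X T w))%:E).
Proof.
apply: (@integrable_le _ _ _ P _ (fun w => `|g 0| + C * `|X T w|)) => //.
  move=> w; have -> : g (X T w) = g 0 + (g (X T w) - g 0) by rewrite addrC subrK.
  apply: le_trans (ler_normD _ _) _; rewrite lerD2l.
  by apply: le_trans (lip_g _ _) _; rewrite subr0.
have := integrableD measurableT (finite_measure_integrable_cst P `|g 0| measurableT)
  (integrableZl measurableT C integrable_norm_terminal).
by apply: eq_integrable => // w _; rewrite /= EFinD EFinM.
Qed.

(** [l] has no sign, so passing from the iterated integral to the product needs integrability; that
    of both parts also allows running and terminal cost to be estimated separately. *)
Lemma costE : cost P t T l g a X =
  ((\int[m]_(z in D) l (X z.1 z.2, a z.1 z.2)) + (\int[P]_w g (X T w)))%R%:E.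
Proof.
have iL := integrable_running_cost.
rewrite EFinD !EFin_Rintegral//; last exact: integrable_terminal_cost.
pose f := (fun z => (l (X z.1 z.2, a z.1 z.2))%:E) \_ D.
have iF : m.-integrable setT f by apply/(integrable_mkcond _ mD).
have fG w : fubini_G mu f w = (\int[mu]_(r in `[t, T]) (l (X r w, a r w))%:E)%E.
  rewrite [RHS]integral_mkcond /fubini_G; apply: eq_integral => r _.
  rewrite /f /patch; case: ifPn => [/set_mem/= [Dr _]|].
    by rewrite mem_set.
  by rewrite notin_setE => h; rewrite memNset// => Dr; apply: h.
have mG : measurable_fun setT (fubini_G mu f) by exact: (measurable_fubini_G iF).
have iG : P.-integrable setT (fubini_G mu f).
  apply/integrableP; split => //.
  have mf := measurable_int m iF.
  apply: le_lt_trans ((integrable21ltyP mu P mf).1 iF).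
  apply: ge0_le_integral_nonmeasurable => // w _; apply: le_abse_integral => //.
  exact: measurableT_comp mf (pair2_measurable w).
have -> : (\int[m]_(z in D) (l (X z.1 z.2, a z.1 z.2))%:E = \int[P]_w fubini_G mu f w)%E.
  by rewrite (integral21_prod_meas1 iF) [LHS]integral_mkcond.
rewrite -integralD//; last exact: integrable_terminal_cost.
by apply: eq_integral => w _; rewrite fG.
Qed.

End cost_of_mild_solution.

(** * Convexity under integrals and infima *)

Section convexity.
Context {R : realType}.

Lemma convex_functionP (E : lmodType R) (D : set E) (f : E -> R) k u v :
  convex_function D f -> 0 <= k <= 1 -> D u -> D v ->
  f (k *: u + (1 - k) *: v) <= k * f u + (1 - k) * f v.
Proof.
move=> cf /andP[k0 k1] Du Dv.
by have := cf (Itv01 k0 k1) u v (mem_set Du) (mem_set Dv).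
Qed.

Lemma convex_setP (E : lmodType R) (D : set E) k u v :
  convex_set D -> 0 <= k <= 1 -> D u -> D v -> D (k *: u + (1 - k) *: v).
Proof.
move=> cD /andP[k0 k1] Du Dv; apply/set_mem.
by have := cD u v (Itv01 k0 k1) (mem_set Du) (mem_set Dv).
Qed.

(* With [+oo + -oo = -oo] the inequality says nothing on the infima separately,
   so finiteness of both has to be recovered from that of [v]. *)
Lemma ereal_inf_conv_le (A : set R) (B : set R) (v : \bar R) (k : R) : 0 < k < 1 ->
  A !=set0 -> B !=set0 ->
  (forall x y, A x -> B y -> (v <= (k * x + (1 - k) * y)%:E)%E) ->
  (v <= k%:E * ereal_inf (EFin @` A) + (1 - k)%:E * ereal_inf (EFin @` B))%E.
Proof.
move=> /andP[k0 k1] [x0 Ax0] [y0 By0].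
have k1' : 0 < 1 - k by rewrite subr_gt0.
case: v => [v| |] h; last by rewrite leNye.
(* One fixed [y] bounds the infimum of [A] from below by a real number and [x0] bounds it from
   above, so it is finite; the same then follows for [B]. *)
- have hA y : B y -> (((v - (1 - k) * y) / k)%:E <= ereal_inf (EFin @` A))%E.
    move=> By; apply: le_ereal_inf_tmp => _ [x Ax <-].
    by rewrite lee_fin ler_pdivrMr//; have := h _ _ Ax By; rewrite lee_fin; lra.
  have uA : (ereal_inf (EFin @` A) <= x0%:E)%E by apply: ereal_inf_lbound; exists x0.
  have := hA _ By0; move: hA uA; case: (ereal_inf (EFin @` A)) => [r1| |]// hA _ _.
  have hB : (((v - k * r1) / (1 - k))%:E <= ereal_inf (EFin @` B))%E.
    apply: le_ereal_inf_tmp => _ [y By <-].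
    have := hA _ By; rewrite !lee_fin ler_pdivrMr// ler_pdivrMr//.
    by lra.
  have uB : (ereal_inf (EFin @` B) <= y0%:E)%E by apply: ereal_inf_lbound; exists y0.
  move: hB uB; case: (ereal_inf (EFin @` B)) => [r2| |]// + _.
  by rewrite -!EFinM -EFinD !lee_fin ler_pdivrMr//; lra.
- by have := h _ _ Ax0 By0.
Qed.

(** Pointwise convexity holds only up to [C * y], the Lipschitz price of replacing the solution by a
    combination of two others; since [y] integrates to zero, the error disappears. *)
Lemma Rintegral_conv_le {d : measure_display} {U : measurableType d}
    (m : {measure set U -> \bar R}) (D : set U) (f f1 f2 y : U -> R) k C :
  measurable D -> m.-integrable D (EFin \o f) ->
  m.-integrable D (EFin \o f1) -> m.-integrable D (EFin \o f2) ->
  measurable_fun D y -> (forall z, 0 <= y z) ->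
  (\int[m]_(z in D) (y z)%:E = 0)%E ->
  (forall z, D z -> f z <= k * f1 z + (1 - k) * f2 z + C * y z) ->
  \int[m]_(z in D) f z <=
    k * (\int[m]_(z in D) f1 z) + (1 - k) * (\int[m]_(z in D) f2 z).
Proof.
move=> mD iF i1 i2 my y0 iy0 h.
have iy : m.-integrable D (EFin \o y).
  apply/integrableP; split; first exact/measurable_EFinP.
  rewrite (_ : (\int[m]_(z in D) _)%E = 0%E) ?ltry// -[RHS]iy0.
  by apply: eq_integral => z _; rewrite gee0_abs ?lee_fin.
have ik1 : m.-integrable D (EFin \o (fun z => k * f1 z)).
  exact: (integrableZl mD k i1).
have ik2 : m.-integrable D (EFin \o (fun z => (1 - k) * f2 z)).
  exact: (integrableZl mD (1 - k) i2).
have iC : m.-integrable D (EFin \o (fun z => C * y z)).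
  exact: (integrableZl mD C iy).
have i12 : m.-integrable D (EFin \o (fun z => k * f1 z + (1 - k) * f2 z)).
  exact: (integrableD mD ik1 ik2).
have i12y : m.-integrable D (EFin \o (fun z => k * f1 z + (1 - k) * f2 z + C * y z)).
  exact: (integrableD mD i12 iC).
have iY : \int[m]_(z in D) y z = 0 by rewrite /Rintegral iy0.
apply: le_trans (le_Rintegral mD iF i12y h) _.
rewrite (RintegralD mD i12 iC) (RintegralD mD ik1 ik2).
by rewrite (RintegralZl k mD i1) (RintegralZl (1 - k) mD i2) (RintegralZl C mD iy) iY mulr0 addr0.
Qed.

End convexity.

Section convex_cost.
Context {R : realType} {d : measure_display} {Omega : measurableType d}
  (P : probability Omega R) {H Xi : hilbertType R}
  {Lam : completeNormedModType R}.
Hypotheses (sepH : separable H) (sepLam : separable Lam).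
Variables (W : R -> Xi -> Omega -> R) (t T p : R).
Hypotheses (tT : t <= T) (hp : 2 < p) (refW : reference_space P W t T).
Variable Lam0 : set Lam.
Hypothesis convLam0 : convex_set Lam0.
Local Notation mu := (@lebesgue_measure R).
Local Notation RT := (measurableTypeR R).
Local Notation adm := (admissible P W t T Lam0 p).

Lemma admissible_conv k a1 a2 : 0 <= k <= 1 -> adm a1 -> adm a2 ->
  adm (fun s w => k *: a1 s w + (1 - k) *: a2 s w).
Proof.
move=> k01 [p1 L1 i1] [p2 L2 i2]; split.
- move=> s tsT; apply: borel_onD => //; [exact: smallest_sigma_algebra| |];
    apply: borel_onZl; [exact: p1|exact: p2].
- by move=> s w tsT; apply: convex_setP => //; [exact: L1|exact: L2].
have mn (a : R -> Omega -> Lam) : progressive P W t T a ->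
    measurable_fun (`[t, T]%classic `*` setT : set (RT * Omega)%type)
      (fun z => `|a z.1 z.2| `^ p).
  move=> pa; have ba := progressive_borel_on refW tT (lexx T) (lexx T) pa.
  have mD : measurable (`[t, T]%classic `*` setT : set (RT * Omega)%type).
    exact: (measurableX (measurable_itv `[t, T]) measurableT).
  have mna : measurable_fun (`[t, T]%classic `*` setT : set (RT * Omega)%type)
      (fun z => `|a z.1 z.2|).
    by apply/borel_on_measurable_fun => //; exact: borel_on_norm.
  exact: (@measurableT_comp _ _ _ _ _ _ (fun x : R => x `^ p) _ _ (measurable_powR p) mna).
apply: (@le_lt_trans _ _
  (1%:E * \int[P]_w \int[mu]_(s in `[t, T]) (`|a1 s w| `^ p)%:E +
   1%:E * \int[P]_w \int[mu]_(s in `[t, T]) (`|a2 s w| `^ p)%:E)%E).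
  apply: (iterated_integral_le2 P (u := fun s w => `|k *: a1 s w + (1 - k) *: a2 s w| `^ p)
    (v := fun s w => `|a1 s w| `^ p) (w := fun s w => `|a2 s w| `^ p)) => //.
  - exact: mn.
  - exact: mn.
  move=> s w _; rewrite !mul1r; move: (a1 s w) (a2 s w) => u v.
  have /andP[k0 k1] := k01.
  (* The maximum is enough for finiteness: its [p]-th power is at most the sum of the two [p]-th
     powers. *)
  have h : `|k *: u + (1 - k) *: v| <= Num.max `|u| `|v|.
    apply: le_trans (ler_normD _ _) _; rewrite !normrZ ger0_norm// ger0_norm ?subr_ge0//.
    rewrite [leRHS](_ : _ = k * Num.max `|u| `|v| + (1 - k) * Num.max `|u| `|v|); last by ring.
    by apply: lerD; apply: ler_wpM2l; rewrite ?subr_ge0// le_max lexx ?orbT.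
  have p0 : 0 <= p by rewrite ltW// (lt_trans _ hp).
  apply: (@le_trans _ _ (Num.max `|u| `|v| `^ p)).
    by apply: ge0_ler_powR => //; rewrite nnegrE ?le_max normr_ge0.
  have u0 := powR_ge0 `|u| p; have v0 := powR_ge0 `|v| p.
  by case: (leP `|u| `|v|) => _; rewrite ?lerDl ?lerDr.
have one0 : (0 <= 1%:E :> \bar R)%E by rewrite lee_fin.
by apply: lte_add_pinfty; [exact: lte_mul_pinfty i1|exact: lte_mul_pinfty i2].
Qed.


Variable S : R -> H -> H.
Hypothesis semiS : c0_contraction_semigroup S.
Variables (b : H * Lam -> H) (sigma : H * Lam -> Xi -> H).
Hypotheses (affine_b : affine b) (cont_b : continuous b)
  (affine_sigma : forall xi, affine (fun u => sigma u xi))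
  (cont_sigma : hs_continuous sigma).
Variables (l : H * Lam -> R) (g : H -> R) (C : R).
Hypothesis cont_l : {within setT `*` Lam0, continuous l}.
Hypothesis C0 : 0 < C.
Hypothesis lip_l :
  forall x x' a, Lam0 a -> `|l (x, a) - l (x', a)| <= C * `|x - x'|.
Hypothesis growth_l :
  forall x a, Lam0 a -> `|l (x, a)| <= C * (1 + `|x| + `|a| ^+ 2).
Hypothesis lip_g : forall x x', `|g x - g x'| <= C * `|x - x'|.
Hypotheses (conv_l : convex_function (setT `*` Lam0) l)
  (conv_g : convex_function setT g).
Local Notation mild := (mild_solution P W t T S b sigma).

(** Lets the infima be taken over sets of real numbers. *)
Lemma cost_finite x a X : adm a -> mild x a X ->
  exists c, cost P t T l g a X = c%:E.
Proof.
move=> aP mX; have [Cb Cb0 lip_b] := affine_continuous_lipschitz affine_b cont_b.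
eexists; exact: (costE sepH sepLam tT hp refW semiS Cb0 lip_b cont_l C0 growth_l lip_g aP mX).
Qed.

Lemma cost_conv_le k x1 x2 a1 a2 X1 X2 X : 0 <= k <= 1 ->
  adm a1 -> adm a2 -> mild x1 a1 X1 -> mild x2 a2 X2 ->
  mild (k *: x1 + (1 - k) *: x2) (fun s w => k *: a1 s w + (1 - k) *: a2 s w) X ->
  (cost P t T l g (fun s w => k *: a1 s w + (1 - k) *: a2 s w)%R X <=
   k%:E * cost P t T l g a1 X1 + (1 - k)%:E * cost P t T l g a2 X2)%E.
Proof.
move=> k01 ad1 ad2 mX1 mX2 mX.
have [Cb Cb0 lip_b] := affine_continuous_lipschitz affine_b cont_b.
have [Cs Cs0 lip_s] := hs_affine_lipschitz affine_sigma cont_sigma.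
pose a s w := k *: a1 s w + (1 - k) *: a2 s w.
have ad : adm a := admissible_conv k01 ad1 ad2.
have aE s w : t <= s <= T -> a s w = k *: a1 s w + (1 - k) *: a2 s w by [].
have cE := costE sepH sepLam tT hp refW semiS Cb0 lip_b cont_l C0 growth_l lip_g.
rewrite (cE _ _ _ _ ad mX) (cE _ _ _ _ ad1 mX1) (cE _ _ _ _ ad2 mX2).
rewrite -!EFinM -EFinD lee_fin.
pose D := (`[t, T]%classic `*` setT : set (RT * Omega)%type).
pose Y := defect k X1 X2 X.
have Y0 := integral_norm_defect_eq0 sepH tT refW semiS affine_b affine_sigma Cb0 Cs0
  lip_b lip_s aE mX1 mX2 mX.
have YT := defect_ae0 sepH tT refW semiS affine_b affine_sigma Cb0 Cs0
  lip_b lip_s aE mX1 mX2 mX.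
have XE s w : X s w - (k *: X1 s w + (1 - k) *: X2 s w) = Y s w.
  by rewrite /Y /defect !scaleNr opprD addrA.
have mts : measurable (`[t, T]%classic : set RT) by exact: measurable_itv.
have mD : measurable D by exact: measurableX.
have mY : measurable_fun D (fun z => `|Y z.1 z.2|).
  apply/borel_on_measurable_fun => //; apply: borel_on_norm.
  have bX Z x a' : mild x a' Z ->
      borel_on (measurable : set (set (RT * Omega)%type)) D (fun z => Z z.1 z.2).
    by case=> pZ _ _ _; exact: (progressive_borel_on refW tT (lexx T) (lexx T) pZ).
  have sm := @sigma_algebra_measurable _ (RT * Omega)%type.
  apply: borel_onD => //; last by apply: borel_onZl; exact: bX mX2.
  by apply: borel_onD => //; [exact: bX mX|apply: borel_onZl; exact: bX mX1].
have run : \int[(mu \x P)%E]_(z in D) l (X z.1 z.2, a z.1 z.2) <=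
    k * (\int[(mu \x P)%E]_(z in D) l (X1 z.1 z.2, a1 z.1 z.2)) +
    (1 - k) * (\int[(mu \x P)%E]_(z in D) l (X2 z.1 z.2, a2 z.1 z.2)).
  have iR x a' Z (aZ : adm a') (mZ : mild x a' Z) :=
    integrable_running_cost sepH sepLam tT hp refW cont_l C0 growth_l aZ mZ.
  have h := @Rintegral_conv_le _ _ _ _ D (fun z => l (X z.1 z.2, a z.1 z.2)) _ _
    (fun z => `|Y z.1 z.2|) k C mD (iR _ _ _ ad mX) (iR _ _ _ ad1 mX1) (iR _ _ _ ad2 mX2)
    mY (fun=> normr_ge0 _) Y0.
  apply: h => // z [Dz _].
  have zT : t <= z.1 <= T by move: Dz; rewrite /= in_itv.
  have [_ /(_ z.1 z.2 zT) L _] := ad.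
  have [_ /(_ z.1 z.2 zT) L1 _] := ad1; have [_ /(_ z.1 z.2 zT) L2 _] := ad2.
  (* The state is replaced by the combination of [X1] and [X2] with the control unchanged; the pairs
     then combine exactly and joint convexity applies. *)
  have := lip_l (X z.1 z.2) (k *: X1 z.1 z.2 + (1 - k) *: X2 z.1 z.2) L.
  rewrite XE => /(le_trans (ler_norm _)); rewrite lerBlDl => /le_trans; apply.
  rewrite lerD2r.
  exact: (convex_functionP (u := (X1 z.1 z.2, a1 z.1 z.2)) (v := (X2 z.1 z.2, a2 z.1 z.2))
    conv_l k01).
have term : \int[P]_w g (X T w) <=
    k * (\int[P]_w g (X1 T w)) + (1 - k) * (\int[P]_w g (X2 T w)).
  have iG x a' Z (mZ : mild x a' Z) (aZ : adm a') :=
    integrable_terminal_cost sepH tT hp refW semiS Cb0 lip_b C0 lip_g aZ mZ.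
  have TTi : `[t, T]%classic T by rewrite /= in_itv /= tT lexx.
  have mYT : measurable_fun setT (fun w => `|Y T w|).
    have h : measurable_fun D (fun z => `|Y z.1 z.2|%:E) by exact/measurable_EFinP.
    apply/measurable_EFinP.
    exact: (@measurable_fun_section2 _ _ _ _ (fun r w => `|Y r w|%:E) mts h T TTi).
  have YT0 : (\int[P]_w `|Y T w|%:E = 0)%E.
    rewrite (ae_eq_integral (cst 0%E))//; [by rewrite integral0|exact/measurable_EFinP|].
    by apply: filterS YT => w + _; rewrite -/Y /= => ->; rewrite normr0.
  have h := @Rintegral_conv_le _ _ _ P setT (fun w => g (X T w)) _ _
    (fun w => `|Y T w|) k C measurableT (iG _ _ _ mX ad) (iG _ _ _ mX1 ad1)
    (iG _ _ _ mX2 ad2) mYT (fun=> normr_ge0 _) YT0.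
  apply: h => w _.
  have := lip_g (X T w) (k *: X1 T w + (1 - k) *: X2 T w).
  rewrite XE => /(le_trans (ler_norm _)); rewrite lerBlDl => /le_trans; apply.
  by rewrite lerD2r; exact: (convex_functionP conv_g k01).
apply: le_trans (lerD run term) _.
by rewrite !mulrDr addrACA.
Qed.

End convex_cost.

Theorem theorem3p15 (R : realType)
  (H Xi : hilbertType R) (Lam : completeNormedModType R)
  (sepH : separable H) (sepXi : separable Xi) (sepLam : separable Lam)
  (Lam0 : set Lam) (convLam0 : convex_set Lam0)
  (p T : R) (hp : 2 < p) (hT : 0 < T)
  (D : set H) (A : H -> H) (S : R -> H -> H)
  (linA : linear_operator D A) (denseA : dense D)
  (dissA : maximal_dissipative D A) (genA : generates D A S)
  (b : H * Lam -> H) (sigma : H * Lam -> Xi -> H)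
  (l : H * Lam -> R) (g : H -> R)
  (cont_l : {within setT `*` Lam0, continuous l})
  (growth : exists2 C : R, 0 < C &
     [/\ forall x x' a, Lam0 a -> `|l (x, a) - l (x', a)| <= C * `|x - x'|,
         forall x a, Lam0 a -> `|l (x, a)| <= C * (1 + `|x| + `|a| ^+ 2)
       & forall x x', `|g x - g x'| <= C * `|x - x'| ])
  (below : ~ bounded_set Lam0 ->
     exists m : R, (forall x a, Lam0 a -> m <= l (x, a)) /\
                   (forall x, m <= g x))
  (affine_b : affine b) (cont_b : continuous b)
  (hs_sigma : forall u, hilbert_schmidt (sigma u))
  (affine_sigma : forall xi, affine (fun u => sigma u xi))
  (cont_sigma : hs_continuous sigma)
  (conv_l : convex_function (setT `*` Lam0) l)
  (conv_g : convex_function setT g)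
  (t : R) (ht : 0 <= t <= T)
  (d : measure_display) (Omega : measurableType d) (P : probability Omega R)
  (W : R -> Xi -> Omega -> R) (refW : reference_space P W t T)
  (X : H -> (R -> Omega -> Lam) -> R -> Omega -> H)
  (solX : forall x a, admissible P W t T Lam0 p a ->
     mild_solution P W t T S b sigma x a (X x a)) :
  convex_efunction (value P W t T Lam0 p l g X).
Proof.
have /andP[_ tT] := ht.
have semiS := genA.1.
have [C C0 [lip_l growth_l lip_g]] := growth.
set adm := admissible P W t T Lam0 p.
pose c x a := cost P t T l g a (X x a).
have valE x : value P W t T Lam0 p l g X x = ereal_inf [set c x a | a in adm] by [].
have cfin x a : adm a -> exists r, c x a = r%:E.
  move=> aP; exact: (cost_finite sepH sepLam tT hp refW semiS affine_b cont_b cont_l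
    C0 growth_l lip_g aP (solX x a aP)).
pose costs x := [set r | exists2 a, adm a & c x a = r%:E].
have costsE x : [set c x a | a in adm] = EFin @` costs x.
  apply/seteqP; split => [_ [a aP <-]|_ [r [a aP cr] <-]].
    by have [r cr] := cfin x a aP; exists r => //; exists a.
  by exists a.
move=> k x y k01; rewrite !valE; have /andP[k0 k1] := k01.
(* Without admissible controls the value is [+oo] everywhere; [k = 0] and [k = 1] need care because
   [0 * +oo = 0]. *)
have [adm0|[a0 a0P]] : adm = set0 \/ adm !=set0.
  by have [->|/set0P] := eqVneq adm set0; [left|right].
  rewrite adm0 !image_set0 ereal_inf0.
  have [->|kn0] := eqVneq k 0; first by rewrite mul0e add0e subr0 mul1e.
  rewrite gt0_muley ?lte_fin ?lt_neqAle 1?eq_sym ?kn0//.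
  have [->|kn1] := eqVneq k 1; first by rewrite subrr mul0e adde0.
  by rewrite gt0_muley ?addye// lte_fin subr_gt0 lt_neqAle kn1.
(* At the endpoints [0 * _ = 0] makes the inequality trivial even for infinite values;
   [ereal_inf_conv_le] is for [0 < k < 1]. *)
have [->|kn0] := eqVneq k 0.
  by rewrite scale0r add0r subr0 scale1r mul0e add0e mul1e.
have [->|kn1] := eqVneq k 1.
  by rewrite subrr scale0r addr0 scale1r mul0e adde0 mul1e.
rewrite (costsE x) (costsE y).
have k01' : 0 < k < 1 by rewrite !lt_neqAle k0 k1 kn1 eq_sym kn0.
apply: ereal_inf_conv_le => //.
(* Admissibility does not depend on the initial datum, so [a0] serves [x] and [y]. *)
- by have [r cr] := cfin x a0 a0P; exists r, a0.
- by have [r cr] := cfin y a0 a0P; exists r, a0.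
move=> r1 r2 [a1 a1P cr1] [a2 a2P cr2].
have aP := admissible_conv sepLam tT hp refW convLam0 k01 a1P a2P.
apply: (@le_trans _ _ (c (k *: x + (1 - k) *: y)
    (fun s w => k *: a1 s w + (1 - k) *: a2 s w))).
  by apply: ereal_inf_lbound; exists (fun s w => k *: a1 s w + (1 - k) *: a2 s w).
rewrite EFinD !EFinM -cr1 -cr2.
exact: (cost_conv_le sepH sepLam tT hp refW convLam0 semiS affine_b cont_b affine_sigma
  cont_sigma cont_l C0 lip_l growth_l lip_g conv_l conv_g k01 a1P a2P
  (solX x a1 a1P) (solX y a2 a2P) (solX _ _ aP)).
Qed.
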